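(* Let $\Bbbk$ be a commutative ring and let $A$ be an associative unital $\Bbbk$-algebra equipped with an isomorphism of $A$-bimodules $\Theta:A\xrightarrow{\cong}A^{\vee}$ (i.e. $A$ is a symmetric algebra). Then: a) The Connes coboundary map on $HH^*(A,A^\vee)$ defines, via the isomorphism $HH^*(A,\Theta):HH^*(A,A)\xrightarrow{\cong}HH^*(A,A^\vee)$, a structure of Batalin-Vilkovisky algebra on the Gerstenhaber algebra $HH^*(A,A)$. b) The cyclic cohomology of $A$, $HC^*(A)$, is a graded Lie algebra of degree $-2$ (with the bracket described in the context).
   Context: **Hochschild cochains.** $A^\vee=\mathrm{Hom}_{\Bbbk}(A,\Bbbk)$ with its usual bimodule structure $(a\cdot f\cdot b)(x)=f(bxa)$. For an $A$-bimodule $M$, $\mathcal C^n(A,M)=\mathrm{Hom}_{\Bbbk}(A^{\otimes n},M)$ is the Hochschild cochain complex with differential $(df)(a_1,\dots,a_{n+1})=a_1f(a_2,\dots,a_{n+1})+\sum_{i=1}^n(-1)^if(a_1,\dots,a_ia_{i+1},\dots,a_{n+1})+(-1)^{n+1}f(a_1,\dots,a_n)a_{n+1}$, and $HH^*(A,M)$ is its cohomology. The normalized subcomplex $\overline{\mathcal C}^*(A,M)$ consists of the $f$ vanishing whenever some argument $a_i$ equals $1$; its inclusion is a cochain homotopy equivalence. **Gerstenhaber structure on $HH^*(A,A)$.** For $f\in\mathcal C^m(A,A)$, $g\in\mathcal C^n(A,A)$: $(f\cup g)(a_1,\dots,a_{m+n})=f(a_1,\dots,a_m)g(a_{m+1},\dots,a_{m+n})$;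 $f\circ_ig$ is the insertion of $g$ in the $i$-th argument of $f$; $f\overline{\circ}g:=(-1)^{(m-1)(n-1)}\sum_{i=1}^m(-1)^{(n-1)(i-1)}f\circ_ig$; $\{f,g\}:=f\overline\circ g-(-1)^{(m-1)(n-1)}g\overline\circ f$. These induce the known Gerstenhaber algebra structure on $HH^*(A,A)$. **Connes coboundary on $HH^*(A,A^\vee)$.** Identify $\mathcal C^n(A,A^\vee)$ with $\mathrm{Hom}(A^{\otimes n+1},\Bbbk)$ by $g\mapsto\big((a_0,\dots,a_n)\mapsto g(a_1,\dots,a_n)(a_0)\big)$. Let $\tau_n$ be the dual of $t_n(a_0,\dots,a_n)=(a_n,a_0,\dots,a_{n-1})$; this makes $\mathcal C^*(A,A^\vee)$ a cocyclic module. For $n\ge1$ and $F$ normalized of degree $n$, $\sigma_nF(a_0,\dots,a_{n-1}):=F(1,a_0,\dots,a_{n-1})$ and $$BF:=\sum_{i=0}^{n-1}(-1)^{i(n-1)}\tau_{n-1}^i\,\sigma_nF;$$ $B=0$ in degree $0$. The Connes coboundary is the induced map $B:HH^n(A,A^\vee)\to HH^{n-1}(A,A^\vee)$; the corresponding map on $HH^*(A,A)$ is $HH^*(A,\Theta)^{-1}\circ B\circ HH^*(A,\Theta)$. **Gerstenhaber and Batalin-Vilkovisky algebras.** A Gerstenhaber algebra is a graded module $G=\{G^i\}_{i\in\mathbb Z}$ with a graded commutative algebra structure $\cup:G^i\otimes G^j\to G^{i+j}$ and a linear map $\{-,-\}:G^i\otimes G^j\to G^{i+j-1}$ such that $\{a,b\}=-(-1)^{(|a|-1)(|b|-1)}\{b,a\}$,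 $\{a,\{b,c\}\}=\{\{a,b\},c\}+(-1)^{(|a|-1)(|b|-1)}\{b,\{a,c\}\}$ and $\{a,bc\}=\{a,b\}c+(-1)^{|b|(|a|-1)}b\{a,c\}$. A Batalin-Vilkovisky algebra is a Gerstenhaber algebra $G$ with a linear map $B:G^i\to G^{i-1}$ such that $B\circ B=0$ and $\{a,b\}=(-1)^{|a|}\big(B(a\cup b)-(Ba)\cup b-(-1)^{|a|}a\cup(Bb)\big)$. **Cyclic cohomology.** $HC^*(A)$ is the cohomology of the complex $\mathrm{Tot}^n=\bigoplus_{k\ge0}\overline{\mathcal C}^{\,n+2k}(A,A^\vee)$ ($n\in\mathbb Z$, with $\overline{\mathcal C}^i=0$ for $i<0$) with differential $(c_0,c_1,\dots)\mapsto(dc_0+Bc_1,\,dc_1+Bc_2,\dots)$. (This is the homology of the complex $M_n\oplus M_{n-2}\oplus\cdots$ of the mixed complex $M_n:=\overline{\mathcal C}^{-n}(A,A^\vee)$.) There are maps $I:HH^n(A,A^\vee)\to HC^n(A)$, $[c]\mapsto[(c,0,0,\dots)]$, and $\partial:HC^n(A)\to HH^{n-1}(A,A^\vee)$, $[(c_0,c_1,\dots)]\mapsto[Bc_0]$. Transporting the cup product of $HH^*(A,A)$ to $HH^*(A,A^\vee)$ by $HH^*(A,\Theta)$, the bracket is $[a,b]:=(-1)^{|a|}I(\partial a\cup\partial b)$. **Graded Lie algebra of degree $-2$.** A graded module $L$ with a linear map $[-,-]:L^i\otimes L^j\to L^{i+j-2}$ satisfying $[a,b]=-(-1)^{|a||b|}[b,a]$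 and $[a,[b,c]]=[[a,b],c]+(-1)^{|a||b|}[b,[a,c]]$. *)

(* Defs.v *)
From HB Require Import structures.
From mathcomp Require Import all_boot all_order all_algebra.
From mathcomp Require Import all_classical.
From mathcomp Require Import zify.

Set Implicit Arguments.
Unset Strict Implicit.
Unset Printing Implicit Defensive.

Import GRing.Theory.
Local Open Scope ring_scope.
Local Open Scope quotient_scope.

(* (-1)^i for an integer i; only the parity of i matters. *)
Definition sgn (k : comPzRingType) (i : int) : k := (-1) ^+ `|i|%N.
Arguments sgn {k} i.

Definition regrade (k : comPzRingType) (G : int -> lmodType k) (i j : int)
    (e : i = j) (x : G i) : G j :=
  ecast n (G n : Type) e x.
Arguments regrade {k} G {i j} e x.

Lemma deg_brC (i j : int) : j + i - 1 = i + j - 1. Proof. lia. Qed.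
Lemma deg_brA (i j l : int) : i + j - 1 + l - 1 = i + (j + l - 1) - 1.
Proof. lia. Qed.
Lemma deg_brCA (i j l : int) : j + (i + l - 1) - 1 = i + (j + l - 1) - 1.
Proof. lia. Qed.
Lemma deg_br_cup (i j l : int) : i + j - 1 + l = i + (j + l) - 1.
Proof. lia. Qed.
Lemma deg_cup_br (i j l : int) : j + (i + l - 1) = i + (j + l) - 1.
Proof. lia. Qed.
Lemma deg_B_cup (i j : int) : i - 1 + j = i + j - 1. Proof. lia. Qed.
Lemma deg_cup_B (i j : int) : i + (j - 1) = i + j - 1. Proof. lia. Qed.
Lemma deg_lieC (i j : int) : j + i - 2 = i + j - 2. Proof. lia. Qed.
Lemma deg_lieA (i j l : int) : i + j - 2 + l - 2 = i + (j + l - 2) - 2.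
Proof. lia. Qed.
Lemma deg_lieCA (i j l : int) : j + (i + l - 2) - 2 = i + (j + l - 2) - 2.
Proof. lia. Qed.
Lemma deg_lie (i j : int) : i - 1 + (j - 1) = i + j - 2. Proof. lia. Qed.

Section GradedStructures.
Variables (k : comPzRingType) (G : int -> lmodType k).

Definition graded_linear (p : int -> int) (f : forall i, G i -> G (p i)) : Prop :=
  forall i (c : k) (a a' : G i), f i (c *: a + a') = c *: f i a + f i a'.

Definition graded_bilinear (p : int -> int -> int)
    (m : forall i j, G i -> G j -> G (p i j)) : Prop :=
  (forall i j (c : k) (a a' : G i) (b : G j),
      m i j (c *: a + a') b = c *: m i j a b + m i j a' b) /\
  (forall i j (c : k) (a : G i) (b b' : G j),
      m i j a (c *: b + b') = c *: m i j a b + m i j a b').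

Record graded_comm_algebra (one : G 0)
    (cup : forall i j, G i -> G j -> G (i + j)) : Prop := {
  cup_bilinear : graded_bilinear cup;
  cupA : forall i j l (a : G i) (b : G j) (c : G l),
    regrade G (addrA i j l) (cup _ _ a (cup _ _ b c)) = cup _ _ (cup _ _ a b) c;
  cup1l : forall i (a : G i), regrade G (add0r i) (cup _ _ one a) = a;
  cup1r : forall i (a : G i), regrade G (addr0 i) (cup _ _ a one) = a;
  cupC : forall i j (a : G i) (b : G j),
    cup _ _ a b = sgn (i * j) *: regrade G (addrC j i) (cup _ _ b a)
}.

Record gerstenhaber_algebra (one : G 0)
    (cup : forall i j, G i -> G j -> G (i + j))
    (br : forall i j, G i -> G j -> G (i + j - 1)) : Prop := {
  gerst_comm_algebra : graded_comm_algebra one cup;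
  br_bilinear : graded_bilinear br;
  brC : forall i j (a : G i) (b : G j),
    br _ _ a b =
      - (sgn ((i - 1) * (j - 1)) *: regrade G (deg_brC i j) (br _ _ b a));
  br_jacobi : forall i j l (a : G i) (b : G j) (c : G l),
    br _ _ a (br _ _ b c) =
      regrade G (deg_brA i j l) (br _ _ (br _ _ a b) c) +
      sgn ((i - 1) * (j - 1)) *:
        regrade G (deg_brCA i j l) (br _ _ b (br _ _ a c));
  br_poisson : forall i j l (a : G i) (b : G j) (c : G l),
    br _ _ a (cup _ _ b c) =
      regrade G (deg_br_cup i j l) (cup _ _ (br _ _ a b) c) +
      sgn (j * (i - 1)) *:
        regrade G (deg_cup_br i j l) (cup _ _ b (br _ _ a c))
}.

Record BV_algebra (one : G 0)
    (cup : forall i j, G i -> G j -> G (i + j))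
    (br : forall i j, G i -> G j -> G (i + j - 1))
    (B : forall i, G i -> G (i - 1)) : Prop := {
  BV_gerstenhaber : gerstenhaber_algebra one cup br;
  BV_linear : graded_linear B;
  BV_square : forall i (a : G i), B _ (B _ a) = 0;
  BV_bracket : forall i j (a : G i) (b : G j),
    br _ _ a b = sgn i *:
      (B _ (cup _ _ a b)
       - regrade G (deg_B_cup i j) (cup _ _ (B _ a) b)
       - sgn i *: regrade G (deg_cup_B i j) (cup _ _ a (B _ b)))
}.

Record graded_lie_algebra_m2
    (br : forall i j, G i -> G j -> G (i + j - 2)) : Prop := {
  lie_bilinear : graded_bilinear br;
  lieC : forall i j (a : G i) (b : G j),
    br _ _ a b = - (sgn (i * j) *: regrade G (deg_lieC i j) (br _ _ b a));
  lie_jacobi : forall i j l (a : G i) (b : G j) (c : G l),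
    br _ _ a (br _ _ b c) =
      regrade G (deg_lieA i j l) (br _ _ (br _ _ a b) c) +
      sgn (i * j) *: regrade G (deg_lieCA i j l) (br _ _ b (br _ _ a c))
}.

End GradedStructures.

(* The quotient of a module by a submodule: the library equips the underlying
   quotient of additive groups with its Z-module structure only. *)
Section ModuleQuotient.
Variables (k : pzRingType) (V : lmodType k) (I : submodClosed V).

Definition mquot_pred : {pred V} := I.
Let mquot_pred_zmod : zmod_closed mquot_pred.
Proof.
split; first exact: (rpred0 I).
by move=> x y xI yI; rewrite -scaleN1r; apply: (@rpredD V I); [|apply: rpredZ].
Qed.
HB.instance Definition _ :=
  GRing.isZmodClosed.Build V mquot_pred mquot_pred_zmod.

Definition mquot : Type := Quotient.quot mquot_pred.
HB.instance Definition _ := GRing.Zmodule.on mquot.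

Let pi (x : V) : mquot := \pi_(Quotient.quot mquot_pred) x.
Let mscale (c : k) (x : mquot) : mquot := pi (c *: repr (x : Quotient.quot mquot_pred)).

Let piD x y : pi (x + y) = pi x + pi y.
Proof. exact: (raddfD (\pi_(Quotient.quot mquot_pred))). Qed.

Let pi_eq x y : (x - y \in mquot_pred) = (pi x == pi y).
Proof. by rewrite Quotient.idealrBE. Qed.

Let mscale_pi c x : mscale c (pi x) = pi (c *: x).
Proof.
apply/eqP; rewrite /mscale -pi_eq -scalerBr.
have h : repr (\pi_(Quotient.quot mquot_pred) x) - x \in mquot_pred.
  by rewrite pi_eq /pi reprK.
exact: (@rpredZ k V I c _ h).
Qed.

Let piP (x : mquot) : exists y, x = pi y.
Proof. by exists (repr (x : Quotient.quot mquot_pred)); rewrite /pi reprK. Qed.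

Let mscaleA a b x : mscale a (mscale b x) = mscale (a * b) x.
Proof. by have [y ->] := piP x; rewrite !mscale_pi scalerA. Qed.
Let mscale1 : left_id 1 mscale.
Proof. by move=> x; have [y ->] := piP x; rewrite mscale_pi scale1r. Qed.
Let mscaleDr : right_distributive mscale +%R.
Proof.
move=> a x y; have [u ->] := piP x; have [v ->] := piP y.
by rewrite -piD !mscale_pi scalerDr piD.
Qed.
Let mscaleDl x : {morph mscale^~ x : a b / a + b}.
Proof.
by move=> a b; have [u ->] := piP x; rewrite !mscale_pi scalerDl piD.
Qed.
HB.instance Definition _ := GRing.Zmodule_isLmodule.Build k mquot
  mscaleA mscale1 mscaleDr mscaleDl.

End ModuleQuotient.

(* A complex is given inside an ambient module [cpx_ambient]: its degree n part
   is the submodule [cpx_deg n] and all components of the differential are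
   restrictions of one map. Cohomology in degree n is the quotient of the module
   of n-cocycles by the submodule of those that are differentials of
   (n-1)-cochains. *)
Record complex (k : comPzRingType) := Complex {
  cpx_ambient : lmodType k;
  cpx_deg : int -> cpx_ambient -> Prop;
  cpx_d : cpx_ambient -> cpx_ambient;
  cpx_deg0 : forall n, cpx_deg n 0;
  cpx_degP : forall n c x y,
    cpx_deg n x -> cpx_deg n y -> cpx_deg n (c *: x + y);
  cpx_d_linear : forall n c x y, cpx_deg n x -> cpx_deg n y ->
    cpx_d (c *: x + y) = c *: cpx_d x + cpx_d y
}.

Section Cohomology.
Variables (k : comPzRingType) (C : complex k) (n : int).
Local Notation V := (cpx_ambient C).

Definition cocycle : {pred V} :=
  [pred x : V | `[< cpx_deg n x /\ cpx_d x = 0 >]].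

Lemma cocycleP x : reflect (cpx_deg n x /\ cpx_d x = 0) (x \in cocycle).
Proof. exact: asboolP. Qed.

Let d0 : cpx_d (0 : V) = 0.
Proof.
have := cpx_d_linear (-1) (cpx_deg0 C n) (cpx_deg0 C n).
by rewrite scaleN1r addNr scaleN1r addNr.
Qed.

Lemma cocycle_submod : submod_closed cocycle.
Proof.
split; first by apply/cocycleP; split; [exact: cpx_deg0 | exact: d0].
move=> c x y /cocycleP[xn dx] /cocycleP[yn dy]; apply/cocycleP.
by split; [exact: cpx_degP|rewrite (cpx_d_linear c xn yn) dx dy scaler0 addr0].
Qed.
HB.instance Definition _ := GRing.isSubmodClosed.Build k V cocycle cocycle_submod.

Record cocycles : Type := Cocycle { cocycle_val : V; _ : cocycle_val \in cocycle }.
HB.instance Definition _ := [isSub for cocycle_val].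
HB.instance Definition _ := [Choice of cocycles by <:].
HB.instance Definition _ := [SubChoice_isSubLmodule of cocycles by <:].

Definition coboundary : {pred cocycles} :=
  [pred z : cocycles | `[< exists2 y : V, cpx_deg (n - 1) y & val z = cpx_d y >]].

Lemma coboundary_submod : submod_closed coboundary.
Proof.
split.
  by apply/asboolP; exists 0; [exact: cpx_deg0 | rewrite raddf0 d0].
move=> c x y /asboolP[u un xu] /asboolP[v vn yv]; apply/asboolP.
exists (c *: u + v); first exact: cpx_degP.
by rewrite (cpx_d_linear c un vn) -xu -yv linearP.
Qed.
HB.instance Definition _ :=
  GRing.isSubmodClosed.Build k cocycles coboundary coboundary_submod.

Definition cohomology : lmodType k := mquot coboundary.

(* The class of a cocycle; elements that are not n-cocycles are sent to 0. *)
Definition cls (x : V) : cohomology :=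
  \pi_(Quotient.quot (mquot_pred coboundary)) (insubd (0 : cocycles) x).

Definition rep (h : cohomology) : V :=
  val (repr (h : Quotient.quot (mquot_pred coboundary))).

End Cohomology.
Arguments cohomology {k} C n.
Arguments cls {k C n} x.
Arguments rep {k C n} h.

Record bimodule (k : comPzRingType) (A : algType k) := Bimodule {
  bimod_sort :> lmodType k;
  lact : A -> bimod_sort -> bimod_sort;
  ract : bimod_sort -> A -> bimod_sort;
  lact_linearl : forall x c a b, lact (c *: a + b) x = c *: lact a x + lact b x;
  lact_linearr : forall a c x y, lact a (c *: x + y) = c *: lact a x + lact a y;
  ract_linearl : forall a c x y, ract (c *: x + y) a = c *: ract x a + ract y a;
  ract_linearr : forall x c a b, ract x (c *: a + b) = c *: ract x a + ract x b;
  lact1 : forall x, lact 1 x = x;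
  ract1 : forall x, ract x 1 = x;
  lactA : forall a b x, lact a (lact b x) = lact (a * b) x;
  ractA : forall a b x, ract (ract x a) b = ract x (a * b);
  lractA : forall a b x, ract (lact a x) b = lact a (ract x b)
}.
Arguments lact {k A} b a x : rename.
Arguments ract {k A} b x a : rename.

Definition bimodule_iso (k : comPzRingType) (A : algType k) (M N : bimodule A)
    (phi : M -> N) : Prop :=
  [/\ linear phi,
      forall a x, phi (lact M a x) = lact N a (phi x),
      forall x a, phi (ract M x a) = ract N (phi x) a
    & bijective phi].

#[local] Obligation Tactic := idtac.

Section Bimodules.
Variables (k : comPzRingType) (A : algType k).

Program Definition regular_bimod : bimodule A :=
  @Bimodule k A A (fun a x => a * x) (fun x a => x * a) _ _ _ _ _ _ _ _ _.
Next Obligation. by move=> x c a b /=; rewrite mulrDl scalerAl. Qed.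
Next Obligation. by move=> a c x y /=; rewrite mulrDr scalerAr. Qed.
Next Obligation. by move=> a c x y /=; rewrite mulrDl scalerAl. Qed.
Next Obligation. by move=> x c a b /=; rewrite mulrDr scalerAr. Qed.
Next Obligation. by move=> x /=; rewrite mul1r. Qed.
Next Obligation. by move=> x /=; rewrite mulr1. Qed.
Next Obligation. by move=> a b x /=; rewrite mulrA. Qed.
Next Obligation. by move=> a b x /=; rewrite mulrA. Qed.
Next Obligation. by move=> a b x /=; rewrite mulrA. Qed.

Definition linear_functional : {pred A -> k^o} := [pred f : A -> k^o | `[< linear f >]].

Lemma linear_functional_submod : submod_closed linear_functional.
Proof.
split; first by apply/asboolP => c a b; rewrite /= scaler0 addr0.
move=> c f g /asboolP fl /asboolP gl; apply/asboolP => e a b.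
rewrite !fctE fl gl !scalerDr !scalerA [c * e]mulrC.
by rewrite addrACA.
Qed.
HB.instance Definition _ :=
  GRing.isSubmodClosed.Build k (A -> k^o) linear_functional linear_functional_submod.

Record dual : Type :=
  Dual { dual_fun :> A -> k^o; _ : dual_fun \in linear_functional }.
HB.instance Definition _ := [isSub for dual_fun].
HB.instance Definition _ := [Choice of dual by <:].
HB.instance Definition _ := [SubChoice_isSubLmodule of dual by <:].

Lemma dual_linear (f : dual) : linear f.
Proof. by case: f => f /= /asboolP. Qed.

Lemma dualP (f g : dual) : f =1 g -> f = g.
Proof. by move=> fg; apply: val_inj; apply/funext. Qed.

Let dual_lact_subproof (a : A) (f : dual) :
  (fun x => f (x * a) : k^o) \in linear_functional.
Proof. by apply/asboolP => c x y; rewrite mulrDl -scalerAl dual_linear. Qed.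
Let dual_ract_subproof (f : dual) (b : A) :
  (fun x => f (b * x) : k^o) \in linear_functional.
Proof. by apply/asboolP => c x y; rewrite mulrDr -scalerAr dual_linear. Qed.

Program Definition dual_bimod : bimodule A :=
  @Bimodule k A dual (fun a f => Dual (dual_lact_subproof a f))
    (fun f b => Dual (dual_ract_subproof f b)) _ _ _ _ _ _ _ _ _.
Next Obligation.
by move=> f c a b /=; apply: dualP => x /=; rewrite mulrDr -scalerAr dual_linear.
Qed.
Next Obligation. by move=> a c f g /=; apply: dualP. Qed.
Next Obligation. by move=> a c f g /=; apply: dualP. Qed.
Next Obligation.
by move=> f c a b /=; apply: dualP => x /=; rewrite mulrDl -scalerAl dual_linear.
Qed.
Next Obligation. by move=> f /=; apply: dualP => x /=; rewrite mulr1. Qed.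
Next Obligation. by move=> f /=; apply: dualP => x /=; rewrite mul1r. Qed.
Next Obligation. by move=> a b f /=; apply: dualP => x /=; rewrite mulrA. Qed.
Next Obligation. by move=> a b f /=; apply: dualP => x /=; rewrite mulrA. Qed.
Next Obligation. by move=> a b f /=; apply: dualP => x /=; rewrite mulrA. Qed.

(* The functional g itself when g is linear, and 0 otherwise. *)
Definition mkdual (g : A -> k^o) : dual := insubd (0 : dual) g.

Lemma mkdualE (g : A -> k^o) : linear g -> mkdual g =1 g.
Proof. by move=> gl x; rewrite /mkdual insubdK //; apply/asboolP. Qed.

End Bimodules.

(* Hom(A^{(x)n}, M) is the module of k-multilinear maps A^n -> M. For all n at
   once these are represented as functions on finite sequences of elements of A;
   an n-cochain is multilinear and supported on the sequences of length n. In
   particular there are no nonzero cochains in negative degrees. *)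
Section Hochschild.
Variables (k : comPzRingType) (A : algType k) (M : bimodule A).
Implicit Types f : seq A -> M.

Definition multilinear f : Prop :=
  forall (s t : seq A) (c : k) (a b : A),
    f (s ++ (c *: a + b) :: t) = c *: f (s ++ a :: t) + f (s ++ b :: t).

Definition is_cochain (n : int) f : Prop :=
  multilinear f /\ (forall s, (size s)%:Z != n -> f s = 0).

Definition normalized f : Prop := forall s, 1 \in s -> f s = 0.

(* Multiplies the entries i and i+1 (numbered from 0). *)
Definition contract (i : nat) (s : seq A) : seq A :=
  take i s ++ s`_i * s`_i.+1 :: drop i.+2 s.

Definition hoch_d f : seq A -> M := fun s =>
  if s is a :: s' then
    lact M a (f s')
    + \sum_(i < size s') (-1) ^+ i.+1 *: f (contract i s)
    + (-1) ^+ size s *: ract M (f (belast a s')) (last a s')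
  else 0.

Lemma is_cochain0 n : is_cochain n (0 : seq A -> M).
Proof. by split=> // s t c a b; rewrite scaler0 addr0. Qed.

Lemma is_cochainP n c f g :
  is_cochain n f -> is_cochain n g -> is_cochain n (c *: f + g).
Proof.
case=> fl f0 [gl g0]; split=> [s t e a b|s sn]; rewrite !fctE.
  by rewrite fl gl !scalerDr !scalerA [c * e]mulrC addrACA.
by rewrite f0 // g0 // scaler0 addr0.
Qed.

Lemma hoch_d_linear c f g : hoch_d (c *: f + g) = c *: hoch_d f + hoch_d g.
Proof.
apply/funext => -[|a s]; rewrite !fctE /= ?fctE ?scaler0 ?addr0 //.
rewrite lact_linearr ract_linearl [_ *: (c *: _ + _)]scalerDr.
rewrite [(-1) ^+ _ *: (c *: _)]scalerA [_ * c]mulrC -scalerA.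
rewrite (_ : \sum_(i < size s) _ =
   c *: (\sum_(i < size s) (-1) ^+ i.+1 *: f (contract i (a :: s)))
   + \sum_(i < size s) (-1) ^+ i.+1 *: g (contract i (a :: s))).
  by rewrite !(scalerDr c) [X in X + _ = _]addrACA [LHS]addrACA.
rewrite scaler_sumr -big_split /=; apply: eq_bigr => i _.
by rewrite scalerDr !scalerA [c * _]mulrC.
Qed.

Definition hochschild : complex k :=
  @Complex k (seq A -> M) is_cochain hoch_d is_cochain0 is_cochainP
    (fun n c f g _ _ => hoch_d_linear c f g).

Definition HH (n : int) : lmodType k := cohomology hochschild n.

Definition HHcocycle (n : int) f : Prop := is_cochain n f /\ hoch_d f = 0.

Definition HHcls (n : int) f : HH n := @cls k hochschild n f.

End Hochschild.
Arguments HH {k A} M n.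
Arguments HHcls {k A} M n f.

Section InducedMap.
Variables (k : comPzRingType) (A : algType k) (M N : bimodule A) (phi : M -> N).

Definition HHmap (n : int) (x : HH M n) : HH N n :=
  HHcls N n (phi \o rep x).

Definition HHmap_inv (n : int) : HH N n -> HH M n :=
  'pinv_(fun=> 0) [set: HH M n] (@HHmap n).

End InducedMap.

Section GerstenhaberOperations.
Variables (k : comPzRingType) (A : algType k).
Local Notation AA := (regular_bimod A).
Implicit Types f g : seq A -> A.

Definition cup_cochain (m : int) f g : seq A -> A :=
  fun s => f (take `|m| s) * g (drop `|m| s).

(* Insertion of the n-cochain g in the argument number p of f, arguments being
   numbered from 0. *)
Definition insert_cochain (n : int) (p : nat) f g : seq A -> A :=
  fun s => f (take p s ++ g (take `|n| (drop p s)) :: drop (p + `|n|) s).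

Definition circ_cochain (m n : int) f g : seq A -> A :=
  sgn ((m - 1) * (n - 1)) *:
    \sum_(p < `|m|%N) (sgn ((n - 1) * p%:Z) : k) *: insert_cochain n p f g.

Definition bracket_cochain (m n : int) f g : seq A -> A :=
  circ_cochain m n f g - (sgn ((m - 1) * (n - 1)) : k) *: circ_cochain n m g f.

Definition one_cochain : seq A -> A := fun s => if s is [::] then 1 else 0.

Definition HHone : HH AA 0 :=
  HHcls AA 0 one_cochain.

Definition HHcup (i j : int) (x : HH AA i) (y : HH AA j) : HH AA (i + j) :=
  HHcls AA (i + j) (cup_cochain i (rep x) (rep y)).

Definition HHbracket (i j : int) (x : HH AA i) (y : HH AA j) :
    HH AA (i + j - 1) :=
  HHcls AA (i + j - 1) (bracket_cochain i j (rep x) (rep y)).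

End GerstenhaberOperations.

Section Connes.
Variables (k : comPzRingType) (A : algType k).
Local Notation D := (dual_bimod A).
Implicit Types (f : seq A -> D) (F : seq A -> k^o).

Definition flatten_dual f : seq A -> k^o :=
  fun s => if s is a0 :: s' then (f s' : dual A) a0 else 0.

Definition tau F : seq A -> k^o := fun s => F (rotr 1 s).
Definition sigma F : seq A -> k^o := fun s => F (1 :: s).

(* For f of degree n, the (n-1)-cochain B f is evaluated on sequences s of
   length n - 1; by connesBE below, mkdual is applied to a linear map as soon as
   f is multilinear. *)
Definition connesB f : seq A -> D := fun s =>
  mkdual (fun a0 : A => \sum_(i < (size s).+1)
    (-1) ^+ (i * size s) *: iter i tau (sigma (flatten_dual f)) (a0 :: s)).

Lemma iter_tauE i F s : iter i tau F s = F (iter i (rotr 1) s).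
Proof. by elim: i s => //= i IH s; rewrite /tau IH -iterSr. Qed.

Lemma iter_rotr_split i (s t : seq A) : exists s' t',
  forall a, iter i (rotr 1) (s ++ a :: t) = s' ++ a :: t'.
Proof.
elim: i => [|i [s' [t' IH]]]; first by exists s, t.
case: (lastP t') IH => [|t'' z] IH.
  by exists [::], s' => a; rewrite /= IH cats1 rotr1_rcons.
exists (z :: s'), t'' => a.
by rewrite /= IH -rcons_cons -rcons_cat rotr1_rcons.
Qed.

Lemma connes_linear f s : multilinear f -> linear (fun a0 : A =>
  \sum_(i < (size s).+1)
    (-1) ^+ (i * size s) *: iter i tau (sigma (flatten_dual f)) (a0 :: s) : k^o).
Proof.
move=> fl c a b; rewrite scaler_sumr -big_split /=; apply: eq_bigr => i _.
have [s' [t' E]] := iter_rotr_split i [::] s.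
rewrite !iter_tauE !(E _) /sigma /= fl /= scalerDr.
by rewrite !scalerA [c * _]mulrC.
Qed.

Lemma connesBE f s (a0 : A) : multilinear f ->
  (connesB f s : dual A) a0 = \sum_(i < (size s).+1)
    (-1) ^+ (i * size s) *: iter i tau (sigma (flatten_dual f)) (a0 :: s).
Proof. by move=> fl; rewrite /connesB mkdualE //; apply: connes_linear. Qed.

Lemma connesB_linear c f g : multilinear f -> multilinear g ->
  connesB (c *: f + g) = c *: connesB f + connesB g.
Proof.
move=> fl gl; apply/funext => s; apply: dualP => a0.
have fgl : multilinear (c *: f + g).
  move=> u v e a b; rewrite !fctE fl gl !scalerDr !scalerA [c * e]mulrC.
  by rewrite addrACA.
rewrite connesBE // !fctE /= fctE connesBE //= fctE connesBE //.
rewrite scaler_sumr -big_split /=; apply: eq_bigr => i _.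
by rewrite !iter_tauE /sigma /= scalerDr !scalerA [c * _]mulrC.
Qed.

Lemma multilinear0 : multilinear (0 : seq A -> D).
Proof. by move=> s t c a b; rewrite scaler0 addr0. Qed.

(* The sequence c of components c_0, c_1, and so on; as in a direct sum, only
   finitely many of them are nonzero. *)
Definition is_tot (n : int) (c : nat -> seq A -> D) : Prop :=
  (forall i, is_cochain (n + (2 * i)%:Z) (c i) /\ normalized (c i)) /\
  exists N, forall i, (N <= i)%N -> c i = 0.

Definition tot_d (c : nat -> seq A -> D) : nat -> seq A -> D :=
  fun i => hoch_d (c i) + connesB (c i.+1).

Lemma is_tot0 n : is_tot n (0 : nat -> seq A -> D).
Proof.
split=> [i|]; last by exists 0%N.
by split; [exact: is_cochain0 | move=> s].
Qed.

Lemma is_totP n e c c' : is_tot n c -> is_tot n c' -> is_tot n (e *: c + c').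
Proof.
case=> cn [N c0] [c'n [N' c'0]]; split=> [i|].
  have [ci cin] := cn i; have [c'i c'in] := c'n i; split.
    exact: is_cochainP.
  by move=> s s1; rewrite !fctE cin // c'in // scaler0 addr0.
exists (maxn N N') => i; rewrite geq_max => /andP[Ni N'i].
by rewrite -[LHS]/(e *: c i + c' i) c0 // c'0 // scaler0 addr0.
Qed.

Lemma tot_d_linear n e c c' : is_tot n c -> is_tot n c' ->
  tot_d (e *: c + c') = e *: tot_d c + tot_d c'.
Proof.
case=> cn _ [c'n _]; apply/funext => i.
have [[cl _] _] := cn i.+1; have [[c'l _] _] := c'n i.+1.
rewrite /tot_d -[RHS]/(e *: (hoch_d (c i) + connesB (c i.+1))
  + (hoch_d (c' i) + connesB (c' i.+1))).
rewrite -[(e *: c + c') i]/(e *: c i + c' i).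
rewrite -[(e *: c + c') i.+1]/(e *: c i.+1 + c' i.+1).
by rewrite hoch_d_linear connesB_linear // scalerDr addrACA.
Qed.

Definition cyclic_complex : complex k :=
  @Complex k (nat -> seq A -> D) is_tot tot_d is_tot0 is_totP tot_d_linear.

Definition HC (n : int) : lmodType k := cohomology cyclic_complex n.

Definition HCcocycle (n : int) (c : nat -> seq A -> D) : Prop :=
  is_tot n c /\ tot_d c = 0.

Definition HCcls (n : int) (c : nat -> seq A -> D) : HC n :=
  @cls k cyclic_complex n c.

(* A normalized cocycle in the class x. *)
Definition nrep (n : int) (x : HH D n) : seq A -> D :=
  xget 0 [set f : seq A -> D |
    [/\ normalized f, HHcocycle n f & HHcls D n f = x]].

Definition HHconnes (n : int) (x : HH D n) : HH D (n - 1) :=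
  HHcls D (n - 1) (connesB (nrep x)).

Definition tot_incl f : nat -> seq A -> D := fun i => if i is 0%N then f else 0.

Definition HCI (n : int) (x : HH D n) : HC n :=
  HCcls n (tot_incl (nrep x)).

Definition HCpartial (n : int) (y : HC n) : HH D (n - 1) :=
  HHcls D (n - 1) (connesB ((rep y : nat -> seq A -> D) 0%N)).

End Connes.
Arguments HC {k} A n.

Section Symmetric.
Variables (k : comPzRingType) (A : algType k).
Local Notation AA := (regular_bimod A).
Local Notation D := (dual_bimod A).
Variable Theta : AA -> D.

Definition HHdelta (n : int) (x : HH AA n) : HH AA (n - 1) :=
  HHmap_inv Theta (HHconnes (HHmap Theta x)).

Definition HHcup_dual (i j : int) (x : HH D i) (y : HH D j) : HH D (i + j) :=
  HHmap Theta (HHcup (HHmap_inv Theta x) (HHmap_inv Theta y)).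

Definition HCbracket (i j : int) (x : HC A i) (y : HC A j) : HC A (i + j - 2) :=
  sgn i *: regrade (HC A) (deg_lie i j)
    (HCI (HHcup_dual (HCpartial x) (HCpartial y))).

(* The maps above are computed on chosen representatives of classes. This says
   that the underlying cochain operations preserve cocycles and that the class
   of the result does not depend on the representatives; that each class in
   HH(A, A^v) has a normalized representative; and that HH(A, Theta) can be
   inverted. *)
Record operations_induced : Prop := {
  induced_one : HHcocycle 0 (@one_cochain k A : seq A -> AA);
  induced_cup : forall i j (f g : seq A -> AA),
    HHcocycle i f -> HHcocycle j g ->
    HHcocycle (i + j) (cup_cochain i f g : seq A -> AA) /\
    HHcup (HHcls AA i f) (HHcls AA j g) = HHcls AA (i + j) (cup_cochain i f g);
  induced_bracket : forall i j (f g : seq A -> AA),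
    HHcocycle i f -> HHcocycle j g ->
    HHcocycle (i + j - 1) (bracket_cochain i j f g : seq A -> AA) /\
    HHbracket (HHcls AA i f) (HHcls AA j g) =
      HHcls AA (i + j - 1) (bracket_cochain i j f g);
  induced_Theta : forall i (f : seq A -> AA), HHcocycle i f ->
    HHcocycle i (Theta \o f) /\
    HHmap Theta (HHcls AA i f) = HHcls D i (Theta \o f);
  induced_Theta_bij : forall i, bijective (@HHmap _ _ _ _ Theta i);
  induced_nrep : forall i (x : HH D i), exists f : seq A -> D,
    [/\ normalized f, HHcocycle i f & HHcls D i f = x];
  induced_connes : forall i (f : seq A -> D), normalized f -> HHcocycle i f ->
    HHcocycle (i - 1) (connesB f) /\
    HHconnes (HHcls D i f) = HHcls D (i - 1) (connesB f);
  induced_I : forall i (f : seq A -> D), normalized f -> HHcocycle i f ->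
    HCcocycle i (tot_incl f) /\ HCI (HHcls D i f) = HCcls i (tot_incl f);
  induced_partial : forall i (c : nat -> seq A -> D), HCcocycle i c ->
    HHcocycle (i - 1) (connesB (c 0%N)) /\
    HCpartial (HCcls i c) = HHcls D (i - 1) (connesB (c 0%N))
}.

End Symmetric.

(* Main.v *)
Require Import Defs.
From mathcomp Require Import all_boot all_order all_algebra.
From mathcomp Require Import all_classical.
From mathcomp Require Import zify ring.

Set Implicit Arguments.
Unset Strict Implicit.
Unset Printing Implicit Defensive.

Import GRing.Theory.
Local Open Scope ring_scope.

(** Cochains are functions on words in A, and every operation on them is a sum
    over ways of cutting a word. The sum over the cuts in two is [deconc]; the cup
    product is one such sum. The insertion [brace e g phi] sums
    e^|p| phi(p, g(v), w) over the cuts s = p v w. For e = (-1)^(|g|-1) it is, up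
    to a global sign, the circle product of Gerstenhaber, written phi{g} below;
    [brace2] is the double insertion phi{g,h}, with g to the left of h. The
    pre-Lie identity [brace_brace] expresses phi{g}{h} by phi{g{h}} and the two
    double insertions.

    The Hochschild differential d of A is itself made of insertions, of a cochain
    into the product of A and of the product into a cochain. The pre-Lie identity
    therefore computes d(f{g}), which contains f u g and g u f and shows that the
    cup product is commutative on cohomology ([dif_brace]). The same method for
    double insertions ([bar_brace2]) computes d(f{g,h}), which contains the three
    terms of the Poisson identity ([dif_brace2]). The Jacobi identity is the
    antisymmetrized pre-Lie identity and holds for cochains ([brk_jacobi]). So
    HH(A, A) is a Gerstenhaber algebra.

    The isomorphism Theta amounts to the functional tr x = Theta(1)(x). It
    satisfies tr(x y) = tr(y x) and Theta(x)(y) = tr(y x), and the Connes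
    operator, transported to an operator Delta on cochains with values in A, is
    the sum over rotations
      tr(a0 Delta f(s)) = sum over s = p w of (-1)^(|w| |s|) tr f(w, a0, p).
    Let H(f,g) be the analogous sum in which g is inserted somewhere between a0
    and the end of the word (w, a0, p). Up to signs, its differential is f{g}, minus
    g u Delta f, plus the terms of Delta(f u g) in which a0 is an argument of f
    ([cdif_homotopy]). Exchanging f and g gives the terms in which a0 is an argument
    of g. The two contributions add up to Delta(f u g) ([connes_cup]), and what
    remains says that {f,g} is cohomologous to the Batalin-Vilkovisky expression
    ([bracket_homotopic]). The square of Delta vanishes on normalized cochains, and
    each class has a normalized representative because values on words containing
    1 can be removed one place at a time ([normalization]).

    For cyclic cohomology, I o B = 0, and the composite of I with the boundary map
    is B. Hence, writing f, g, h for representatives of the boundaries of a, b, c,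
    the double bracket [a,[b,c]] is up to sign the image under I of
    f u Delta(g u h). The Poisson identity and the Batalin-Vilkovisky identity
    make Delta a differential operator of order two: as Delta kills f, g and h,
      Delta(f g h) = Delta(f g) h +- f Delta(g h) +- g Delta(f h)
    in cohomology ([Delta_cup3]). Applying I kills the left-hand side and leaves
    the Jacobi identity. Antisymmetry is commutativity of the cup product of the
    boundaries, whose degrees are one less. *)

(** * Linear combinations in a module *)

Inductive lin_expr (k : Type) : Type :=
  | LinVar of nat | LinZero | LinAdd of lin_expr k & lin_expr k
  | LinOpp of lin_expr k | LinScale of k & lin_expr k.
Arguments LinVar {k}.
Arguments LinZero {k}.

Section LinearCombinations.
Variables (k : comPzRingType) (V : lmodType k).

Fixpoint lin_eval (env : seq V) (e : lin_expr k) : V :=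
  match e with
  | LinVar n => nth 0 env n
  | LinZero => 0
  | LinAdd e1 e2 => lin_eval env e1 + lin_eval env e2
  | LinOpp e1 => - lin_eval env e1
  | LinScale c e1 => c *: lin_eval env e1
  end.

Fixpoint lin_coef (e : lin_expr k) (i : nat) : k :=
  match e with
  | LinVar n => if Nat.eqb n i then 1 else 0
  | LinZero => 0
  | LinAdd e1 e2 => lin_coef e1 i + lin_coef e2 i
  | LinOpp e1 => - lin_coef e1 i
  | LinScale c e1 => c * lin_coef e1 i
  end.

(** A conjunction rather than a quantified statement, so that it unfolds
    to one ring equation for each atom. *)
Fixpoint lin_coefs_eq (n : nat) (e1 e2 : lin_expr k) : Prop :=
  if n is m.+1 then lin_coef e1 m = lin_coef e2 m /\ lin_coefs_eq m e1 e2
  else True.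

Lemma lin_evalE env e :
  lin_eval env e = \sum_(i < size env) lin_coef e i *: env`_i.
Proof.
elim: e => [n||e1 IH1 e2 IH2|e IH|c e IH] /=.
- have [ltn|gen] := ltnP n (size env); last first.
    rewrite nth_default // big1 // => i _; case: PeanoNat.Nat.eqb_spec => [E|_].
      by move: gen; rewrite E leqNgt ltn_ord.
    by rewrite scale0r.
  rewrite (bigD1 (Ordinal ltn)) //= PeanoNat.Nat.eqb_refl scale1r big1 ?addr0 //.
  move=> i /eqP ni; case: PeanoNat.Nat.eqb_spec => [E|_]; last by rewrite scale0r.
  by case: ni; apply: val_inj.
- by rewrite big1 // => i _; rewrite scale0r.
- by rewrite IH1 IH2 -big_split; apply: eq_bigr => i _; rewrite scalerDl.
- by rewrite IH -sumrN; apply: eq_bigr => i _; rewrite scaleNr.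
- by rewrite IH scaler_sumr; apply: eq_bigr => i _; rewrite scalerA.
Qed.

Lemma lin_eval_inj env e1 e2 (x y : V) :
  lin_eval env e1 = x -> lin_eval env e2 = y ->
  lin_coefs_eq (size env) e1 e2 -> x = y.
Proof.
move=> <- <-; rewrite !lin_evalE; move: (size env) => n.
move=> E; apply: eq_bigr => -[i /= lti] _; congr (_ *: _).
elim: n lti E => // n IH; rewrite ltnS leq_eqVlt => /orP[/eqP -> []|lti [_]] //.
exact: IH.
Qed.

End LinearCombinations.

Ltac lin_index x env :=
  lazymatch env with
  | cons ?y ?env' =>
    match constr:(tt) with
    | _ => let _ := match constr:(tt) with _ => first [constr_eq x y | unify x y] end in constr:(0%N)
    | _ => let n := lin_index x env' in constr:(S n)
    end
  end.

Ltac lin_atoms env x :=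
  lazymatch x with
  | Algebra.add ?a ?b => let env := lin_atoms env a in lin_atoms env b
  | Algebra.opp ?a => lin_atoms env a
  | Algebra.zero => env
  | GRing.scale _ ?a => lin_atoms env a
  | _ =>
    match constr:(tt) with
    | _ => let _ := lin_index x env in env
    | _ => constr:(cons x env)
    end
  end.

Ltac lin_reify env x :=
  lazymatch x with
  | Algebra.add ?a ?b =>
    let a := lin_reify env a in let b := lin_reify env b in open_constr:(LinAdd a b)
  | Algebra.opp ?a => let a := lin_reify env a in open_constr:(LinOpp a)
  | Algebra.zero => open_constr:(@LinZero _)
  | GRing.scale ?c ?a => let a := lin_reify env a in open_constr:(LinScale c a)
  | _ => let n := lin_index x env in open_constr:(@LinVar _ n)
  end.

(** Closes an equation in a module over a commutative ring by reifying
    both sides as linear combinations of the same atoms and leaving the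
    equality of the coefficients to [ring]. *)
Ltac lin :=
  lazymatch goal with
  | |- @eq ?T ?x ?y =>
    let env := constr:(@nil T) in
    let env := lin_atoms env x in
    let env := lin_atoms env y in
    let e1 := lin_reify env x in
    let e2 := lin_reify env y in
    refine (@lin_eval_inj _ _ env e1 e2 x y (erefl _) (erefl _) _);
    cbn [size lin_coefs_eq lin_coef Nat.eqb]; repeat split; ring
  end.

(** The variant of [lin] that may use two equations between scalars, such
    as e * e = 1 for a sign e that is kept abstract. *)
Ltac lin_using H H' :=
  lazymatch goal with
  | |- @eq ?T ?x ?y =>
    let env := constr:(@nil T) in
    let env := lin_atoms env x in
    let env := lin_atoms env y in
    let e1 := lin_reify env x in
    let e2 := lin_reify env y in
    refine (@lin_eval_inj _ _ env e1 e2 x y (erefl _) (erefl _) _);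
    cbn [size lin_coefs_eq lin_coef Nat.eqb]; repeat split; ring: H H'
  end.

Section LinearMaps.
Variables (k : comPzRingType) (V W : lmodType k) (l : V -> W).
Hypothesis ll : linear l.

Lemma linear_map0 : l 0 = 0.
Proof. by have := ll (-1) 0 0; rewrite scaler0 addr0 => ->; lin. Qed.

Lemma linear_mapD x y : l (x + y) = l x + l y.
Proof. by rewrite -[x in LHS]scale1r ll scale1r. Qed.

Lemma linear_mapZ c x : l (c *: x) = c *: l x.
Proof. by rewrite -[_ *: x]addr0 ll linear_map0 addr0. Qed.

End LinearMaps.

(** * Cutting words and inserting cochains *)

Section Words.
Variables (k : comPzRingType) (A : algType k).

Section Operators.
Variable V : lmodType k.
Implicit Types (phi : seq A -> V) (psi : seq A -> seq A -> V).

Fixpoint deconc psi (s : seq A) : V :=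
  psi [::] s + (if s is a :: s' then deconc (fun u v => psi (a :: u) v) s' else 0).

(** The sum of e^|p| P(phi(p, -))(t) over the cuts s = p t: an operation P
    at the front of a word is spread over all places of the word. *)
Fixpoint ins_sum (e : k) (P : (seq A -> V) -> seq A -> V) phi (s : seq A) : V :=
  P phi s +
  (if s is a :: s' then e *: ins_sum e P (fun t => phi (a :: t)) s' else 0).

(** The insertions are locked: they are nested below, and unfolding them while
    cochains are compared up to conversion would make the comparison explode. *)
Fact insertion_key : unit. Proof. exact: tt. Qed.

Definition head_ins : (seq A -> A) -> (seq A -> V) -> seq A -> V :=
  locked_with insertion_key (fun g phi => deconc (fun v w => phi (g v :: w))).

(** The insertion phi{g}, the sum of e^|p| phi(p, g(v), w) over s = p v w. *)
Definition brace : k -> (seq A -> A) -> (seq A -> V) -> seq A -> V :=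
  locked_with insertion_key (fun e g => ins_sum e (head_ins g)).

Lemma head_insE g phi s : head_ins g phi s = deconc (fun v w => phi (g v :: w)) s.
Proof. by rewrite /head_ins unlock. Qed.

Lemma braceE e g phi s : brace e g phi s = ins_sum e (head_ins g) phi s.
Proof. by rewrite /brace unlock. Qed.

Definition head_ins2 : k -> (seq A -> A) -> (seq A -> A) -> (seq A -> V) -> seq A -> V :=
  locked_with insertion_key (fun eh g h phi =>
    deconc (fun v w => brace eh h (fun t => phi (g v :: t)) w)).

(** The double insertion phi{g,h}: the sum of e^|p| eh^|q| phi(p, g(v), q,
    h(w), r) over s = p v q w r. *)
Definition brace2 : k -> k -> (seq A -> A) -> (seq A -> A) -> (seq A -> V) -> seq A -> V :=
  locked_with insertion_key (fun e eh g h => ins_sum e (head_ins2 eh g h)).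

Lemma head_ins2E eh g h phi s :
  head_ins2 eh g h phi s = deconc (fun v w => brace eh h (fun t => phi (g v :: t)) w) s.
Proof. by rewrite /head_ins2 unlock. Qed.

Lemma brace2E e eh g h phi s :
  brace2 e eh g h phi s = ins_sum e (head_ins2 eh g h) phi s.
Proof. by rewrite /brace2 unlock. Qed.

Lemma eq_deconc psi psi' s : (forall u v, psi u v = psi' u v) ->
  deconc psi s = deconc psi' s.
Proof.
by elim: s psi psi' => [|a s IH] psi psi' E /=; rewrite E // (IH _ (fun u => psi' (a :: u))).
Qed.

Lemma deconc0 s : deconc (fun _ _ => 0) s = 0.
Proof. by elim: s => [|a s IH] /=; rewrite ?IH addr0. Qed.

Lemma deconcP c psi psi' s :
  deconc (fun u v => c *: psi u v + psi' u v) s = c *: deconc psi s + deconc psi' s.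
Proof. by elim: s psi psi' => [|a s IH] psi psi' /=; rewrite ?IH; lin. Qed.

Lemma deconcD psi psi' s :
  deconc (fun u v => psi u v + psi' u v) s = deconc psi s + deconc psi' s.
Proof. by elim: s psi psi' => [|a s IH] psi psi' /=; rewrite ?IH; lin. Qed.

Lemma deconcZ c psi s : deconc (fun u v => c *: psi u v) s = c *: deconc psi s.
Proof. by elim: s psi => [|a s IH] psi /=; rewrite ?IH; lin. Qed.

(** Coassociativity: cutting in two and then the second, or the first,
    part in two gives every cut in three once. *)
Lemma deconcA (chi : seq A -> seq A -> seq A -> V) s :
  deconc (fun u z => deconc (fun v w => chi u v w) z) s =
  deconc (fun y w => deconc (fun u v => chi u v w) y) s.
Proof.
elim: s chi => [|a s IH] chi /=; first by [].
by rewrite (IH (fun u => chi (a :: u))) deconcD /=; lin.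
Qed.

Lemma head_insP g c phi phi' s :
  head_ins g (fun t => c *: phi t + phi' t) s = c *: head_ins g phi s + head_ins g phi' s.
Proof. by rewrite !head_insE; exact: deconcP. Qed.

Section InsSum.
Variables (e : k) (P : (seq A -> V) -> seq A -> V).
Hypothesis PP : forall c phi phi' s,
  P (fun t => c *: phi t + phi' t) s = c *: P phi s + P phi' s.

Lemma ins_sumP c phi phi' s :
  ins_sum e P (fun t => c *: phi t + phi' t) s =
  c *: ins_sum e P phi s + ins_sum e P phi' s.
Proof.
by elim: s phi phi' => [|a s IH] phi phi' /=; rewrite ?IH PP; lin.
Qed.

End InsSum.

Lemma braceP e g c phi phi' s :
  brace e g (fun t => c *: phi t + phi' t) s =
  c *: brace e g phi s + brace e g phi' s.
Proof. by rewrite !braceE; apply: ins_sumP => *; apply: head_insP. Qed.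

(** Sums over cuts are operators on functions of words; this is what lets
    them commute with each other ([op_deconc], [op_brace]). *)
Definition op_linear (T : (seq A -> V) -> seq A -> V) : Prop :=
  forall c phi phi' s, T (fun t => c *: phi t + phi' t) s = c *: T phi s + T phi' s.

Section OpLinear.
Variables (T : (seq A -> V) -> seq A -> V).
Hypothesis TP : op_linear T.

Lemma opD phi phi' s : T (fun t => phi t + phi' t) s = T phi s + T phi' s.
Proof.
have := TP 1 phi phi' s; rewrite scale1r => <-.
by congr (T _ s); apply/funext => t; rewrite scale1r.
Qed.

Lemma op0 s : T (fun=> 0) s = 0.
Proof.
have := TP (-1) (fun=> 0) (fun=> 0) s; rewrite scaler0 addr0 => {1}->.
by rewrite scaleN1r addNr.
Qed.

Lemma opZ c phi s : T (fun t => c *: phi t) s = c *: T phi s.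
Proof.
have := TP c phi (fun=> 0) s; rewrite op0 addr0 => <-.
by congr (T _ s); apply/funext => t; rewrite addr0.
Qed.

Lemma op_deconc (chi : seq A -> seq A -> seq A -> V) s t :
  T (fun v => deconc (fun x y => chi x y v) s) t =
  deconc (fun x y => T (chi x y) t) s.
Proof.
elim: s chi => [|a s IH] chi /=; first by rewrite opD op0.
by rewrite opD IH.
Qed.

End OpLinear.

Lemma brace_nil e g phi : brace e g phi [::] = phi [:: g [::]].
Proof. by rewrite braceE /= head_insE /= !addr0. Qed.

Lemma brace_linear e g : op_linear (brace e g).
Proof. exact: braceP. Qed.

Lemma brace_cons e g phi a s :
  brace e g phi (a :: s) =
  head_ins g phi (a :: s) + e *: brace e g (fun t => phi (a :: t)) s.
Proof. by rewrite !braceE. Qed.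

Lemma head_ins_deconc h psi s : head_ins h (deconc psi) s =
  head_ins h (psi [::]) s + deconc (fun p w => head_ins h (fun v => psi v w) p) s.
Proof.
rewrite !head_insE /= deconcD; congr (_ + _).
rewrite (deconcA (fun v x y => psi (h v :: x) y)).
by apply: eq_deconc => u v; rewrite head_insE.
Qed.

(** Insertion is a coderivation of deconcatenation: the inserted cochain
    lies on one side of the cut. *)
Lemma brace_deconc e h psi s :
  brace e h (deconc psi) s =
  deconc (fun v w => brace e h (fun v' => psi v' w) v
                     + e ^+ size v *: brace e h (psi v) w) s.
Proof.
elim: s psi => [|a s IH] psi.
  by rewrite /= !brace_nil /= expr0; lin.
rewrite brace_cons head_ins_deconc /= (opD (@brace_linear _ _)) IH !deconcD.
rewrite brace_cons !brace_nil !head_insE /=.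
under [X in _ = _ + (X + _)]eq_deconc => u v do rewrite brace_cons.
rewrite deconcD deconcZ.
under [X in _ = _ + (_ + X)]eq_deconc => u v do rewrite exprS -scalerA.
by rewrite deconcZ; lin.
Qed.

Lemma brace2_cons e eh g h phi a s :
  brace2 e eh g h phi (a :: s) =
  head_ins2 eh g h phi (a :: s) + e *: brace2 e eh g h (fun t => phi (a :: t)) s.
Proof. by rewrite !brace2E. Qed.

Lemma brace2_nil e eh g h phi : brace2 e eh g h phi [::] = phi [:: g [::]; h [::]].
Proof. by rewrite brace2E /= head_ins2E /= !addr0 brace_nil. Qed.

Lemma head_ins2_linear eh g h : op_linear (head_ins2 eh g h).
Proof.
move=> c phi phi' s; rewrite !head_ins2E -deconcP; apply: eq_deconc => u v.
exact: braceP.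
Qed.

Lemma brace2_linear e eh g h : op_linear (brace2 e eh g h).
Proof.
by move=> c phi phi' s; rewrite !brace2E; apply: ins_sumP => *; apply: head_ins2_linear.
Qed.

(** Only the parity of the degree enters the signs. *)
Definition homog (b : bool) phi : Prop := forall s, odd (size s) != b -> phi s = 0.

(** Multilinearity with values in an arbitrary module; for a bimodule it
    is convertible to [multilinear]. *)
Definition mlin phi : Prop := forall s t c a b,
  phi (s ++ (c *: a + b) :: t) = c *: phi (s ++ a :: t) + phi (s ++ b :: t).

Lemma mlin_cons phi a : mlin phi -> mlin (fun t => phi (a :: t)).
Proof. by move=> phil s t c x y; apply: (phil (a :: s)). Qed.

Lemma mlin_head phi t c a b :
  mlin phi -> phi ((c *: a + b) :: t) = c *: phi (a :: t) + phi (b :: t).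
Proof. by move=> phil; apply: (phil [::]). Qed.

Lemma mlin0 phi s t : mlin phi -> phi (s ++ 0 :: t) = 0.
Proof.
by move=> phil; have := phil s t (-1) 0 0; rewrite scaler0 addr0 => ->; lin.
Qed.

Lemma mlin0h phi t : mlin phi -> phi (0 :: t) = 0.
Proof. exact: (@mlin0 phi [::]). Qed.

End Operators.

Section LinearMap.
Variables (V W : lmodType k) (l : V -> W).
Hypothesis ll : linear l.

Let l0 := linear_map0 ll.
Let lD := linear_mapD ll.
Let lZ := linear_mapZ ll.

Lemma deconc_comp psi s : l (deconc psi s) = deconc (fun u v => l (psi u v)) s.
Proof. by elim: s psi => [|a s IH] psi /=; rewrite lD ?l0 ?IH. Qed.

Lemma brace_comp e g phi s : l (brace e g phi s) = brace e g (fun t => l (phi t)) s.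
Proof.
elim: s phi => [|a s IH] phi; first by rewrite !brace_nil.
by rewrite !brace_cons lD lZ IH !head_insE deconc_comp.
Qed.

Lemma brace2_comp e eh g h phi s :
  l (brace2 e eh g h phi s) = brace2 e eh g h (fun t => l (phi t)) s.
Proof.
elim: s phi => [|a s IH] phi; first by rewrite !brace2_nil.
rewrite !brace2_cons lD lZ IH !head_ins2E deconc_comp.
by congr (_ + _); apply: eq_deconc => u v; rewrite brace_comp.
Qed.

End LinearMap.

Lemma expr_odd (e : k) n : e * e = 1 -> e ^+ n = e ^+ odd n.
Proof.
move=> ee; rewrite -{1}(odd_double_half n) exprD -mul2n exprM expr2 ee expr1n.
by rewrite mulr1.
Qed.

Section Associator.
Variables (V : lmodType k).
Implicit Types (g h : seq A -> A) (phi : seq A -> V).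

(** The sign e^|v| is constant on the support of g. *)
Lemma deconc_sign e b g (chi : A -> seq A -> V) s :
  e * e = 1 -> homog b g -> (forall w, chi 0 w = 0) ->
  deconc (fun v w => e ^+ size v *: chi (g v) w) s =
  e ^+ b *: deconc (fun v w => chi (g v) w) s.
Proof.
move=> ee gb chi0; rewrite -deconcZ; apply: eq_deconc => u v.
rewrite (expr_odd _ ee).
have [-> //|ub] := eqVneq (odd (size u)) b.
by rewrite gb // chi0 !scaler0.
Qed.

(** By [brace_deconc], h is inserted either among the arguments of g or to
    the right of the value of g. *)
Lemma brace_head_ins e b g h phi s :
  mlin phi -> e * e = 1 -> homog b g ->
  brace e h (head_ins g phi) s =
  head_ins (brace e h g) phi s + e ^+ b *: head_ins2 e g h phi s.
Proof.
move=> phil ee gb; have -> : head_ins g phi = deconc (fun v w => phi (g v :: w)).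
  by apply/funext => t; rewrite head_insE.
rewrite brace_deconc deconcD head_insE head_ins2E; congr (_ + _).
  apply: eq_deconc => u v; rewrite -(@brace_comp _ V (fun x => phi (x :: v))) //.
  by move=> c x y; apply: mlin_head.
rewrite (@deconc_sign e b g (fun x => brace e h (fun t => phi (x :: t)))) // => w.
have -> : (fun t => phi (0 :: t)) = fun=> 0.
  by apply/funext => t; apply: (mlin0h).
by rewrite (op0 (@brace_linear _ _ _)).
Qed.

(** The pre-Lie identity: in phi{g}{h}, the cochain h is inserted in g, to
    the right of g, or to the left of g. On the right, the sign of h also
    counts the arguments of g, whence eh^b. On the left, the sign of g
    counts the value of h as one letter, whence eg. *)
Lemma brace_brace eg eh b g h phi s :
  mlin phi -> eh * eh = 1 -> homog b g ->
  brace eh h (brace eg g phi) s =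
  brace (eg * eh) (brace eh h g) phi s
  + eh ^+ b *: brace2 (eg * eh) eh g h phi s + eg *: brace2 (eg * eh) eg h g phi s.
Proof.
move=> phil ee gb; elim: s phi phil => [|a s IH] phi phil.
  rewrite !brace_nil brace_cons !brace2_nil !brace_nil head_insE /=; case: b gb => gb.
    by rewrite (gb [::]) // (mlin0h) //; lin.
  by rewrite expr0; lin.
have E : head_ins h (brace eg g phi) (a :: s) =
    head_ins h (head_ins g phi) (a :: s) + eg *: head_ins2 eg h g phi (a :: s).
  rewrite !head_insE head_ins2E -deconcZ -deconcD.
  by apply: eq_deconc => u v; rewrite brace_cons.
have F : brace eh h (fun t => brace eg g phi (a :: t)) s =
    brace eh h (fun t => head_ins g phi (a :: t)) s
    + eg *: brace eh h (brace eg g (fun t => phi (a :: t))) s.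
  have -> : (fun t => brace eg g phi (a :: t)) = (fun t => head_ins g phi (a :: t)
      + eg *: brace eg g (fun t => phi (a :: t)) t).
    by apply/funext => t; rewrite brace_cons.
  by rewrite (opD (@brace_linear _ _ _)) (opZ (@brace_linear _ _ _)).
rewrite brace_cons E F IH; last exact: mlin_cons.
have := brace_head_ins h (a :: s) phil ee gb; rewrite brace_cons.
rewrite (brace_cons (eg * eh)) !(brace2_cons (eg * eh)).
set x1 := head_ins h _ _; set x2 := brace eh h _ _.
move/eqP; rewrite addrC -subr_eq => /eqP E2.
by rewrite -E2; lin.
Qed.

End Associator.

End Words.

(** * Multilinearity and cup products *)

Section Multilinearity.
Variables (k : comPzRingType) (A : algType k) (V : lmodType k).
Implicit Types (phi : seq A -> V) (g h : seq A -> A).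

Lemma deconc_cat (psi : seq A -> seq A -> V) s x t :
  deconc psi (s ++ x :: t) = deconc (fun u v => psi u (v ++ x :: t)) s
                             + deconc (fun u v => psi (s ++ x :: u) v) t.
Proof. by elim: s psi => [|a s IH] psi /=; rewrite ?IH /=; lin. Qed.

Lemma mlin_deconc (psi : seq A -> seq A -> V) :
  (forall w, mlin (fun v => psi v w)) -> (forall v, mlin (psi v)) ->
  mlin (deconc psi).
Proof.
move=> psil psir s t c a b; rewrite !deconc_cat.
under eq_deconc => u v do rewrite psir.
under [X in _ + X = _]eq_deconc => u v do rewrite psil.
by rewrite !deconcP; lin.
Qed.

Lemma mlin_comb c phi phi' : mlin phi -> mlin phi' ->
  mlin (fun t => c *: phi t + phi' t).
Proof. by move=> l l' s t d a b; rewrite l l'; lin. Qed.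

Lemma mlin_ins_sum e (P : (seq A -> V) -> seq A -> V) phi :
  op_linear P -> (forall phi, mlin phi -> mlin (P phi)) ->
  mlin phi -> mlin (ins_sum e P phi).
Proof.
move=> PP Pl phil s; elim: s phi phil => [|x s IH] phi phil t c a b.
  have -> : ins_sum e P phi ([::] ++ (c *: a + b) :: t) =
      P phi ((c *: a + b) :: t) + e *: ins_sum e P (fun u => phi ((c *: a + b) :: u)) t.
    by [].
  rewrite (mlin_head _ _ _ _ (Pl _ phil)).
  have -> : (fun u => phi (c *: a + b :: u)) =
      (fun u => c *: phi (a :: u) + phi (b :: u)).
    by apply/funext => u; apply: mlin_head.
  by rewrite (ins_sumP _ PP) /=; lin.
have := IH _ (mlin_cons x phil) t c a b; rewrite /= => ->.
by rewrite (Pl _ phil (x :: s) t); lin.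
Qed.

Lemma mlin_head_ins g phi : mlin g -> mlin phi -> mlin (head_ins g phi).
Proof.
move=> gl phil; have -> : head_ins g phi = deconc (fun v w => phi (g v :: w)).
  by apply/funext => s; rewrite head_insE.
apply: mlin_deconc => u s t c a b; last by rewrite -!cat_cons phil.
by rewrite gl mlin_head.
Qed.

Lemma mlin_brace e g phi : mlin g -> mlin phi -> mlin (brace e g phi).
Proof.
move=> gl phil; have -> : brace e g phi = ins_sum e (head_ins g) phi.
  by apply/funext => s; rewrite braceE.
apply: mlin_ins_sum => //; first by move=> *; apply: head_insP.
by move=> *; apply: mlin_head_ins.
Qed.

Lemma brace_mlin_head e g phi c a b s : mlin phi ->
  brace e g (fun t => phi ((c *: a + b) :: t)) s =
  c *: brace e g (fun t => phi (a :: t)) s + brace e g (fun t => phi (b :: t)) s.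
Proof.
move=> phil; rewrite -braceP; congr (brace _ _ _ s).
by apply/funext => t; apply: mlin_head.
Qed.

Lemma mlin_head_ins2 eh g h phi :
  mlin g -> mlin h -> mlin phi -> mlin (head_ins2 eh g h phi).
Proof.
move=> gl hl phil.
have -> : head_ins2 eh g h phi =
    deconc (fun v w => brace eh h (fun t => phi (g v :: t)) w).
  by apply/funext => s; rewrite head_ins2E.
apply: mlin_deconc => u; last by apply: mlin_brace => //; apply: mlin_cons.
by move=> s t c a b; rewrite gl brace_mlin_head.
Qed.

Lemma mlin_brace2 e eh g h phi :
  mlin g -> mlin h -> mlin phi -> mlin (brace2 e eh g h phi).
Proof.
move=> gl hl phil; have -> : brace2 e eh g h phi = ins_sum e (head_ins2 eh g h) phi.
  by apply/funext => s; rewrite brace2E.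
apply: mlin_ins_sum => //; first exact: head_ins2_linear.
by move=> *; apply: mlin_head_ins2.
Qed.

Lemma head_ins_fun c g g' phi s : mlin phi ->
  head_ins (fun v => c *: g v + g' v) phi s = c *: head_ins g phi s + head_ins g' phi s.
Proof.
move=> phil; rewrite !head_insE -deconcP; apply: eq_deconc => u v.
exact: mlin_head.
Qed.

(** Insertion is linear in the inserted cochain, because the outer cochain
    is multilinear. *)
Lemma brace_fun e c g g' phi s : mlin phi ->
  brace e (fun v => c *: g v + g' v) phi s = c *: brace e g phi s + brace e g' phi s.
Proof.
elim: s phi => [|a s IH] phi phil; first by rewrite !brace_nil mlin_head.
by rewrite !brace_cons head_ins_fun // IH; [lin|apply: mlin_cons].
Qed.

Lemma head_ins2_funl eh c g g' h phi s : mlin phi ->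
  head_ins2 eh (fun v => c *: g v + g' v) h phi s =
  c *: head_ins2 eh g h phi s + head_ins2 eh g' h phi s.
Proof.
move=> phil; rewrite !head_ins2E -deconcP; apply: eq_deconc => u v.
exact: brace_mlin_head.
Qed.

Lemma brace_fun0 e phi s : mlin phi -> brace e (fun=> 0) phi s = 0.
Proof.
move=> phil; have := brace_fun e (-1) (fun=> 0) (fun=> 0) s phil.
rewrite scaler0 addr0 => ->; lin.
Qed.

Lemma brace2_fun0l e eh h phi s : mlin phi -> brace2 e eh (fun=> 0) h phi s = 0.
Proof.
elim: s phi => [|a s IH] phi phil; first by rewrite brace2_nil (mlin0h).
rewrite brace2_cons IH; last exact: mlin_cons.
rewrite head_ins2E (_ : (fun t => phi (0 :: t)) = fun=> 0).
  by under eq_deconc => u v do rewrite (op0 (@brace_linear _ _ _ _ _)); rewrite deconc0; lin.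
by apply/funext => t; apply: (mlin0h).
Qed.

Lemma brace2_fun0r e eh g phi s : mlin phi -> brace2 e eh g (fun=> 0) phi s = 0.
Proof.
elim: s phi => [|a s IH] phi phil; first by rewrite brace2_nil (mlin0 [:: _]).
rewrite brace2_cons IH; last exact: mlin_cons.
rewrite head_ins2E.
under eq_deconc => u v do rewrite (brace_fun0 _ _ (mlin_cons _ phil)).
by rewrite deconc0; lin.
Qed.

End Multilinearity.

Lemma brace_nilsupp (k : comPzRingType) (A : algType k) (V : lmodType k) e
    (g : seq A -> A) (phi : seq A -> V) t :
  (forall x t', phi (x :: t') = 0) -> brace e g phi t = 0.
Proof.
elim: t phi => [|x t IH] phi E; first by rewrite brace_nil.
rewrite brace_cons head_insE IH; last by move=> *; apply: E.
under eq_deconc => u v do rewrite E.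
by rewrite deconc0; lin.
Qed.

Section Products.
Variables (k : comPzRingType) (A : algType k).
Implicit Types (f g h : seq A -> A).

Definition cup f g : seq A -> A := deconc (fun u v => f u * g v).
(** The identity of A as a cochain of degree 1: cup products with it
    multiply by the first or the last letter. *)
Definition idc : seq A -> A := fun s => if s is [:: a] then a else 0.
(** The product of A, a cochain of degree 2; inserting it or inserting in
    it gives all parts of the Hochschild differential. *)
Definition mul2 : seq A -> A := cup idc idc.

Lemma mlin_idc : mlin idc.
Proof. by move=> [|x [|y s]] [|z t] c a b //=; lin. Qed.

Lemma mlin_cup f g : mlin f -> mlin g -> mlin (cup f g).
Proof.
move=> fl gl; apply: mlin_deconc => u s t c a b.
  by rewrite fl mulrDl scalerAl.
by rewrite gl mulrDr scalerAr.
Qed.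

Lemma mlin_mul2 : mlin mul2. Proof. exact: mlin_cup mlin_idc mlin_idc. Qed.

(** Only the cut after the first letter contributes when the first factor
    has degree 1. *)
Lemma deconc_unaryl (V : lmodType k) (chi : A -> seq A -> V) s :
  (forall w, chi 0 w = 0) ->
  deconc (fun u v => chi (idc u) v) s = if s is a :: s' then chi a s' else 0.
Proof.
case: s => [|a s] chi0 /=; first by rewrite chi0 addr0.
case: s => [|b s] /=; first by rewrite chi0; lin.
rewrite chi0 (@eq_deconc _ _ _ _ (fun _ _ => 0)) ?deconc0; first lin.
by move=> u v; apply: chi0.
Qed.

Lemma deconc_unaryr (V : lmodType k) (chi : A -> seq A -> V) s a :
  (forall w, chi 0 w = 0) ->
  deconc (fun u v => chi (idc v) u) (rcons s a) = chi a s.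
Proof.
move=> chi0; elim: s chi chi0 => [|b s IH] chi chi0 /=; first by rewrite chi0; lin.
rewrite (IH (fun x u => chi x (b :: u))) //.
by case: s {IH} => [|c s] /=; rewrite chi0 add0r.
Qed.

Lemma cup_idl f s : cup idc f s = if s is a :: s' then a * f s' else 0.
Proof. by rewrite /cup (deconc_unaryl (chi := fun a t => a * f t)) // => w; rewrite mul0r. Qed.

Lemma cup_idr f s a : cup f idc (rcons s a) = f s * a.
Proof. by rewrite /cup (deconc_unaryr (chi := fun a t => f t * a)) // => w; rewrite mulr0. Qed.

Lemma cup_idr0 f : cup f idc [::] = 0.
Proof. by rewrite /cup /= mulr0 addr0. Qed.

Lemma brace_idc e g s : brace e g idc s = g s.
Proof.
have last_nil t : deconc (fun u v => idc (g u :: v)) t = g t.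
  elim: t (g) => [|y t IH] g' /=; first by rewrite addr0.
  by rewrite (IH (fun u => g' (y :: u))) add0r.
case: s => [|a s]; first by rewrite brace_nil.
rewrite brace_cons head_insE last_nil //.
by rewrite (brace_nilsupp _ _ (phi := fun t => idc (a :: t))) //; lin.
Qed.

(** A consequence of [brace_deconc]: insertion in the left variable is a
    derivation of the cup product. *)
Lemma brace_cup e g f h b s : e * e = 1 -> homog b f ->
  brace e g (cup f h) s = cup (brace e g f) h s + e ^+ b *: cup f (brace e g h) s.
Proof.
move=> ee fb; rewrite /cup brace_deconc deconcD; congr (_ + _).
  apply: eq_deconc => u v; rewrite -(@brace_comp _ _ _ _ (fun x => x * h v)) //.
  by move=> c x y; rewrite mulrDl scalerAl.
rewrite -(deconc_sign (chi := fun x w => x * brace e g h w) s ee fb); last first.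
  by move=> w; rewrite mul0r.
apply: eq_deconc => u v; rewrite -(@brace_comp _ _ _ _ (fun x => f u * x)) //.
by move=> c x y; rewrite mulrDr scalerAr.
Qed.

Lemma homog_idc : homog true idc.
Proof. by move=> [|x [|y s]]. Qed.

Lemma brace_mul2 e g s : e * e = 1 ->
  brace e g mul2 s = cup g idc s + e *: cup idc g s.
Proof.
move=> ee; rewrite /mul2 (brace_cup _ _ _ ee homog_idc) expr1.
by congr (_ + _ *: _); apply: eq_deconc => u v; rewrite brace_idc.
Qed.

End Products.

(** * The differential by insertion of the product *)

Section Differential.
Variables (k : comPzRingType) (A : algType k).
Local Notation mul2 := (@mul2 k A).
Local Notation idc := (@idc k A).

Lemma mul2E s : mul2 s = if s is a :: s' then a * idc s' else 0.
Proof. exact: cup_idl. Qed.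

(** The sign (-1)^(n-1) that goes with the insertion of a cochain of
    degree n, where b is the parity of n. *)
Definition eps (b : bool) : k := (-1) ^+ ~~ b.

Lemma epsK b : eps b * eps b = 1.
Proof. by case: b; rewrite /eps /= ?expr0 ?expr1 ?mulr1 ?mulrNN ?mulr1. Qed.

Section Coefficients.
Variable V : lmodType k.
Implicit Types (phi : seq A -> V) (f g h : seq A -> A).

(** The inner part of the Hochschild differential, the alternating sum of
    the phi(..., a_i a_(i+1), ...), is the insertion of the product in
    phi. *)
Definition bar phi : seq A -> V := brace (-1) mul2 phi.

Definition mulhead a phi : seq A -> V :=
  fun s => if s is b :: s' then phi (a * b :: s') else 0.

Lemma bar_nil phi : mlin phi -> bar phi [::] = 0.
Proof. by move=> phil; rewrite /bar brace_nil mul2E (mlin0h). Qed.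

Lemma head_ins_mul2 phi a s : mlin phi -> head_ins mul2 phi (a :: s) = mulhead a phi s.
Proof.
move=> phil; rewrite head_insE /= mul2E (mlin0h) // add0r.
under eq_deconc => u v do rewrite mul2E.
by rewrite (deconc_unaryl (chi := fun x v => phi (a * x :: v))) // => w;
   rewrite mulr0 mlin0h.
Qed.

Lemma bar_cons phi a s : mlin phi ->
  bar phi (a :: s) = mulhead a phi s - bar (fun t => phi (a :: t)) s.
Proof. by move=> phil; rewrite /bar brace_cons head_ins_mul2 //; lin. Qed.

Lemma bar_linear : op_linear bar.
Proof. exact: brace_linear. Qed.

Lemma mlin_bar phi : mlin phi -> mlin (bar phi).
Proof. by move=> phil; apply: mlin_brace => //; apply: mlin_mul2. Qed.

End Coefficients.

(** The Hochschild differential of A: the insertion of g in the product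
    gives the two outer terms, see [difE]. *)
Definition dif b (g : seq A -> A) : seq A -> A :=
  fun s => eps b *: brace (eps b) g mul2 s - bar g s.

Lemma homog_mul2 : homog false mul2.
Proof.
by move=> [|a [|b [|c s]]] // _; rewrite mul2E ?mulr0.
Qed.

(** Associativity of A. *)
Lemma bar_mul2 t : bar mul2 t = 0.
Proof.
have m1 : -1 * -1 = 1 :> k by ring.
rewrite /bar brace_mul2 //.
case: t => [|x t]; first by rewrite cup_idr0 cup_idl; lin.
case/lastP: t => [|t y]; first by rewrite (cup_idr _ [::]) cup_idl !mul2E mul0r mulr0; lin.
rewrite cup_idl -rcons_cons cup_idr mul2E /mul2 cup_idr mulrA; lin.
Qed.

Section Coefficients2.
Variable V : lmodType k.
Implicit Types (phi : seq A -> V) (f g h : seq A -> A).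

(** Both sides insert the product and g in phi. Two applications of the
    pre-Lie identity, in either order, have the same double insertions, so
    that only the insertions of the product in g and of g in the product
    remain; these form [dif b g]. *)
Lemma bar_brace b g phi s : mlin phi -> homog b g ->
  bar (brace (eps b) g phi) s =
  eps b *: brace (eps b) g (bar phi) s - brace (- eps b) (dif b g) phi s.
Proof.
move=> phil gb; rewrite /dif /bar.
have m1 : -1 * -1 = 1 :> k by ring.
rewrite (brace_brace _ _ _ phil m1 gb) (brace_brace _ _ _ phil (epsK b) homog_mul2).
rewrite brace_fun // mulrN1 mulN1r.
have -> : brace (- eps b) (fun s => - brace (-1) mul2 g s) phi s =
   - brace (- eps b) (brace (-1) mul2 g) phi s.
  have := brace_fun (- eps b) (-1) (brace (-1) mul2 g) (fun=> 0) s phil.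
  rewrite brace_fun0 // addr0 scaleN1r => <-; congr (brace _ _ _ _).
  by apply/funext => t; rewrite addr0 scaleN1r.
rewrite expr0; case: b gb => gb; rewrite /eps /=; lin.
Qed.

(** The pre-Lie identity for the product twice: the double insertions
    cancel, and the rest vanishes by associativity. *)
Lemma bar_bar phi s : mlin phi -> bar (bar phi) s = 0.
Proof.
move=> phil; rewrite /bar.
have m1 : -1 * -1 = 1 :> k by ring.
rewrite (brace_brace _ _ _ phil m1 homog_mul2) expr0 m1.
have -> : brace (-1) mul2 mul2 = fun=> 0 by apply/funext => t; apply: bar_mul2.
by rewrite brace_fun0 //; lin.
Qed.

End Coefficients2.

End Differential.

(** * The differential and double insertions *)

Section Brace2.
Variables (k : comPzRingType) (A : algType k).
Local Notation mul2 := (@mul2 k A).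
Local Notation idc := (@idc k A).
Local Notation eps := (@eps k).
Local Notation dif := (@dif k A).

Lemma difE b g s :
  dif b g s = eps b *: cup g idc s + cup idc g s - bar g s.
Proof. by rewrite /dif brace_mul2 ?epsK // scalerDr scalerA epsK scale1r. Qed.

Section Coefficients.
Variable V : lmodType k.
Implicit Types (phi : seq A -> V) (f g h : seq A -> A).

(** The argument that begins with c absorbs the letter next to it, which
    is either a letter of the word or the value of h. *)
Lemma brace_mulhead e h c phi s :
  brace e h (mulhead c phi) s = head_ins h (mulhead c phi) s
    + if s is b :: s' then e *: brace e h (fun t => phi (c * b :: t)) s' else 0.
Proof.
by case: s => [|b s]; rewrite ?brace_cons // brace_nil head_insE /= !addr0.
Qed.

(** The product g u h at the front of the word is the product of g in
    front with the value of h that follows it immediately. *)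
Lemma head_ins_cup g h phi s : mlin phi ->
  head_ins (cup g h) phi s = deconc (fun v w => head_ins h (mulhead (g v) phi) w) s.
Proof.
move=> phil; rewrite head_insE; transitivity
   (deconc (fun p w => deconc (fun u v => phi (g u * h v :: w)) p) s).
  apply: eq_deconc => u v; rewrite -(@deconc_comp _ _ _ _ (fun x => phi (x :: v))) //.
  by move=> c x y; apply: mlin_head.
rewrite -(deconcA (fun u v w => phi (g u * h v :: w))); apply: eq_deconc => u v.
by rewrite head_insE.
Qed.

Lemma brace_cst0 e h phi s : mlin phi -> brace e h (fun t => phi (0 :: t)) s = 0.
Proof.
move=> phil; rewrite (_ : (fun t => _) = fun=> 0) ?(op0 (@brace_linear _ _ _ _ _)) //.
by apply/funext => t; rewrite mlin0h.
Qed.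

Lemma head_ins2_cup_idr eh g h phi s : mlin phi ->
  head_ins2 eh (cup g idc) h phi s =
  deconc (fun v w => if w is b :: w' then brace eh h (fun t => phi (g v * b :: t)) w'
                     else 0) s.
Proof.
move=> phil; rewrite head_ins2E; transitivity
   (deconc (fun p w => deconc (fun u v => brace eh h (fun t => phi (g u * idc v :: t)) w) p) s).
  apply: eq_deconc => u v.
  rewrite -(@deconc_comp _ _ _ _ (fun x => brace eh h (fun t => phi (x :: t)) v)) //.
  by move=> c x y; apply: brace_mlin_head.
rewrite -(deconcA (fun u v w => brace eh h (fun t => phi (g u * idc v :: t)) w)).
apply: eq_deconc => u v.
rewrite (deconc_unaryl (chi := fun x w => brace eh h (fun t => phi (g u * x :: t)) w)) //.
by move=> w; rewrite mulr0 brace_cst0.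
Qed.

Lemma head_ins2_cup_idl eh g h phi a s : mlin phi ->
  head_ins2 eh (cup idc g) h phi (a :: s) = head_ins2 eh g h (mulhead a phi) s.
Proof.
move=> phil; rewrite !head_ins2E /=.
under eq_deconc => u v do rewrite cup_idl.
by rewrite cup_idl brace_cst0 // add0r.
Qed.

Section TwoCochains.
Variables (bg bh : bool) (g h : seq A -> A).
Hypotheses (gl : mlin g) (hl : mlin h) (gb : homog bg g) (hb : homog bh h).
Local Notation eg := (eps bg).
Local Notation eh := (eps bh).

(** On the left, a product of two letters is an argument of g, an argument
    of h, or outside of both. The first two kinds are insertions of the
    product in g and in h. The third kind consists of terms of [bar phi],
    which also contains g(v) h(w) when these are adjacent, whence the cup
    product, and products of g(v) or h(w) with a neighbouring letter,
    which complete the insertions of the product in g and h to [dif]. As g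
    stands at the front of the word, the product of the letter a with g(v)
    is not among these terms; it accounts for the first term on the right. *)
Lemma bar_head_ins2 phi a s : mlin phi ->
  bar (head_ins2 eh g h phi) (a :: s) =
  head_ins2 eh g h (mulhead a phi) s
  + (eg * eh) *: head_ins2 eh g h (bar phi) (a :: s)
  - ((eg * eh) *: head_ins (cup g h) phi (a :: s)
     + head_ins2 eh (dif bg g) h phi (a :: s)
     - eg *: head_ins2 (- eh) g (dif bh h) phi (a :: s)).
Proof.
move=> phil; have m1 : -1 * -1 = 1 :> k by ring.
have -> : bar (head_ins2 eh g h phi) (a :: s) =
    head_ins2 eh (bar g) h phi (a :: s)
    - eg *: (eh *: deconc (fun v w => brace eh h (bar (fun t => phi (g v :: t))) w) (a :: s)
             - head_ins2 (- eh) g (dif bh h) phi (a :: s)).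
  have -> : head_ins2 eh g h phi =
      deconc (fun v w => brace eh h (fun t => phi (g v :: t)) w).
    by apply/funext => t; rewrite head_ins2E.
  rewrite /bar brace_deconc deconcD; congr (_ + _).
    rewrite head_ins2E; apply: eq_deconc => u v.
    rewrite -(@brace_comp _ _ _ _ (fun x => brace eh h (fun t => phi (x :: t)) v)) //.
    by move=> c x y; apply: brace_mlin_head.
  rewrite (deconc_sign (chi := fun x w => bar (brace eh h (fun t => phi (x :: t))) w) _ m1 gb).
    rewrite -scaleNr; have -> : (-1) ^+ bg = - eg :> k.
      by case: (bg); rewrite /eps /= ?expr0 ?expr1 ?opprK.
    congr (_ *: _); rewrite head_ins2E -deconcZ -[X in _ = _ - X]scale1r -scaleNr addrC -deconcP.
    apply: eq_deconc => u v; rewrite bar_brace //; first by lin.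
    exact: mlin_cons.
  move=> w; rewrite (_ : brace eh h _ = fun=> 0) ?(op0 (@bar_linear _ _ _)) //.
  by apply/funext => t; rewrite brace_cst0.
have -> : head_ins2 eh g h (bar phi) (a :: s) =
    head_ins (cup g h) phi (a :: s) + eh *: head_ins2 eh (cup g idc) h phi (a :: s)
    - deconc (fun v w => brace eh h (bar (fun t => phi (g v :: t))) w) (a :: s).
  rewrite head_ins_cup // head_ins2_cup_idr // head_ins2E.
  transitivity (deconc (fun v w =>
     -1 *: brace eh h (bar (fun t => phi (g v :: t))) w
     + (head_ins h (mulhead (g v) phi) w
        + eh *: (if w is b :: w' then brace eh h (fun t => phi (g v * b :: t)) w'
                 else 0))) (a :: s)); last by rewrite deconcP deconcD deconcZ; lin.
  apply: eq_deconc => u v.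
  have -> : (fun t => bar phi (g u :: t)) =
      (fun t => -1 *: bar (fun t => phi (g u :: t)) t + mulhead (g u) phi t).
    by apply/funext => t; rewrite bar_cons //; lin.
  by rewrite braceP brace_mulhead; case: v => [|b v]; lin.
have -> : head_ins2 eh (bar g) h phi (a :: s) =
    eg *: head_ins2 eh (cup g idc) h phi (a :: s)
    + head_ins2 eh g h (mulhead a phi) s - head_ins2 eh (dif bg g) h phi (a :: s).
  rewrite -head_ins2_cup_idl //.
  have -> : bar g = fun v => -1 *: dif bg g v + (eg *: cup g idc v + cup idc g v).
    by apply/funext => v; rewrite difE; lin.
  by rewrite !head_ins2_funl //; lin.
by case: (bg); case: (bh); rewrite /eps /=; lin.
Qed.

(** The analogue of [bar_brace] for double insertions. The additional term
    with g u h comes from the product of the values of g and h when these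
    are adjacent. *)
Lemma bar_brace2 phi s : mlin phi ->
  bar (brace2 (eg * eh) eh g h phi) s =
  (eg * eh) *: brace2 (eg * eh) eh g h (bar phi) s
  - ((eg * eh) *: brace (- (eg * eh)) (cup g h) phi s
     + brace2 (- (eg * eh)) eh (dif bg g) h phi s
     - eg *: brace2 (- (eg * eh)) (- eh) g (dif bh h) phi s).
Proof.
elim: s phi => [|a s IH] phi phil.
  rewrite bar_nil; last exact: mlin_brace2.
  have dif0 b f : mlin f -> dif b f [::] = 0.
    by move=> fl; rewrite difE bar_nil // cup_idr0 cup_idl; lin.
  rewrite !brace2_nil brace_nil !dif0 // (mlin0 [:: _]) // mlin0h //.
  rewrite bar_cons //= bar_cons; last exact: mlin_cons.
  rewrite bar_nil /cup /=; last exact: (mlin_cons _ (mlin_cons _ phil)).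
  by rewrite !addr0; lin.
have e1 : (eps bg * eps bh) * (eps bg * eps bh) = 1.
  by rewrite mulrACA !epsK mulr1.
rewrite bar_cons; last exact: mlin_brace2.
have -> : (fun t => brace2 (eg * eh) eh g h phi (a :: t)) =
   (fun t => (eg * eh) *: brace2 (eg * eh) eh g h (fun t => phi (a :: t)) t
             + head_ins2 eh g h phi (a :: t)).
  by apply/funext => t; rewrite brace2_cons addrC.
rewrite bar_linear IH; last exact: mlin_cons.
have := bar_head_ins2 a s phil; rewrite bar_cons; last exact: mlin_head_ins2.
have -> : mulhead a (brace2 (eg * eh) eh g h phi) s =
    mulhead a (head_ins2 eh g h phi) s
    + if s is b :: s' then (eg * eh) *: brace2 (eg * eh) eh g h (fun t => phi (a * b :: t)) s'
      else 0.
  by case: s {IH} => [|b s] /=; rewrite ?addr0 // brace2_cons.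
have E : brace2 (eg * eh) eh g h (mulhead a phi) s =
    head_ins2 eh g h (mulhead a phi) s
    + if s is b :: s' then (eg * eh) *: brace2 (eg * eh) eh g h (fun t => phi (a * b :: t)) s'
      else 0.
  case: s {IH} => [|b s] /=; last by rewrite brace2_cons.
  by rewrite brace2E /= !addr0.
rewrite (brace2_cons _ _ _ _ (bar phi)).
have -> : brace2 (eg * eh) eh g h (fun t => bar phi (a :: t)) s =
    brace2 (eg * eh) eh g h (mulhead a phi) s
    - brace2 (eg * eh) eh g h (bar (fun t => phi (a :: t))) s.
  rewrite -[X in _ - X]scale1r -scaleNr addrC -brace2_linear.
  by congr (brace2 _ _ _ _ _ _); apply/funext => t; rewrite bar_cons //; lin.
rewrite E brace_cons !brace2_cons.
set X := if s is _ :: _ then _ else _.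
move=> /eqP; rewrite subr_eq => /eqP ->.
move: (eg * eh) e1 => e e1.
lin_using e1 e1.
Qed.
End TwoCochains.
End Coefficients.
End Brace2.

(** * Gerstenhaber identities for cochains *)

Section Gerstenhaber.
Variables (k : comPzRingType) (A : algType k).
Local Notation mul2 := (@mul2 k A).
Local Notation idc := (@idc k A).
Local Notation eps := (@eps k).
Local Notation dif := (@dif k A).
Implicit Types (f g h phi : seq A -> A).

Lemma cup_ext f f' g g' s : (forall t, f t = f' t) -> (forall t, g t = g' t) ->
  cup f g s = cup f' g' s.
Proof. by move=> E E'; apply: eq_deconc => u v; rewrite E E'. Qed.

Lemma cupPl c f f' g s :
  cup (fun t => c *: f t + f' t) g s = c *: cup f g s + cup f' g s.
Proof. by rewrite -deconcP; apply: eq_deconc => u v; rewrite mulrDl scalerAl. Qed.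

Lemma cupPr c f g g' s :
  cup f (fun t => c *: g t + g' t) s = c *: cup f g s + cup f g' s.
Proof. by rewrite -deconcP; apply: eq_deconc => u v; rewrite mulrDr scalerAr. Qed.

Lemma cup0l g s : cup (fun=> 0) g s = 0.
Proof. by rewrite /cup; under eq_deconc => u v do rewrite mul0r; rewrite deconc0. Qed.

Lemma cup0r g s : cup g (fun=> 0) s = 0.
Proof. by rewrite /cup; under eq_deconc => u v do rewrite mulr0; rewrite deconc0. Qed.

Lemma cup_assoc f g h s : cup f (cup g h) s = cup (cup f g) h s.
Proof.
transitivity (deconc (fun u z => deconc (fun v w => f u * g v * h w) z) s).
  apply: eq_deconc => u v.
  rewrite (@deconc_comp _ _ _ _ (fun x => f u * x)).
    by apply: eq_deconc => x y; rewrite mulrA.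
  by move=> c x y; rewrite mulrDr scalerAr.
rewrite deconcA; apply: eq_deconc => u v.
rewrite (@deconc_comp _ _ _ _ (fun x => x * h v)) //.
by move=> c x y; rewrite mulrDl scalerAl.
Qed.

Lemma cup_cons f g a s :
  cup f g (a :: s) = f [::] * g (a :: s) + cup (fun t => f (a :: t)) g s.
Proof. by []. Qed.

Lemma homog_cons (V : lmodType k) b (chi : seq A -> V) a :
  homog b chi -> homog (~~ b) (fun t => chi (a :: t)).
Proof. by move=> chib t tb; rewrite chib //=; case: (odd _) (b) tb => [] []. Qed.

(** A double insertion in a cup product puts both cochains in the first
    factor, one in each, or both in the second. *)
Lemma brace2_cup eg eh b g h f phi s :
  eg * eg = 1 -> eh * eh = 1 -> homog b f ->
  brace2 (eg * eh) eh g h (cup f phi) s =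
  cup (brace2 (eg * eh) eh g h f) phi s
  + eh ^+ (~~ b) *: cup (brace eg g f) (brace eh h phi) s
  + (eg * eh) ^+ b *: cup f (brace2 (eg * eh) eh g h phi) s.
Proof.
move=> eeg eeh.
have lmul (x : A) : linear (fun y => x * y).
  by move=> c y z; rewrite mulrDr scalerAr.
have rmul (x : A) : linear (fun y => y * x).
  by move=> c y z; rewrite mulrDl scalerAl.
have headE b' f' t : homog b' f' ->
    head_ins2 eh g h (cup f' phi) t =
    cup (head_ins2 eh g h f') phi t
    + eh ^+ (~~ b') *: cup (head_ins g f') (brace eh h phi) t
    + f' [::] * head_ins2 eh g h phi t.
  move=> fb; transitivity (deconc (fun v z =>
     (eh ^+ (~~ b') *: deconc (fun x y => f' (g v :: x) * brace eh h phi y) z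
      + deconc (fun x y => brace eh h (fun t => f' (g v :: t)) x * phi y) z)
     + f' [::] * brace eh h (fun t => phi (g v :: t)) z) t).
    rewrite head_ins2E; apply: eq_deconc => v z.
    have -> : (fun u => cup f' phi (g v :: u)) =
       (fun u => cup (fun t => f' (g v :: t)) phi u + f' [::] * phi (g v :: u)).
      by apply/funext => u; rewrite cup_cons addrC.
    rewrite (opD (@brace_linear _ _ _ _ _)) -(brace_comp (lmul (f' [::]))).
    by rewrite (brace_cup _ _ _ eeh (homog_cons (g v) fb)) /cup; lin.
  rewrite deconcD deconcP; congr (_ + _); last first.
    by rewrite -(deconc_comp (lmul (f' [::]))) head_ins2E.
  rewrite !deconcA addrC; congr (_ + _ *: _); apply: eq_deconc => u v.
    by rewrite -(deconc_comp (rmul (phi v))) head_ins2E.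
  by rewrite -(deconc_comp (rmul (brace eh h phi v))) head_insE.
elim: s f b => [|a s IH] f b fb.
  rewrite brace2E /= addr0 (headE b) // /cup /= !addr0.
  rewrite !brace2E /= !addr0 !brace_nil !head_insE /= !addr0; congr (_ + _).
  case: b fb => fb; first by rewrite (fb [::]) // !mul0r scaler0.
  by rewrite expr0 scale1r.
rewrite brace2_cons (headE b) //.
have -> : (fun t => cup f phi (a :: t)) =
   (fun t => cup (fun t => f (a :: t)) phi t + f [::] * phi (a :: t)).
  by apply/funext => u; rewrite cup_cons addrC.
rewrite (opD (@brace2_linear _ _ _ _ _ _ _)) (IH _ _ (homog_cons a fb)).
rewrite -(brace2_comp (lmul (f [::]))).
rewrite !(cup_cons (brace2 _ _ _ _ _)) !(cup_cons (brace _ _ _)) (cup_cons f).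
rewrite !(cup_cons (head_ins2 _ _ _ _)) !(cup_cons (head_ins _ _)).
have -> : (fun t => brace2 (eg * eh) eh g h f (a :: t)) =
   (fun t => (eg * eh) *: brace2 (eg * eh) eh g h (fun t => f (a :: t)) t
             + head_ins2 eh g h f (a :: t)).
  by apply/funext => t; rewrite brace2_cons addrC.
have -> : (fun t => brace eg g f (a :: t)) =
   (fun t => eg *: brace eg g (fun t => f (a :: t)) t + head_ins g f (a :: t)).
  by apply/funext => t; rewrite brace_cons addrC.
rewrite !cupPl brace2_cons mulrDr -scalerAr.
have -> : brace2 (eg * eh) eh g h f [::] = head_ins2 eh g h f [::].
  by rewrite brace2E /= addr0.
have -> : brace eg g f [::] = head_ins g f [::] by rewrite braceE /= addr0.
case: b fb => fb /=; rewrite expr0 !expr1; last by lin_using eeg eeh.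
by rewrite (fb [::]) // !mul0r; lin_using eeg eeh.
Qed.

Lemma brace2_idc e eh g h s : brace2 e eh g h idc s = 0.
Proof.
have nilsupp (phi : seq A -> A) t : (forall x t', phi (x :: t') = 0) -> brace2 e eh g h phi t = 0.
  elim: t phi => [|x t IH] phi E; first by rewrite brace2_nil.
  rewrite brace2_cons head_ins2E IH; last by move=> *; apply: E.
  rewrite (@eq_deconc _ _ _ _ (fun _ _ => 0)) ?deconc0; first by lin.
  move=> u v; rewrite (_ : (fun t => _) = fun=> 0) ?(op0 (@brace_linear _ _ _ _ _)) //.
  by apply/funext => y; rewrite E.
have brnil (x : A) u : brace eh h (fun t => idc (x :: t)) u = 0.
  elim: u => [|y u IH]; first by rewrite brace_nil.
  rewrite brace_cons head_insE (@eq_deconc _ _ _ _ (fun _ _ => 0)) ?deconc0 //.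
  rewrite (_ : (fun t => _) = fun=> 0) ?(op0 (@brace_linear _ _ _ _ _)) //; lin.
have hd t : head_ins2 eh g h idc t = 0.
  rewrite head_ins2E (@eq_deconc _ _ _ _ (fun _ _ => 0)) ?deconc0 // => u v.
case: s => [|a s]; first by rewrite brace2E /= hd addr0.
by rewrite brace2_cons hd nilsupp //; lin.
Qed.

(** The cup product is a double insertion in the product of A. This
    reduces [dif_cup] to [bar_brace2]. *)
Lemma brace2_mul2 bg bh g h s : brace2 (eps bg * eps bh) (eps bh) g h mul2 s = cup g h s.
Proof.
rewrite /mul2 (brace2_cup _ _ _ _ (epsK _ _) (epsK _ _) (@homog_idc _ _)).
rewrite (cup_ext s (fun t => brace2_idc _ _ _ _ t) (fun=> erefl)) cup0l.
rewrite (@cup_ext idc idc (brace2 _ _ _ _ _) (fun=> 0) s) // ?cup0r; last first.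
  by move=> t; rewrite brace2_idc.
rewrite (cup_ext s (fun t => brace_idc _ _ t) (fun t => brace_idc _ _ t)).
by rewrite /= expr0; lin.
Qed.

Section Signs.
Variables (bf bg bh : bool).
Local Notation ef := (eps bf).
Local Notation eg := (eps bg).
Local Notation eh := (eps bh).

Lemma eps_brace : eps (bf (+) ~~ bg) = ef * eg.
Proof. by case: (bf); case: (bg); rewrite /eps /= ?expr0 ?expr1; ring. Qed.

Lemma eps_cup : eps (bf (+) bg) = - (ef * eg).
Proof. by case: (bf); case: (bg); rewrite /eps /= ?expr0 ?expr1; ring. Qed.

(** [bar_brace] gives the inner part of the differential. The outer part
    inserts f{g} in the product, and differs from the insertion of g in
    the outer part of the differential of f by the double insertions of f
    and g in the product, which are f u g and g u f. *)
Lemma dif_brace f g s : mlin f -> homog bf f -> homog bg g ->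
  dif (bf (+) ~~ bg) (brace eg g f) s =
  eg *: brace eg g (dif bf f) s + brace (- eg) (dif bg g) f s
  - ((ef * eg ^+ (~~ bf)) *: cup f g s + eg *: cup g f s).
Proof.
move=> fl fb gb; rewrite {1}/dif eps_brace bar_brace //.
have := brace_brace ef g s (@mlin_mul2 k A) (epsK k bg) fb.
rewrite brace2_mul2 mulrC brace2_mul2 [eg * ef]mulrC => E.
have -> : brace eg g (dif bf f) s =
   ef *: brace eg g (brace ef f mul2) s - brace eg g (bar f) s.
  have -> : dif bf f = (fun t => -1 *: bar f t + ef *: brace ef f mul2 t).
    by apply/funext => t; rewrite scaleN1r addrC.
  by rewrite braceP (opZ (@brace_linear _ _ _ _ _)) addrC scaleN1r.
have ee := epsK k bf; have ee' := epsK k bg.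
rewrite E; case: (bf) ee => ee /=; rewrite expr0 ?expr1; lin_using ee ee'.
Qed.

Lemma epsN b : eps (~~ b) = - eps b.
Proof. by case: b; rewrite /eps /= ?expr0 ?expr1 ?opprK. Qed.

Lemma dif_cup g h s : mlin g -> mlin h -> homog bg g -> homog bh h ->
  dif (bg (+) bh) (cup g h) s = cup (dif bg g) h s - eg *: cup g (dif bh h) s.
Proof.
move=> gl hl gb hb.
have m2 : mlin mul2 by apply: mlin_mul2.
have := bar_brace2 gl hl gb hb s m2.
have -> : brace2 (eg * eh) eh g h mul2 = cup g h.
  by apply/funext => t; rewrite brace2_mul2.
have -> : bar mul2 = fun=> 0 by apply/funext => t; rewrite bar_mul2.
have E1 : - (eg * eh) = eps (~~ bg) * eh by rewrite epsN mulNr.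
have E2 : - (eg * eh) = eg * eps (~~ bh) by rewrite epsN mulrN.
rewrite {2}E1 {2}E2 brace2_mul2 -epsN brace2_mul2 /dif => ->.
rewrite (op0 (@brace2_linear _ _ _ _ _ _ _)).
have -> : eps (bg (+) bh) = - (eg * eh).
  by case: (bg); case: (bh); rewrite /eps /= ?expr0 ?expr1; ring.
lin.
Qed.

(** The differential of f{g,h} for cocycles: inner terms from
    [bar_brace2], where the insertions of the differentials of g and h
    vanish; outer terms where f has one argument outside of g and h,
    computed by expressing [bar f] through cup products with the identity. *)
Lemma dif_brace2 f g h s : mlin f -> mlin g -> mlin h ->
  homog bf f -> homog bg g -> homog bh h ->
  (forall t, dif bf f t = 0) -> (forall t, dif bg g t = 0) ->
  (forall t, dif bh h t = 0) ->
  dif (bf (+) bg (+) bh) (brace2 (eg * eh) eh g h f) s =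
  (eg * eh) *: (brace (- (eg * eh)) (cup g h) f s
    - (ef * eh ^+ (~~ bf)) *: cup (brace eg g f) h s - cup g (brace eh h f) s).
Proof.
move=> fl gl hl fb gb hb df dg dh.
rewrite /dif; have -> : eps (bf (+) bg (+) bh) = ef * (eg * eh).
  by case: (bf); case: (bg); case: (bh); rewrite /eps /= ?expr0 ?expr1; ring.
have ee : eg * eh * (eg * eh) = 1 by rewrite mulrACA !epsK mulr1.
have ef1 := epsK k bf.
have sq : ef * (eg * eh) * (ef * (eg * eh)) = 1 by rewrite mulrACA ef1 ee mulr1.
rewrite (brace_mul2 _ _ sq) bar_brace2 //.
have -> : dif bg g = fun=> 0 by apply/funext.
have -> : dif bh h = fun=> 0 by apply/funext.
rewrite brace2_fun0l // brace2_fun0r //.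
have -> : bar f = (fun t => ef *: cup f idc t + cup idc f t).
  by apply/funext => t; have /eqP := df t; rewrite difE subr_eq0 => /eqP.
rewrite brace2_linear (brace2_cup _ _ _ _ (epsK _ _) (epsK _ _) fb).
rewrite (brace2_cup _ _ _ _ (epsK _ _) (epsK _ _) (@homog_idc _ _)).
have -> : brace2 (eg * eh) eh g h idc = fun=> 0.
  by apply/funext => t; rewrite brace2_idc.
have -> : brace eh h idc = h by apply/funext => t; rewrite brace_idc.
have -> : brace eg g idc = g by apply/funext => t; rewrite brace_idc.
rewrite cup0l cup0r expr0 expr1.
have e2 : eh * eh = 1 := epsK k bh.
lin_using ee ef1.
Qed.

(** The Gerstenhaber bracket, in terms of the parities of the degrees. *)
Definition brk bf bg f g : seq A -> A :=
  fun s => (-1) ^+ (~~ bf && ~~ bg) *: brace (eps bg) g f s - brace (eps bf) f g s.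

(** Up to sign, the double insertions in the pre-Lie identity are
    symmetric in g and h, hence drop out of the commutator. So insertion
    represents the bracket, and the Jacobi identity follows. *)
Lemma brace_brk (V : lmodType k) g h (phi : seq A -> V) s :
  mlin phi -> homog bg g -> homog bh h ->
  brace (eg * eh) (brk bg bh g h) phi s =
  (-1) ^+ (~~ bg && ~~ bh) *: brace eh h (brace eg g phi) s
  - brace eg g (brace eh h phi) s.
Proof.
move=> phil gb hb.
have -> : brk bg bh g h = (fun t => (-1) ^+ (~~ bg && ~~ bh) *: brace (eps bh) h g t
   + (-1 *: brace eg g h t + 0)).
  by apply/funext => t; rewrite addr0 scaleN1r.
rewrite brace_fun // brace_fun // brace_fun0 //.
rewrite (brace_brace _ _ _ phil (epsK k bh) gb) (brace_brace _ _ _ phil (epsK k bg) hb).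
rewrite [eh * eg]mulrC.
by case: (bg); case: (bh); rewrite /eps /= ?expr0 ?expr1; lin.
Qed.

End Signs.

Lemma brkE bf bg f g s : brk bf bg f g s =
  (-1) ^+ (~~ bf && ~~ bg) *: brace (eps bg) g f s - brace (eps bf) f g s.
Proof. by []. Qed.

Lemma brace_in_brk e x bf bg f g s : brace e x (brk bf bg f g) s =
  (-1) ^+ (~~ bf && ~~ bg) *: brace e x (brace (eps bg) g f) s
  - brace e x (brace (eps bf) f g) s.
Proof.
rewrite -scaleN1r addrC.
have -> : brk bf bg f g = (fun t => -1 *: brace (eps bf) f g t +
    (-1) ^+ (~~ bf && ~~ bg) *: brace (eps bg) g f t).
  by apply/funext => t; rewrite scaleN1r addrC.
by rewrite braceP (opZ (@brace_linear _ _ _ _ _)).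
Qed.

Lemma brk_jacobi bf bg bh f g h s : mlin f -> mlin g -> mlin h ->
  homog bf f -> homog bg g -> homog bh h ->
  brk bf (bg (+) ~~ bh) f (brk bg bh g h) s =
  brk (bf (+) ~~ bg) bh (brk bf bg f g) h s
  + (-1) ^+ (~~ bf && ~~ bg) *: brk bg (bf (+) ~~ bh) g (brk bf bh f h) s.
Proof.
move=> fl gl hl fb gb hb.
rewrite (brkE bf (bg (+) ~~ bh)) (brkE (bf (+) ~~ bg)) (brkE bg (bf (+) ~~ bh)).
rewrite !eps_brace !brace_brk // !brace_in_brk.
by case: bf {fb}; case: bg {gb}; case: bh {hb} => /=; rewrite ?expr0 ?expr1; lin.
Qed.

End Gerstenhaber.

(** * Sums over rotations of a word *)

Section Rotations.
Variables (k : comPzRingType) (A : algType k) (V : lmodType k).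
Local Notation idc := (@idc k A).
Implicit Types (phi : seq A -> V) (g h : seq A -> A).

Lemma mlin_catl phi u : mlin phi -> mlin (fun t => phi (u ++ t)).
Proof. by move=> phil s t c a b; rewrite !catA phil. Qed.

Lemma mlin_catr phi w : mlin phi -> mlin (fun v => phi (v ++ w)).
Proof. by move=> phil s t c a b; rewrite -!catA phil. Qed.

Lemma mlin_rcons phi x : mlin phi -> mlin (fun v => phi (rcons v x)).
Proof. by move=> phil s t c a b; rewrite -!cats1 -!catA phil. Qed.

Lemma mlin_sign e phi : mlin phi -> mlin (fun v => e ^+ size v *: phi v).
Proof. by move=> phil s t c a b; rewrite phil !size_cat /=; lin. Qed.

Lemma eq_deconc_cat (psi psi' : seq A -> seq A -> V) s :
  (forall u v, u ++ v = s -> psi u v = psi' u v) -> deconc psi s = deconc psi' s.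
Proof.
elim: s psi psi' => [|a s IH] psi psi' E /=; rewrite E //.
by rewrite (IH _ (fun u => psi' (a :: u))) // => u v uv; apply: E; rewrite /= uv.
Qed.

Lemma op_brace (T : (seq A -> V) -> seq A -> V) (TP : op_linear T)
    e g (chi : seq A -> seq A -> V) s w :
  T (fun x => brace e g (fun v => chi v x) w) s = brace e g (fun v => T (chi v) s) w.
Proof.
elim: w chi => [|a w IH] chi.
  by rewrite brace_nil; congr (T _ s); apply/funext => x; rewrite brace_nil.
rewrite brace_cons -IH head_insE -(op_deconc TP) -(opZ TP) -(opD TP).
by congr (T _ s); apply/funext => x; rewrite brace_cons head_insE.
Qed.

(** Multiplying two letters shortens the word by one, so that the sign
    e^|v| is off by a factor e. *)
Lemma bar_sign e phi s : e * e = 1 -> mlin phi ->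
  bar (fun v => e ^+ size v *: phi v) s = (e * e ^+ size s) *: bar phi s.
Proof.
move=> ee; elim: s phi => [|a s IH] phi phil.
  by rewrite !bar_nil ?scaler0 //; apply: mlin_sign.
rewrite !bar_cons //; last exact: mlin_sign.
have -> : (fun t => e ^+ size (a :: t) *: phi (a :: t)) =
    (fun t => e *: (e ^+ size t *: phi (a :: t))).
  by apply/funext => t; rewrite exprS scalerA.
rewrite (opZ (@bar_linear _ _ _)) IH; last exact: mlin_cons.
by case: s {IH} => [|b s] /=; rewrite ?exprS; lin_using ee ee.
Qed.

(** Two neighbours lie both in (u, x) or both in (x, w). *)
Lemma bar_cat phi u x w : mlin phi ->
  bar phi (u ++ x :: w) = bar (fun v => phi (v ++ w)) (rcons u x)
    + (-1) ^+ size u *: bar (fun t => phi (u ++ t)) (x :: w).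
Proof.
elim: u phi => [|a u IH] phi phil /=.
  rewrite [bar _ [:: x]]bar_cons; last exact: mlin_catr.
  by rewrite bar_nil /=; [lin | exact: (mlin_cons x (mlin_catr w phil))].
rewrite (bar_cons a _ phil) (IH _ (mlin_cons a phil)).
rewrite (bar_cons a _ (mlin_catr w phil)).
by case: u {IH} => [|b u] /=; rewrite ?exprS ?cat_rcons; lin.
Qed.

Lemma bar_rcons phi u x : mlin phi ->
  bar phi (rcons u x) = bar (fun v => phi (rcons v x)) u
   - (-1) ^+ size u *: deconc (fun v y => phi (rcons v (idc y * x))) u.
Proof.
elim: u phi => [|a u IH] phi phil /=.
  rewrite bar_cons //= !bar_nil ?mul0r ?mlin0h //; first by lin.
  - exact: mlin_rcons.
  - exact: mlin_cons.
rewrite (bar_cons a _ phil) (IH _ (mlin_cons a phil)).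
rewrite (bar_cons a _ (mlin_rcons x phil)).
case: u IH => [|b u] IH /=; last by rewrite mul0r mlin0h // !exprS; lin.
by rewrite mul0r (mlin0 [:: a]) //; lin.
Qed.
End Rotations.

Section CyclicSums.
Variables (k : comPzRingType) (A : algType k) (V : lmodType k).
Local Notation idc := (@idc k A).
Implicit Types (phi : seq A -> V) (g h : seq A -> A).

(** The sum over the rotations (w, a0, p) of (a0, p, w), with an operator
    T acting on the letters between a0 and the end. For T the identity it
    is the Connes operator; for T the insertion of g it is the homotopy
    for the Batalin-Vilkovisky identity. *)
Definition cyc (T : (seq A -> V) -> seq A -> V) (e : k) phi (a0 : A) : seq A -> V :=
  deconc (fun p w => e ^+ size w *: T (fun p' => phi (w ++ a0 :: p')) p).

(** The differential of the Hochschild complex of A with values in its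
    dual, for cochains h(a0)(s) with the functional evaluated at a0, see
    [hoch_d_dual]. *)
Definition cdif (h : A -> seq A -> V) (a0 : A) : seq A -> V := fun s =>
  deconc (fun y s' => h (a0 * idc y) s') s - bar (h a0) s
  + (-1) ^+ size s *: deconc (fun s' y => h (idc y * a0) s') s.

Lemma op_mlin0 (T : (seq A -> V) -> seq A -> V) phi u w s : op_linear T ->
  mlin phi -> T (fun t => phi (u ++ 0 :: (w ++ t))) s = 0.
Proof.
move=> TP phil; rewrite (_ : (fun t => _) = fun=> 0) ?(op0 TP) //.
by apply/funext => t; rewrite mlin0.
Qed.

Section Operator.
Variables (T : (seq A -> V) -> seq A -> V) (eta e : k).
Hypotheses (TP : op_linear T) (ee : e * e = 1) (etaeta : eta * eta = 1).
Hypothesis Tbar : forall phi s, mlin phi -> bar (T phi) s = eta *: T (bar phi) s.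

(** Sorts the terms of the product inserted in the rotated word (w, a0,
    p): two letters of w, two letters of p, the last letter of w with a0,
    or a0 with the first letter of p. *)
Let Tbar_rotation phi a0 p w : mlin phi ->
  T (bar (fun t => phi (w ++ a0 :: t))) p =
  T (mulhead a0 (fun t => phi (w ++ t))) p
  + (-1) ^+ size w *: bar (fun v => T (fun t => phi (v ++ a0 :: t)) p) w
  - deconc (fun v y => T (fun t => phi (v ++ (idc y * a0) :: t)) p) w
  - (-1) ^+ size w *: T (fun t => bar phi (w ++ a0 :: t)) p.
Proof.
move=> phil.
have -> : bar (fun t => phi (w ++ a0 :: t)) = (fun t =>
    -1 *: ((-1) ^+ size w *: bar phi (w ++ a0 :: t))
    + ((-1) ^+ size w *: bar (fun v => phi (v ++ a0 :: t)) w
       + (-1 *: deconc (fun v y => phi (v ++ (idc y * a0) :: t)) w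
          + mulhead a0 (fun t => phi (w ++ t)) t))).
  apply/funext => t; rewrite bar_cat // bar_rcons; last exact: mlin_catr.
  rewrite bar_cons; last exact: mlin_catl.
  have -> : (fun v => phi (rcons v a0 ++ t)) = (fun v => phi (v ++ a0 :: t)).
    by apply/funext => v; rewrite cat_rcons.
  have -> : deconc (fun v y => phi (rcons v (idc y * a0) ++ t)) w =
      deconc (fun v y => phi (v ++ (idc y * a0) :: t)) w.
    by apply: eq_deconc => u v; rewrite cat_rcons.
  by rewrite -signr_odd; case: (odd _); rewrite ?expr0 ?expr1; lin.
rewrite !TP (opZ TP) (op_deconc TP) (op_brace TP); lin.
Qed.

(** The inner part of the differential multiplies two letters of p or two
    letters of w. By [Tbar_rotation] these products form the rotations of
    [bar phi], up to products that involve a0. The products of a last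
    letter with a0 are at the same time the outer terms of [cdif] on the
    right, and cancel. The hypothesis on the length of s selects the
    parity for which the signs of the two agree. *)
Lemma cdif_cyc phi a0 s : mlin phi -> (-1) ^+ size s = - (e * eta) ->
  cdif (cyc T e phi) a0 s =
  deconc (fun y s' => cyc T e phi (a0 * idc y) s') s
  - eta *: deconc (fun p w => e ^+ size w *: T (mulhead a0 (fun t => phi (w ++ t))) p) s
  + eta *: deconc (fun p w => (- e) ^+ size w *: T (fun t => bar phi (w ++ a0 :: t)) p) s.
Proof.
move=> phil sz; rewrite /cdif.
have -> : bar (cyc T e phi a0) s = deconc (fun p w =>
    - eta *: ((- e) ^+ size w *: T (fun t => bar phi (w ++ a0 :: t)) p)
    + (- eta *: (e ^+ size w *:
         deconc (fun v y => T (fun t => phi (v ++ (idc y * a0) :: t)) p) w)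
       + eta *: (e ^+ size w *: T (mulhead a0 (fun t => phi (w ++ t))) p))) s.
  rewrite /cyc /bar brace_deconc; apply: eq_deconc_cat => p w pw.
  rewrite -/(bar _ p) -/(bar _ w) (opZ (@bar_linear _ _ _)) Tbar; last exact: (mlin_cons _ (mlin_catl _ phil)).
  rewrite Tbar_rotation // bar_sign //; last first.
    move=> u v c x y; rewrite -TP; congr (T _ p).
    by apply/funext => t; rewrite -!catA phil.
  have -> : (-1) ^+ size p = - (e * eta) * (-1) ^+ size w :> k.
    rewrite -sz -pw size_cat exprD -mulrA -exprMn mulrNN mulr1 expr1n mulr1 //.
  by rewrite -/(bar phi) (exprNn e); lin_using ee etaeta.
rewrite !deconcP !deconcZ sz.
have -> : deconc (fun s' y => cyc T e phi (idc y * a0) s') s =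
    e *: deconc (fun p w => e ^+ size w *:
        deconc (fun v y => T (fun t => phi (v ++ (idc y * a0) :: t)) p) w) s.
  rewrite /cyc -(deconcA (fun p w y => e ^+ size w *:
     T (fun t => phi (w ++ idc y * a0 :: t)) p)) -deconcZ.
  apply: eq_deconc => p w; rewrite -!deconcZ; apply: eq_deconc_cat => u v <-.
  have [[y ->] | v1] : (exists y, v = [:: y]) \/ idc v = 0.
    by case: v => [|y [|z v]]; [right | left; exists y | right].
    rewrite size_cat addn1 exprS; lin_using ee ee.
  by rewrite v1 mul0r (@op_mlin0 T phi _ [::]) //; lin.
lin_using ee etaeta.
Qed.

End Operator.
End CyclicSums.

(** * The Connes operator of a trace *)

Section Trace.
Variables (k : comPzRingType) (A : algType k) (tr : A -> k^o).
Hypotheses (tr_lin : linear tr) (trC : forall x y, tr (x * y) = tr (y * x)).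
Local Notation idc := (@idc k A).
Local Notation eps := (@eps k).
Local Notation dif := (@dif k A).
Implicit Types (f g h : seq A -> A).

Let tr0 : tr 0 = 0 := linear_map0 tr_lin.
Let trD : forall x y, tr (x + y) = tr x + tr y := linear_mapD tr_lin.
Let trZ : forall c x, tr (c *: x) = c *: tr x := linear_mapZ tr_lin.

Lemma mlin_tr f : mlin f -> mlin (fun s => tr (f s)).
Proof. by move=> fl s t c a b; rewrite fl tr_lin. Qed.

Lemma deconc_nilr (V : lmodType k) (chi : seq A -> V) s :
  deconc (fun p w => if w is [::] then chi p else 0) s = chi s.
Proof. by elim: s chi => [|a s IH] chi /=; rewrite ?IH; lin. Qed.

Lemma deconc_nill (V : lmodType k) (chi : seq A -> V) s :
  deconc (fun p w => if p is [::] then chi w else 0) s = chi s.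
Proof. by case: s => [|a s] /=; rewrite ?deconc0 addr0. Qed.

(** The first letter of (w, a0, x) is a0 when w is empty. *)
Lemma cup_idl_rotation f w a0 x :
  cup idc f (w ++ a0 :: x) = (if w is [::] then a0 * f x else 0)
    + deconc (fun v w' => idc v * f (w' ++ a0 :: x)) w.
Proof.
rewrite cup_idl (deconc_unaryl (chi := fun z w => z * f (w ++ a0 :: x))).
  by case: w => [|z w] /=; lin.
by move=> *; rewrite mul0r.
Qed.

(** Sums over rotations telescope: pulling the first letter of w out to
    the left and the last letter of p out to the left, after a cyclic
    permutation under the trace, give the same terms with opposite signs,
    except that for w empty the letter pulled out is a0. *)
Lemma winding T e f a0 s : op_linear T -> e * e = 1 ->
  deconc (fun p w => (- e) ^+ size w *: T (fun x => tr (cup idc f (w ++ a0 :: x))) p) s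
  + e *: deconc (fun p w => (- e) ^+ size w *:
           deconc (fun u v => T (fun x => tr (idc v * f (w ++ a0 :: x))) u) p) s
  = T (fun x => tr (a0 * f x)) s.
Proof.
move=> TP ee.
have -> : deconc (fun p w =>
    (- e) ^+ size w *: T (fun x => tr (cup idc f (w ++ a0 :: x))) p) s =
  deconc (fun p w => (if w is [::] then T (fun x => tr (a0 * f x)) p else 0)
     + (- e) ^+ size w *:
       deconc (fun v w' => T (fun x => tr (idc v * f (w' ++ a0 :: x))) p) w) s.
  apply: eq_deconc => p w.
  have -> : (fun x => tr (cup idc f (w ++ a0 :: x))) = (fun x =>
     (if w is [::] then tr (a0 * f x) else 0)
     + deconc (fun v w' => tr (idc v * f (w' ++ a0 :: x))) w).
    apply/funext => x; rewrite cup_idl_rotation trD (deconc_comp tr_lin).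
    by case: w => //; rewrite tr0.
  rewrite (opD TP) (op_deconc TP) scalerDr; congr (_ + _).
  by case: w => [|? ?]; rewrite ?expr0 ?scale1r // (op0 TP) scaler0.
rewrite deconcD deconc_nilr -[RHS]addr0 -addrA; congr (_ + _).
have -> : deconc (fun p w => (- e) ^+ size w *:
       deconc (fun v w' => T (fun x => tr (idc v * f (w' ++ a0 :: x))) p) w) s =
   - e *: deconc (fun q w => deconc (fun p v =>
       (- e) ^+ size w *: T (fun x => tr (idc v * f (w ++ a0 :: x))) p) q) s.
  rewrite -(deconcA (fun p v w =>
       (- e) ^+ size w *: T (fun x => tr (idc v * f (w ++ a0 :: x))) p)) -deconcZ.
  apply: eq_deconc => p w; rewrite -!deconcZ; apply: eq_deconc_cat => u v <-.
  have [[y ->] | v1] : (exists y, u = [:: y]) \/ idc u = 0.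
    by case: u => [|y [|z u]]; [right | left; exists y | right].
    by rewrite size_cat exprD /= expr1; lin.
  rewrite (_ : (fun x => tr (idc u * f (v ++ a0 :: x))) = fun=> 0) ?(op0 TP) ?scaler0 //.
  by apply/funext => x; rewrite v1 mul0r tr0.
have -> : deconc (fun q w => deconc (fun p v =>
       (- e) ^+ size w *: T (fun x => tr (idc v * f (w ++ a0 :: x))) p) q) s =
   deconc (fun p w => (- e) ^+ size w *:
           deconc (fun u v => T (fun x => tr (idc v * f (w ++ a0 :: x))) u) p) s.
  by apply: eq_deconc => q w; rewrite deconcZ.
lin.
Qed.

Lemma cup_idr_rotation f w a0 x :
  cup f idc (w ++ a0 :: x) = f w * idc (a0 :: x)
    + deconc (fun u v => f (w ++ a0 :: u) * idc v) x.
Proof.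
rewrite /cup deconc_cat; congr (_ + _).
rewrite -(deconc_nilr (fun p => f p * idc (a0 :: x))); apply: eq_deconc => u v.
by case: v => [|y [|z v]] //=; rewrite mulr0.
Qed.

Lemma tr_bar b f s : tr (bar f s) =
  eps b *: tr (cup f idc s) + tr (cup idc f s) - tr (dif b f s).
Proof. by rewrite difE !(trD, trZ) -[- bar f s]scaleN1r trZ; lin. Qed.

Lemma bar_tr f s : bar (fun s => tr (f s)) s = tr (bar f s).
Proof. by rewrite /bar (brace_comp tr_lin). Qed.

(** The Connes operator under the identification of cochains with values
    in A and in the dual, see [connesB_Theta]. *)
Definition connes b f : A -> seq A -> k^o :=
  cyc (fun phi => phi) (eps b) (fun s => tr (f s)).

Lemma id_linear (V : lmodType k) : op_linear (fun phi : seq A -> V => phi).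
Proof. by []. Qed.

Lemma mulheadE (V : lmodType k) a (phi : seq A -> V) s : mlin phi ->
  mulhead a phi s = deconc (fun y t => phi (a * idc y :: t)) s.
Proof.
move=> phil; rewrite (deconc_unaryl (chi := fun x t => phi (a * x :: t))) // => w.
by rewrite mulr0 mlin0h.
Qed.

(** B anticommutes with the differential. By [cdif_cyc] for T the
    identity, the differential of B f is a sum of rotations of [bar f],
    that is, of the two outer terms minus [dif b f]. By [winding] the
    outer terms telescope to tr(a0 f(s)) and tr(f(s) a0), which cancel
    because tr is a trace. *)
Lemma cdif_connes b f a0 s : mlin f -> homog b f -> odd (size s) = b ->
  cdif (connes b f) a0 s = - connes (~~ b) (dif b f) a0 s.
Proof.
move=> fl fb sb.
have ee := epsK k b.
have sz : (-1) ^+ size s = - (eps b * 1) :> k.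
  by rewrite -signr_odd sb /eps mulr1; case: (b); rewrite ?expr0 ?expr1 ?opprK.
have phil := mlin_tr fl.
have Tbar (phi : seq A -> k^o) t : mlin phi -> bar phi t = 1 *: bar phi t.
  by rewrite scale1r.
rewrite /connes (cdif_cyc (@id_linear _) ee (mulr1 1) Tbar a0 phil sz).
rewrite !scale1r.
have -> : deconc (fun y => [eta cyc (fun phi => phi) (eps b)
       (fun s0 => tr (f s0)) (a0 * idc y)]) s =
   deconc (fun p w => eps b ^+ size w *:
      mulhead a0 (fun t => tr (f (w ++ t))) p) s.
  rewrite /cyc deconcA; apply: eq_deconc => p w.
  by rewrite deconcZ mulheadE //; apply: (mlin_catl w phil).
rewrite addrC addrA addrK.
transitivity (tr (a0 * f s) + eps b *: ((- eps b) ^+ size s *: tr (f s * a0))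
    - connes (~~ b) (dif b f) a0 s).
  rewrite -(winding f a0 s (@id_linear _) ee) /connes /cyc epsN.
  rewrite -(deconc_nill (fun w => (- eps b) ^+ size w *: tr (f w * a0))).
  rewrite -[- deconc _ _]scaleN1r -!deconcZ -!deconcD; apply: eq_deconc => p w.
  have E : tr (cup f idc (w ++ a0 :: p)) =
     (if p is [::] then tr (f w * a0) else 0)
     + deconc (fun u v => tr (idc v * f (w ++ a0 :: u))) p.
    rewrite cup_idr_rotation trD (deconc_comp tr_lin); congr (_ + _).
      by case: p => //= *; rewrite mulr0 tr0.
    by apply: eq_deconc => u v; rewrite trC.
  by rewrite bar_tr (tr_bar b) E; case: p {E} => [|y p]; lin.
rewrite trC -/(connes (~~ b) (dif b f)).
have -> : (- eps b) ^+ size s = - eps b.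
  rewrite (expr_odd _ (_ : - eps b * - eps b = 1)) ?mulrNN // sb.
  by rewrite /eps; case: (b); rewrite /= ?expr1 ?expr0 ?opprK.
lin_using ee ee.
Qed.

Section Homotopy.
Variables (bf bg : bool) (f g : seq A -> A).
Hypotheses (fl : mlin f) (gl : mlin g) (fb : homog bf f) (gb : homog bg g).
Hypotheses (df : forall s, dif bf f s = 0) (dg : forall s, dif bg g s = 0).
Local Notation ef := (eps bf).
Local Notation eg := (eps bg).

(** The terms of the Connes operator on f u g in which a0 is an argument
    of f: the arguments of g are the word x between the arguments y and w
    of f. *)
Definition wound a0 s : k^o :=
  deconc (fun p w => (- ef) ^+ size w *:
    deconc (fun y x => eg ^+ size y *: tr (g x * f (w ++ a0 :: y))) p) s.

(** [cdif_cyc] for T the insertion of g, which commutes with [bar] up to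
    sign because g is a cocycle. As f is a cocycle, [bar f] is a sum of
    two outer products. The telescoping of [winding] leaves tr(a0
    f{g}(s)); the products of a0 with the value of g give g u Delta f; and
    in f(-) times the last letter the last letter may be the value of g,
    which gives [wound]. *)
Lemma cdif_homotopy a0 s : odd (size s) = bf (+) ~~ bg ->
  cdif (cyc (brace eg g) ef (fun s => tr (f s))) a0 s =
  eg *: tr (a0 * brace eg g f s)
  - eg *: deconc (fun x z => connes bf f (a0 * g x) z) s
  + (eg * ef) *: wound a0 s.
Proof.
move=> sb.
have ee := epsK k bf; have ee' := epsK k bg.
have sz : (-1) ^+ size s = - (ef * eg) :> k.
  by rewrite -signr_odd sb /eps; case: (bf); case: (bg); rewrite /= ?expr0 ?expr1; ring.
have phil := mlin_tr fl.
have dg0 : dif bg g = fun=> 0 by apply/funext.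
have Tbar (phi : seq A -> k^o) t : mlin phi ->
    bar (brace eg g phi) t = eg *: brace eg g (bar phi) t.
  by move=> l; rewrite bar_brace // dg0 brace_fun0 //; lin.
rewrite (cdif_cyc (@brace_linear _ _ _ _ _) ee ee' Tbar a0 phil sz).
have -> : deconc (fun y => [eta cyc (brace eg g) ef
       (fun s0 => tr (f s0)) (a0 * idc y)]) s =
   deconc (fun p w => ef ^+ size w *: deconc (fun y p' =>
      brace eg g (fun t => tr (f (w ++ (a0 * idc y) :: t))) p') p) s.
  rewrite /cyc deconcA; apply: eq_deconc => p w.
  by rewrite deconcZ.
have -> : deconc (fun p w =>
     ef ^+ size w *: brace eg g (mulhead a0 (fun t => tr (f (w ++ t)))) p) s =
   deconc (fun x z => connes bf f (a0 * g x) z) s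
   + eg *: deconc (fun p w => ef ^+ size w *: deconc (fun y p' =>
      brace eg g (fun t => tr (f (w ++ (a0 * idc y) :: t))) p') p) s.
  rewrite /connes /cyc deconcA -deconcZ -deconcD; apply: eq_deconc => p w.
  rewrite brace_mulhead head_insE deconcZ.
  rewrite (deconc_unaryl (chi := fun z p' => brace eg g
       (fun t => tr (f (w ++ (a0 * z) :: t))) p')).
    by case: p => [|z p] /=; lin.
  move=> v; rewrite (_ : (fun t => _) = fun=> 0) ?(op0 (@brace_linear _ _ _ _ _)) //.
  by apply/funext => t; rewrite mulr0 (mlin0 w) // tr0.
have trcup p w : brace eg g (fun x => tr (cup f idc (w ++ a0 :: x))) p =
   deconc (fun u v => brace eg g (fun x => tr (idc v * f (w ++ a0 :: x))) u) p
   + deconc (fun y x => eg ^+ size y *: tr (g x * f (w ++ a0 :: y))) p.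
  have -> : (fun x => tr (cup f idc (w ++ a0 :: x))) =
     (fun x => (if x is [::] then tr (f w * a0) else 0)
     + deconc (fun u v => tr (idc v * f (w ++ a0 :: u))) x).
    apply/funext => x; rewrite cup_idr_rotation trD (deconc_comp tr_lin); congr (_ + _).
      by case: x => //= *; rewrite mulr0 tr0.
    by apply: eq_deconc => u v; rewrite trC.
  rewrite (opD (@brace_linear _ _ _ _ _)) brace_nilsupp // add0r.
  rewrite brace_deconc deconcD; congr (_ + _); apply: eq_deconc => y x.
  rewrite -(brace_comp (l := fun z => tr (z * f (w ++ a0 :: y)))) ?brace_idc //.
  by move=> c u v; rewrite mulrDl -scalerAl tr_lin.
have -> : deconc (fun p w => (- ef) ^+ size w *:
       brace eg g (fun t => bar (fun s0 => tr (f s0)) (w ++ a0 :: t)) p) s =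
   tr (a0 * brace eg g f s) + ef *: wound a0 s.
  rewrite (@brace_comp _ _ _ _ (fun z => tr (a0 * z))); last first.
    by move=> c u v; rewrite mulrDr -scalerAr tr_lin.
  rewrite -(winding f a0 s (@brace_linear _ _ _ eg g) ee) /wound.
  rewrite -!deconcZ -!deconcD; apply: eq_deconc => p w.
  have -> : (fun t => bar (fun s0 => tr (f s0)) (w ++ a0 :: t)) =
      (fun t => ef *: tr (cup f idc (w ++ a0 :: t)) + tr (cup idc f (w ++ a0 :: t))).
    by apply/funext => t; rewrite bar_tr (tr_bar bf) df tr0 subr0.
  by rewrite braceP trcup; lin.
lin_using ee ee'.
Qed.

End Homotopy.
End Trace.

Section ConnesCup.
Variables (k : comPzRingType) (A : algType k) (tr : A -> k^o).
Hypotheses (tr_lin : linear tr) (trC : forall x y, tr (x * y) = tr (y * x)).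
Local Notation eps := (@eps k).
Variables (bf bg : bool) (f g : seq A -> A).
Hypotheses (fb : homog bf f) (gb : homog bg g).
Local Notation ef := (eps bf).
Local Notation eg := (eps bg).

Let tr0 : tr 0 = 0 := linear_map0 tr_lin.

(** Cutting a rotation of (a0, s) between the arguments of f and those of
    g puts a0 on one of the two sides. The trace moves the factor that
    does not contain a0 to the front. *)
Lemma connes_cup a0 s :
  connes tr (bf (+) bg) (cup f g) a0 s =
  (-1) ^+ (~~ bf && ~~ bg) *: wound tr bf bg f g a0 s
  + (-1) ^+ ((bf && bg) (+) (~~ bf && ~~ bg)) *: wound tr bg bf g f a0 s.
Proof.
have ee := epsK k bf; have ee' := epsK k bg.
have eK : - (ef * eg) * - (ef * eg) = 1 by rewrite mulrNN mulrACA ee ee' mulr1.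
have mK e : e * e = 1 :> k -> - e * - e = 1 by rewrite mulrNN.
rewrite /connes /cyc eps_cup.
transitivity (deconc (fun p w =>
   (- (ef * eg)) ^+ size w *: deconc (fun y x => tr (g x * f (w ++ a0 :: y))) p
   + deconc (fun x y => (- (ef * eg)) ^+ (size x + size y) *: tr (f x * g (y ++ a0 :: p))) w) s).
  apply: eq_deconc => p w.
  rewrite /cup deconc_cat -[X in tr (X + _)]scale1r tr_lin scale1r scalerDr addrC.
  congr (_ *: _ + _); rewrite (deconc_comp tr_lin).
    by apply: eq_deconc => u v; rewrite trC.
  by rewrite -deconcZ; apply: eq_deconc_cat => u v <-; rewrite size_cat.
rewrite deconcD; congr (_ + _).
  rewrite /wound -deconcZ; apply: eq_deconc => p w; rewrite -!deconcZ.
  apply: eq_deconc => y x.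
  (* On the support of f and g the parities of |w| and |y| determine each
     other. *)
  rewrite (expr_odd (size w) eK) (expr_odd (size w) (mK _ ee)) (expr_odd (size y) ee').
  have [par|par] := eqVneq (odd (size (w ++ a0 :: y))) bf; last first.
    by rewrite fb // mulr0 tr0; lin.
  move: par; rewrite size_cat oddD /= => par.
  have -> : odd (size y) = ~~ (bf (+) odd (size w)).
    by rewrite -par; case: (odd _); case: (odd _).
  by case: (bf); case: (bg); case: (odd (size w));
    rewrite /eps /= ?expr0 ?expr1; lin.
rewrite deconcA /wound -deconcZ; apply: eq_deconc => q y; rewrite -!deconcZ.
apply: eq_deconc => p x.
rewrite (expr_odd (_ + _) eK) (expr_odd (size y) (mK _ ee')) (expr_odd (size p) ee) oddD.
have [->|par] := eqVneq (odd (size x)) bf; last by rewrite fb // mul0r tr0; lin.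
have [par|par] := eqVneq (odd (size (y ++ a0 :: p))) bg; last first.
  by rewrite gb // mulr0 tr0; lin.
move: par; rewrite size_cat oddD /= => par.
have -> : odd (size p) = ~~ (bg (+) odd (size y)).
  by rewrite -par; case: (odd _); case: (odd _).
by case: (bf); case: (bg); case: (odd (size y));
  rewrite /eps /= ?expr0 ?expr1; lin.
Qed.

End ConnesCup.

(** * Cochains of a given degree *)

Lemma odd_absD (i j : int) : odd `|(i + j)%R|%N = odd `|i|%N (+) odd `|j|%N.
Proof. lia. Qed.

Lemma odd_abs_pred (i : int) : odd `|(i - 1)%R|%N = ~~ odd `|i|%N.
Proof. lia. Qed.

Lemma sgnE (k : comPzRingType) (i : int) : sgn i = (-1) ^+ odd `|i|%N :> k.
Proof. by rewrite /sgn signr_odd. Qed.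

Lemma sgnM (k : comPzRingType) (i j : int) :
  sgn (i * j) = (-1) ^+ (odd `|i|%N && odd `|j|%N) :> k.
Proof. by rewrite sgnE abszM oddM. Qed.

Section Supports.
Variables (k : comPzRingType) (A : algType k).

(** The support condition of [is_cochain], for functions with values in an
    arbitrary module. *)
Definition supp (V : lmodType k) (i : int) (phi : seq A -> V) : Prop :=
  forall s, (size s)%:Z != i -> phi s = 0.

Lemma supp_homog (V : lmodType k) i (phi : seq A -> V) :
  supp i phi -> homog (odd `|i|%N) phi.
Proof.
move=> phis s so; apply: phis; apply: contra so => /eqP <-; first by rewrite absz_nat.
Qed.

Lemma supp_cons (V : lmodType k) i (phi : seq A -> V) a :
  supp i phi -> supp (i - 1) (fun t => phi (a :: t)).
Proof. by move=> phis s si; apply: phis => /=; apply: contra si => /eqP <-; lia. Qed.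

Lemma deconc_supp (V : lmodType k) (psi : seq A -> seq A -> V) s :
  (forall u v, u ++ v = s -> psi u v = 0) -> deconc psi s = 0.
Proof. by move=> E; rewrite (eq_deconc_cat (psi' := fun _ _ => 0)) ?deconc0. Qed.

Lemma supp_cup i j (f g : seq A -> A) : supp i f -> supp j g -> supp (i + j) (cup f g).
Proof.
move=> fs gs s si; apply: deconc_supp => u v E.
have [ui|/eqP ui] := eqVneq (size u)%:Z i; last by rewrite fs ?mul0r //; apply/eqP.
by rewrite gs ?mulr0 //; move: si; rewrite -E size_cat; lia.
Qed.

Lemma supp_head_ins (V : lmodType k) i j g (phi : seq A -> V) :
  mlin phi -> supp i phi -> supp j g -> supp (i + j - 1) (head_ins g phi).
Proof.
move=> phil phis gs s si; rewrite head_insE; apply: deconc_supp => u v E.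
have [ui|ui] := eqVneq (size u)%:Z j; last by rewrite gs // mlin0h.
by apply: phis => /=; move: si; rewrite -E size_cat; lia.
Qed.

Lemma supp_brace (V : lmodType k) i j e g (phi : seq A -> V) :
  mlin phi -> supp i phi -> supp j g -> supp (i + j - 1) (brace e g phi).
Proof.
move=> phil phis gs s; elim: s i phi phil phis => [|a s IH] i phi phil phis si.
  by rewrite braceE /= addr0 (supp_head_ins phil phis gs).
rewrite brace_cons (supp_head_ins phil phis gs) // add0r.
rewrite (IH _ _ (mlin_cons a phil) (supp_cons a phis)) ?scaler0 //.
by move: si => /=; lia.
Qed.

Lemma supp_brace2 (V : lmodType k) i j l e eh g h (phi : seq A -> V) :
  mlin phi -> supp i phi -> supp j g -> supp l h ->
  supp (i + j + l - 2) (brace2 e eh g h phi).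
Proof.
have supp_head2 i' (phi' : seq A -> V) : mlin phi' -> supp i' phi' -> supp j g -> supp l h ->
    supp (i' + j + l - 2) (head_ins2 eh g h phi').
  move=> phil phis gs hs s si; rewrite head_ins2E; apply: deconc_supp => u v E.
  have [ui|ui] := eqVneq (size u)%:Z j; last by rewrite gs // brace_cst0.
  rewrite (supp_brace eh (mlin_cons (g u) phil) (supp_cons (g u) phis) hs) //.
  by move: si; rewrite -E size_cat; lia.
move=> phil phis gs hs s; elim: s i phi phil phis => [|a s IH] i phi phil phis si.
  by rewrite brace2E /= addr0 (supp_head2 _ _ phil phis gs hs).
rewrite brace2_cons (supp_head2 _ _ phil phis gs hs) // add0r.
rewrite (IH _ _ (mlin_cons a phil) (supp_cons a phis)) ?scaler0 //.
by move: si => /=; lia.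
Qed.

(** A first factor of degree m selects one cut. *)
Lemma deconc_take (V : lmodType k) (psi : seq A -> seq A -> V) m s :
  (forall u v, size u != m -> psi u v = 0) ->
  deconc psi s = psi (take m s) (drop m s).
Proof.
elim: s psi m => [|a s IH] psi m psi0 /=; first by rewrite addr0.
case: m psi0 => [|m] psi0.
  by rewrite deconc_supp ?addr0 // => u v _; apply: psi0.
by rewrite psi0 // add0r (IH _ m) // => u v um; apply: psi0.
Qed.

Lemma cup_cochainE i (f g : seq A -> A) : supp i f -> cup_cochain i f g = cup f g.
Proof.
move=> fs; apply/funext => s; rewrite /cup_cochain /cup.
rewrite (deconc_take (m := `|i|%N)) // => u v ui.
by rewrite fs ?mul0r //; lia.
Qed.

(** Turns the recursive sum over cuts into the sum over the argument
    number. Argument numbers past the degree of phi and past the end of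
    the word contribute zero, so that both index ranges extend to their
    maximum. *)
Lemma braceE_sum (V : lmodType k) i j e (phi : seq A -> V) g s :
  mlin phi -> supp i phi -> supp j g ->
  brace e g phi s = \sum_(p < `|i|%N) e ^+ p *:
    phi (take p s ++ g (take `|j|%N (drop p s)) :: drop (p + `|j|%N) s).
Proof.
move=> phil phis gs.
pose F p : V := e ^+ p *: phi (take p s ++ g (take `|j|%N (drop p s)) :: drop (p + `|j|%N) s).
have -> : brace e g phi s = \sum_(p < (size s).+1) F p.
  rewrite {}/F; elim: s phi {phis} phil => [|a s IH] phi phil.
    by rewrite brace_nil big_ord1 expr0 scale1r.
  rewrite brace_cons (IH _ (mlin_cons a phil)) [RHS]big_ord_recl scaler_sumr.
  congr (_ + _).
    rewrite expr0 scale1r head_insE take0 drop0 add0n.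
    rewrite (deconc_take (m := `|j|%N)) // => u v uj.
    by rewrite gs ?mlin0h //; lia.
  by apply: eq_bigr => p _; rewrite exprS scalerA.
have F0 p : ((p <= size s) && (`|i| <= p) || (size s < p) && (p < `|i|))%N -> F p = 0.
  rewrite /F => H.
  have [gj|gj] := eqVneq (size (take `|j|%N (drop p s)))%:Z j; last first.
    by rewrite gs // mlin0 // scaler0.
  rewrite phis ?scaler0 //; rewrite size_cat /= size_drop.
  by move: gj H; rewrite !size_take_min size_drop; lia.
pose N := maxn (size s).+1 `|i|%N.
rewrite (big_ord_widen N F); last by rewrite leq_maxl.
rewrite [RHS](big_ord_widen N F); last by rewrite leq_maxr.
rewrite big_mkcond [RHS]big_mkcond /=; apply: eq_bigr => p _; rewrite ltnS.
have [ps|ps] := leqP p (size s); have [pi|pi] := ltnP p `|i|%N => //.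
  by apply: F0; rewrite ps pi.
by rewrite F0 // ps pi orbT.
Qed.

Lemma circ_cochainE i j (f g : seq A -> A) : mlin f -> supp i f -> supp j g ->
  circ_cochain i j f g = fun s =>
    (-1) ^+ (~~ odd `|i|%N && ~~ odd `|j|%N) *: brace (eps k (odd `|j|%N)) g f s.
Proof.
move=> fl fs gs; apply/funext => s; rewrite /circ_cochain fctE.
rewrite sgnM !odd_abs_pred; congr (_ *: _).
rewrite (braceE_sum _ _ fl fs gs) fct_sumE; apply: eq_bigr => p _.
rewrite fctE; congr (_ *: _).
by rewrite sgnM odd_abs_pred absz_nat /eps; case: (odd _) => /=;
   rewrite ?andbF ?expr0 ?expr1n //= expr1 signr_odd.
Qed.

Lemma bracket_cochainE i j (f g : seq A -> A) :
  mlin f -> mlin g -> supp i f -> supp j g ->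
  bracket_cochain i j f g = brk (odd `|i|%N) (odd `|j|%N) f g.
Proof.
move=> fl gl fs gs; apply/funext => s; rewrite /bracket_cochain !fctE.
rewrite !circ_cochainE // sgnM !odd_abs_pred /brk.
by case: (odd _) (odd _) => [] [] /=; rewrite ?expr0 ?expr1; lin.
Qed.

End Supports.

(** * The Hochschild complexes of A and of its dual *)

Section HochschildDifferential.
Variables (k : comPzRingType) (A : algType k).

Section Coefficients.
Variable M : bimodule A.
Implicit Types f : seq A -> M.

Lemma bar_contract f a s : mlin f ->
  bar f (a :: s) = \sum_(i < size s) (-1) ^+ i *: f (contract i (a :: s)).
Proof.
elim: s f a => [|b s IH] f a fl.
  by rewrite bar_cons // bar_nil ?big_ord0 ?subr0 //; apply: mlin_cons.
rewrite bar_cons // (IH _ b (mlin_cons a fl)) big_ord_recl /= expr0 scale1r.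
rewrite /contract /= drop0 -sumrN; congr (_ + _); apply: eq_bigr => i _.
by rewrite exprS -scalerA scaleN1r.
Qed.

Lemma hoch_dE f a s : mlin f ->
  hoch_d f (a :: s) = lact M a (f s) - bar f (a :: s)
    + (-1) ^+ (size s).+1 *: ract M (f (belast a s)) (last a s).
Proof.
move=> fl; rewrite bar_contract // /hoch_d -sumrN; congr (_ + _ + _).
by apply: eq_bigr => i _; rewrite exprS -scalerA scaleN1r.
Qed.

Lemma lact0 a : lact M a 0 = 0.
Proof. by have := lact_linearr a (-1) (0 : M) 0; rewrite scaler0 addr0 => ->; lin. Qed.

Lemma ract0 a : ract M 0 a = 0.
Proof. by have := ract_linearl a (-1) (0 : M) 0; rewrite scaler0 addr0 => ->; lin. Qed.

Lemma supp_hoch_d i f : mlin f -> supp i f -> supp (i + 1) (hoch_d f).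
Proof.
move=> fl fs [|a s] si //; rewrite hoch_dE //.
have -> : bar f (a :: s) = 0.
  apply: (supp_brace (-1) fl fs (j := 2)); last by move: si => /=; lia.
  by case=> [|x [|y [|z t]]] // _; rewrite mul2E ?mulr0.
rewrite !fs ?size_belast ?lact0 ?ract0; first by lin.
- by move: si => /=; lia.
- by move: si => /=; lia.
Qed.

End Coefficients.

Lemma hoch_d_regular b (f : seq A -> regular_bimod A) :
  mlin f -> homog b f -> hoch_d f = dif b f.
Proof.
move=> fl fb; apply/funext => -[|a s].
  by rewrite difE bar_nil // cup_idr0 cup_idl /=; lin.
rewrite hoch_dE // difE cup_idl lastI cup_idr /=.
have [sb|sb] := eqVneq (odd (size s)) b; last first.
  by rewrite (fb (belast a s)) ?size_belast // mul0r; lin.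
rewrite -signr_odd /= sb /eps; lin.
Qed.

Lemma dual_combE c (x y : dual A) a :
  (c *: x + y : dual A) a = c *: (x a : k^o) + (y a : k^o).
Proof. by []. Qed.

Lemma dual_eval_linear (a : A) : linear (fun x : dual A => x a).
Proof. by []. Qed.

Lemma hoch_d_dual (f : seq A -> dual_bimod A) s (a0 : A) : mlin f ->
  (hoch_d f s : dual A) a0 = cdif (fun a u => (f u : dual A) a) a0 s.
Proof.
move=> fl; have f0 u : (f u : dual A) 0 = 0.
  exact: linear_map0 (dual_linear (f u)).
case: s => [|a s].
  rewrite /cdif /= bar_nil; last by move=> s t c a b; rewrite fl.
  by rewrite mulr0 mul0r !f0; transitivity (0 : k^o) => //; lin.
rewrite hoch_dE // /cdif.
rewrite (deconc_unaryl (chi := fun z u => (f u : dual A) (a0 * z))); last first.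
  by move=> w; rewrite mulr0 f0.
rewrite [in deconc _ (a :: s)]lastI.
rewrite (deconc_unaryr (chi := fun z u => (f u : dual A) (z * a0))); last first.
  by move=> w; rewrite mul0r f0.
by rewrite /bar -(brace_comp (dual_eval_linear a0)).
Qed.

End HochschildDifferential.

Section Symmetric.
Variables (k : comPzRingType) (A : algType k).
Local Notation AA := (regular_bimod A).
Local Notation D := (dual_bimod A).
Variables (Theta : AA -> D) (Psi : D -> AA).
Hypotheses (Tl : linear Theta) (TL : forall a x, Theta (lact AA a x) = lact D a (Theta x))
  (TR : forall x a, Theta (ract AA x a) = ract D (Theta x) a)
  (TK : cancel Theta Psi) (PK : cancel Psi Theta).

Lemma Psi_linear : linear Psi.
Proof. by move=> c x y; rewrite -{1}(PK x) -{1}(PK y) -Tl TK. Qed.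

Lemma Psi_lact a x : Psi (lact D a x) = lact AA a (Psi x).
Proof. by rewrite -{1}(PK x) -TL TK. Qed.

Lemma Psi_ract x a : Psi (ract D x a) = ract AA (Psi x) a.
Proof. by rewrite -{1}(PK x) -TR TK. Qed.

Definition tr (x : A) : k^o := (Theta 1 : dual A) x.

Lemma tr_linear : linear tr.
Proof. exact: dual_linear. Qed.

(** Theta is determined by the functional Theta(1), because it is left
    linear. *)
Lemma Theta_tr (x y : A) : (Theta x : dual A) y = tr (y * x).
Proof. by have := TL x (1 : A); rewrite /= mulr1 => ->. Qed.

(** Left linearity of Theta gives Theta(y)(x) = tr(x y), and right
    linearity gives tr(y x). *)
Lemma trC x y : tr (x * y) = tr (y * x).
Proof.
rewrite -Theta_tr; have := TR (1 : A) y; rewrite /= mul1r => -> //.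
Qed.

End Symmetric.

Section BimoduleMap.
Variables (k : comPzRingType) (A : algType k) (M N : bimodule A) (phi : M -> N).
Hypotheses (pl : linear phi) (pL : forall a x, phi (lact M a x) = lact N a (phi x))
  (pR : forall x a, phi (ract M x a) = ract N (phi x) a).

Lemma mlin_comp (f : seq A -> M) : mlin f -> mlin (phi \o f).
Proof. by move=> fl s t c a b; rewrite /= fl pl. Qed.

Lemma hoch_d_comp (f : seq A -> M) : mlin f -> hoch_d (phi \o f) = phi \o hoch_d f.
Proof.
have p0 : phi 0 = 0 := linear_map0 pl.
have pD : forall x y, phi (x + y) = phi x + phi y := linear_mapD pl.
have pZ : forall c x, phi (c *: x) = c *: phi x := linear_mapZ pl.
move=> fl; apply/funext => -[|a s] /=; first by rewrite p0.
rewrite !pD pL pZ pR; congr (_ + _ + _).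
by rewrite (big_morph phi pD p0); apply: eq_bigr => i _; rewrite pZ.
Qed.

Lemma supp_comp i (f : seq A -> M) : supp i f -> supp i (phi \o f).
Proof.
have p0 : phi 0 = 0 := linear_map0 pl.
by move=> fs s si; rewrite /= fs.
Qed.

End BimoduleMap.

(** * The Connes operator on cochains with values in the dual *)

Section ConnesOperator.
Variables (k : comPzRingType) (A : algType k).
Local Notation D := (dual_bimod A).
Implicit Types f : seq A -> D.

Lemma deconc_sum (V : lmodType k) (psi : seq A -> seq A -> V) s :
  deconc psi s = \sum_(i < (size s).+1) psi (take i s) (drop i s).
Proof.
elim: s psi => [|a s IH] psi /=; first by rewrite big_ord1 addr0.
by rewrite IH [RHS]big_ord_recl.
Qed.

Lemma iter_rotr_cat (T : Type) (p w : seq T) : iter (size w) (rotr 1) (p ++ w) = w ++ p.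
Proof.
elim/last_ind: w p => [|w z IH] p; first by rewrite cats0.
by rewrite size_rcons iterSr -rcons_cat rotr1_rcons -cat_cons IH cat_rcons.
Qed.

(** The i-th power of the rotation moves the last i letters of (a0, s) to
    the front, and these form the second part of a cut of s; the index is
    therefore reversed. *)
Lemma connesB_deconc f s (a0 : A) : mlin f ->
  (connesB f s : dual A) a0 = deconc (fun p w =>
     (-1) ^+ (size w * size s) *: (f (w ++ a0 :: p) : dual A) 1) s.
Proof.
move=> fl; rewrite connesBE // deconc_sum (reindex_inj rev_ord_inj) /=.
apply: eq_bigr => -[i /= si] _; rewrite size_drop subSS; congr (_ *: _).
rewrite iter_tauE /sigma /= -[X in _ = (f X : dual A) 1]iter_rotr_cat.
by rewrite size_drop cat_cons cat_take_drop.
Qed.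

Lemma mlin_connesB f : mlin f -> mlin (connesB f).
Proof.
move=> fl s t c a b; apply: dualP => a0.
transitivity (c *: (connesB f (s ++ a :: t) : dual A) a0
              + (connesB f (s ++ b :: t) : dual A) a0 : k^o); last by [].
rewrite !connesB_deconc // !size_cat /=; move: (size s + _)%N => N.
pose psi (u v : seq A) : k^o := (-1) ^+ (size v * N) *: (f (v ++ a0 :: u) : dual A) 1.
apply: (@mlin_deconc _ _ _ psi) => [v|u] s' t' c' a' b'; rewrite /psi.
  by rewrite -cat_cons catA fl dual_combE -!catA /=; lin.
by rewrite -catA cat_cons fl dual_combE !size_cat /= -!catA /=; lin.
Qed.

Lemma supp_connesB i f : mlin f -> supp i f -> supp (i - 1) (connesB f).
Proof.
move=> fl fs s si; apply: dualP => a0; rewrite connesB_deconc //.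
apply: deconc_supp => u v E; rewrite fs ?scaler0 //.
by move: si; rewrite -E !size_cat /=; lia.
Qed.

Lemma normalized_connesB f : mlin f -> normalized f -> normalized (connesB f).
Proof.
move=> fl fn s s1; apply: dualP => a0; rewrite connesB_deconc //.
apply: deconc_supp => u v E; rewrite fn ?scaler0 //.
by move: s1; rewrite -E !mem_cat inE => /orP[->|->]; rewrite ?orbT.
Qed.

(** BB f is a sum of values of f on words that contain the 1 of the inner
    operator as an argument. *)
Lemma connesB_connesB f : mlin f -> normalized f -> connesB (connesB f) = 0.
Proof.
move=> fl fn; apply/funext => s; apply: dualP => a0.
rewrite connesB_deconc; last exact: mlin_connesB.
apply: deconc_supp => u v E; rewrite connesB_deconc // deconc_supp ?scaler0 //.
by move=> u' v' E'; rewrite fn ?scaler0 // mem_cat inE eqxx orbT.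
Qed.

End ConnesOperator.

(** * Square of the differential *)

Section Square.
Variables (k : comPzRingType) (A : algType k).
Local Notation AA := (regular_bimod A).

Lemma mlin_dif b (g : seq A -> A) : mlin g -> mlin (dif b g).
Proof.
move=> gl; have -> : dif b g = (fun s => -1 *: bar g s
   + (eps k b *: brace (eps k b) g (@mul2 k A) s + 0)).
  by apply/funext => s; rewrite /dif addr0 scaleN1r addrC.
apply: mlin_comb; first exact: mlin_bar.
apply: mlin_comb; first by apply: mlin_brace => //; apply: mlin_mul2.
by move=> s t c x y; lin.
Qed.

Lemma dif_dif b (g : seq A -> A) s : mlin g -> homog b g -> dif (~~ b) (dif b g) s = 0.
Proof.
move=> gl gb; rewrite {1}/dif epsN.
have m2 := @mlin_mul2 k A.
have := bar_brace s m2 gb.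
have -> : bar (@mul2 k A) = fun=> 0 by apply/funext => t; apply: bar_mul2.
rewrite (op0 (@brace_linear _ _ _ _ _)).
have -> : bar (dif b g) s = eps k b *: bar (brace (eps k b) g (@mul2 k A)) s.
  have -> : dif b g = fun s => -1 *: bar g s + eps k b *: brace (eps k b) g (@mul2 k A) s.
    by apply/funext => t; rewrite /dif scaleN1r addrC.
  by rewrite bar_linear (opZ (@bar_linear _ _ _)) bar_bar //; lin.
by move=> ->; lin.
Qed.

Lemma mlin_hoch_d i (f : seq A -> AA) : mlin f -> supp i f -> mlin (hoch_d f).
Proof. by move=> fl fs; rewrite (hoch_d_regular fl (supp_homog fs)); apply: mlin_dif. Qed.

Lemma hoch_d_hoch_d i (f : seq A -> AA) : mlin f -> supp i f -> hoch_d (hoch_d f) = 0.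
Proof.
move=> fl fs; have fb := supp_homog fs.
have df := supp_homog (supp_hoch_d fl fs).
rewrite (hoch_d_regular (mlin_hoch_d fl fs) df) (hoch_d_regular fl fb).
by apply/funext => s; rewrite odd_absD addbT dif_dif.
Qed.

End Square.

(** * Normalized cochains *)

Section Normalization.
Variables (k : comPzRingType) (A : algType k) (M : bimodule A).
Implicit Types f : seq A -> M.

Definition norm_upto n f : Prop := forall u w, (size u < n)%N -> f (u ++ 1 :: w) = 0.

(** The degeneracy that inserts 1 at the place i. It serves as a
    contracting homotopy in [norm_step]. *)
Definition degen i f : seq A -> M := fun s => f (take i s ++ 1 :: drop i s).

Lemma size_contract i (s : seq A) : (i.+1 < size s)%N -> size (contract i s) = (size s).-1.
Proof. by move=> si; rewrite /contract size_cat /= size_take_min size_drop; lia. Qed.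

Lemma bar_vanish f u : mlin f -> (forall v, (size v < size u)%N -> f v = 0) -> bar f u = 0.
Proof.
case: u => [|a u] fl fu; first exact: bar_nil.
rewrite bar_contract // big1 // => -[i iu] _; rewrite fu ?scaler0 //.
by rewrite size_contract //= ltnS.
Qed.

(** The products of 1 with its two neighbours, or with the value of f at
    an end of the word, occur with opposite signs and cancel; the terms
    with fewer letters to the left of 1 vanish by assumption. What remains
    is a differential on the letters to the right of 1. *)
Lemma hoch_d_one f u w : mlin f ->
  (forall v, (size v < size u)%N -> f (v ++ 1 :: w) = 0) ->
  hoch_d f (u ++ 1 :: w) = if w is z :: w' then
      (-1) ^+ size u *: (bar (fun t => f (u ++ 1 :: t)) w
         - (-1) ^+ size w *: ract M (f (u ++ 1 :: belast z w')) (last z w'))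
    else 0.
Proof.
move=> fl fu.
have barE : bar f (u ++ 1 :: w) =
    (if u is [::] then 0 else - (-1) ^+ size u *: f (u ++ w))
    + (-1) ^+ size u *: ((if w is [::] then 0 else f (u ++ w))
                         - bar (fun t => f (u ++ 1 :: t)) w).
  rewrite bar_cat // bar_cons; last exact: mlin_catl.
  rewrite bar_rcons; last exact: mlin_catr.
  rewrite bar_vanish ?sub0r; last first.
  - by move=> v vu; rewrite cat_rcons fu.
  - exact: (mlin_rcons 1 (mlin_catr w fl)).
  congr (_ + _ *: (_ - _)); last by case: (w) => // z w'; rewrite /mulhead mul1r.
  case/lastP: (u) => [|u' y]; first by rewrite /= mul0r mlin0h // addr0 scaler0 oppr0.
  rewrite (deconc_unaryr (chi := fun z v => f (rcons v (z * 1) ++ w))).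
    by rewrite mulr1 -scaleNr; case: u'.
  by move=> v; rewrite mul0r cat_rcons mlin0.
case: u fu barE => [|a u] fu barE.
  rewrite [[::] ++ _]cat0s hoch_dE // lact1 -[bar f _]/(bar f ([::] ++ 1 :: w)) barE.
  case: w {fu barE} => [|z w] /=.
    rewrite bar_nil ?ract1; [lin | exact: mlin_cons].
  by rewrite expr0 !exprS; lin.
rewrite cat_cons hoch_dE // -cat_cons barE fu // lact0.
rewrite size_cat /=.
case: w {fu barE} => [|z w] /=.
  rewrite bar_nil; last exact: (mlin_cons 1 (mlin_catl (a :: u) fl)).
  rewrite cats1 last_rcons belast_rcons ract1 cats0 addn1 !exprS; lin.
rewrite last_cat /= (_ : belast a (u ++ [:: 1, z & w]) = a :: u ++ 1 :: belast z w).
  by rewrite !exprS exprD !exprS; lin.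
by elim: (u) (a) => [|y u' IH] x //=; rewrite IH.
Qed.

Lemma mlin_degen i f : mlin f -> mlin (degen i f).
Proof.
move=> fl s t c a b; rewrite /degen !take_cat !drop_cat.
case: ltnP => si; first by rewrite -!cat_cons !catA fl.
case: (i - size s)%N => [|n] /=; first by rewrite !cats0 -!(cat_rcons 1) fl.
by rewrite -!catA /= fl.
Qed.

Lemma supp_degen i j f : supp j f -> supp (j - 1) (degen i f).
Proof.
move=> fs s sj; apply: fs; move: sj.
by rewrite size_cat /= addnS -size_cat cat_take_drop; lia.
Qed.

Lemma degen_cat i f u v : size u = i -> degen i f (u ++ v) = f (u ++ 1 :: v).
Proof. by move=> <-; rewrite /degen take_size_cat ?drop_size_cat. Qed.

Lemma norm_upto_degen i f : norm_upto i f -> norm_upto i (degen i f).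
Proof.
move=> fi u w ui; rewrite /degen take_cat ltnNge (ltnW ui) /=.
have -> : (i - size u)%N = (i - size u).-1.+1 by rewrite prednK // subn_gt0.
by rewrite /= -catA cat_cons fi.
Qed.

(** Subtracting the differential of the degeneracy at the place i, up to
    sign, makes f vanish when 1 stands at the place i. Indeed,
    [hoch_d_one] expresses both this differential and the value of df on
    (u, 1, 1, w) by the insertion of the product in the part of the word
    behind u, and these differ by f(u, 1, w). *)
Lemma norm_step i f : mlin f -> norm_upto i f ->
  (forall u w, size u = i -> hoch_d f (u ++ 1 :: 1 :: w) = 0) ->
  norm_upto i.+1 (fun s => f s - (-1) ^+ i *: hoch_d (degen i f) s).
Proof.
move=> fl fi df u w; rewrite ltnS leq_eqVlt => /orP[/eqP ui|ui].
  rewrite hoch_d_one; last first.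
  - by move=> v vu; rewrite norm_upto_degen // -ui.
  - exact: mlin_degen.
  have := df _ w ui; rewrite hoch_d_one //; last by move=> v vu; rewrite fi // -ui.
  case: w => [|z w] /=.
    rewrite bar_cons; last exact: (mlin_cons 1 (mlin_catl u fl)).
    rewrite /= bar_nil; last exact: (mlin_cons 1 (mlin_cons 1 (mlin_catl u fl))).
    rewrite ract1 => E; rewrite scaler0 subr0.
    have /(congr1 (fun x => (-1) ^+ size u *: x)) := E; rewrite scaler0 scalerA.
    rewrite -exprMn mulrNN mulr1 expr1n => <-; lin.
  rewrite bar_cons; last exact: (mlin_cons 1 (mlin_catl u fl)).
  rewrite /= mul1r.
  have -> : (fun t => degen i f (u ++ 1 :: t)) = (fun t => f (u ++ 1 :: 1 :: t)).
    by apply/funext => t; rewrite degen_cat.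
  rewrite degen_cat // ui => /(congr1 (fun x => (-1) ^+ i *: x)).
  rewrite scaler0 !scalerA -exprMn mulrNN mulr1 expr1n !scale1r !exprS => E.
  apply/eqP; rewrite subr_eq0 -subr_eq0; apply/eqP; rewrite -[RHS]E; lin.
have d0 : hoch_d (degen i f) (u ++ 1 :: w) = 0.
  rewrite hoch_d_one; last first.
  - by move=> v vu; rewrite norm_upto_degen // (ltn_trans vu).
  - exact: mlin_degen.
  have dg := norm_upto_degen fi.
  case: w => // z w; have -> : (fun t => degen i f (u ++ 1 :: t)) = fun=> 0.
    by apply/funext => t; apply: dg.
  by rewrite (op0 (@bar_linear _ _ _)) dg // ract0; lin.
by rewrite fi // d0; lin.
Qed.

Lemma norm_upto_normalized n i f :
  supp i f -> norm_upto n f -> (`|i| <= n)%N -> normalized f.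
Proof.
move=> fs fn ni s s1; have [si|si] := eqVneq (size s)%:Z i; last exact: fs.
case/splitPr: s1 si => u w si; apply: fn.
by move: si ni; rewrite size_cat /=; lia.
Qed.

End Normalization.

Section NormalizedCochains.
Variables (k : comPzRingType) (A : algType k).
Local Notation AA := (regular_bimod A).

(** Applies [norm_step] at the places 0, 1, ... in turn. The hypothesis
    asks for df normalized rather than zero in order to compare the
    normalized representatives of one class. *)
Lemma normalization i (f : seq A -> AA) : mlin f -> supp i f -> normalized (hoch_d f) ->
  exists y : seq A -> AA, [/\ mlin y, supp (i - 1) y & normalized (f - hoch_d y)].
Proof.
move=> fl fs fn.
suff [y [yl ys yn]] : exists y : seq A -> AA,
    [/\ mlin y, supp (i - 1) y & norm_upto `|i|%N (f - hoch_d y)].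
  exists y; split=> //; apply: (norm_upto_normalized _ yn) => // s si.
  by rewrite !fctE fs // (supp_hoch_d yl ys) ?subrK // subr0.
elim: `|i|%N => [|n [y [yl ys yn]]].
  exists (fun=> 0); split=> // s t c a b; lin.
set f' := f - hoch_d y in yn.
have dyl := mlin_hoch_d yl ys; have dys := supp_hoch_d yl ys.
have f'l : mlin f'.
  by move=> s t c a b; rewrite /f' !fctE fl dyl; lin.
have f's : supp i f'.
  by move=> s si; rewrite /f' !fctE fs // dys ?subrK // subr0.
have df' : hoch_d f' = hoch_d f.
  have -> : f' = -1 *: hoch_d y + f by rewrite scaleN1r addrC.
  by rewrite hoch_d_linear (hoch_d_hoch_d yl ys) scaler0 add0r.
have gl : mlin (degen n f') by apply: mlin_degen.
have gs : supp (i - 1) (degen n f') by apply: supp_degen.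
exists ((-1) ^+ n *: degen n f' + y); split.
- by move=> s t c a b; rewrite !fctE gl yl; lin.
- by move=> s si; rewrite !fctE gs // ys //; lin.
rewrite hoch_d_linear opprD addrCA addrC -/f' => u w uw.
rewrite -(norm_step f'l yn _ w uw) // => u' w' _.
by rewrite df' fn // mem_cat inE eqxx orbT.
Qed.

End NormalizedCochains.

(** * The Batalin-Vilkovisky homotopy *)

Section CycLinear.
Variables (k : comPzRingType) (A : algType k) (V : lmodType k).

Lemma cyc_linear T e (phi : seq A -> V) s : op_linear T -> mlin phi ->
  linear (fun a0 => cyc T e phi a0 s).
Proof.
move=> TP phil c a b; rewrite /cyc -deconcP; apply: eq_deconc => p w.
have -> : (fun t => phi (w ++ (c *: a + b) :: t)) =
    (fun t => c *: phi (w ++ a :: t) + phi (w ++ b :: t)).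
  by apply/funext => t; apply: phil.
by rewrite TP; lin.
Qed.

Lemma mlin_cyc T e (phi : seq A -> V) a0 : op_linear T ->
  (forall phi, mlin phi -> mlin (T phi)) -> mlin phi -> mlin (cyc T e phi a0).
Proof.
move=> TP Tl phil; rewrite /cyc; apply: mlin_deconc => u s t c a b.
  by rewrite (Tl _ (mlin_cons a0 (mlin_catl u phil))); lin.
have -> : (fun x => phi ((s ++ (c *: a + b) :: t) ++ a0 :: x)) =
    (fun x => c *: phi ((s ++ a :: t) ++ a0 :: x) + phi ((s ++ b :: t) ++ a0 :: x)).
  by apply/funext => x; rewrite -!catA !cat_cons phil.
by rewrite TP !size_cat /=; lin.
Qed.

End CycLinear.

Section SymmetricAlgebra.
Variables (k : comPzRingType) (A : algType k).
Local Notation AA := (regular_bimod A).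
Local Notation D := (dual_bimod A).
Variables (Theta : AA -> D) (Psi : D -> AA).
Hypotheses (Tl : linear Theta) (TL : forall a x, Theta (lact AA a x) = lact D a (Theta x))
  (TR : forall x a, Theta (ract AA x a) = ract D (Theta x) a)
  (TK : cancel Theta Psi) (PK : cancel Psi Theta).
Implicit Types (f g : seq A -> AA).
Local Notation tr := (tr Theta).
Let tr_lin : linear tr := @tr_linear k A Theta.
Let trM : forall x y, tr (x * y) = tr (y * x) := trC TL TR.
Let Pl : linear Psi := Psi_linear Tl TK PK.

Lemma Theta_comp_mlin f : mlin f -> mlin (Theta \o f).
Proof. exact: mlin_comp Tl _. Qed.

(** The form (x, y) -> tr(x y) is nondegenerate, as Theta is injective.
    Identities between cochains are checked against all a0. *)
Lemma pairing_inj (x y : A) : (forall a0, tr (a0 * x) = tr (a0 * y)) -> x = y.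
Proof.
move=> E; apply: (can_inj TK); apply: dualP => a0.
by rewrite !(Theta_tr TL) E.
Qed.

Lemma connesB_Theta b f s a0 : mlin f -> homog b f ->
  (connesB (Theta \o f) s : dual A) a0 = connes tr b f a0 s.
Proof.
move=> fl fb; rewrite connesB_deconc; last exact: Theta_comp_mlin.
apply: eq_deconc_cat => p w pw; rewrite /= (Theta_tr TL) mul1r.
have [par|par] := eqVneq (odd (size (w ++ a0 :: p))) b; last first.
  by rewrite fb // -[0]/(0 : A) (linear_map0 tr_lin) !scaler0.
congr (_ *: _); rewrite mulnC exprM -signr_odd /eps; congr ((_ ^+ nat_of_bool _) ^+ _).
by rewrite -par -pw !size_cat /= addnS oddS addnC negbK.
Qed.

(** The Connes operator transported to cochains with values in A. *)
Definition Delta f : seq A -> AA := Psi \o connesB (Theta \o f).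

Lemma Theta_Delta f : Theta \o Delta f = connesB (Theta \o f).
Proof. by apply/funext => s; rewrite /= PK. Qed.

Lemma tr_Delta b f s a0 : mlin f -> homog b f ->
  tr (a0 * Delta f s) = connes tr b f a0 s.
Proof. by move=> fl fb; rewrite -(Theta_tr TL) /Delta /= PK (connesB_Theta _ _ fl fb). Qed.

Lemma mlin_Delta f : mlin f -> mlin (Delta f).
Proof.
move=> fl; apply: (mlin_comp Pl); apply: mlin_connesB; exact: Theta_comp_mlin.
Qed.

Lemma supp_Delta i f : mlin f -> supp i f -> supp (i - 1) (Delta f).
Proof.
move=> fl fs; apply: (supp_comp Pl); apply: supp_connesB; first exact: Theta_comp_mlin.
exact: (supp_comp Tl).
Qed.

Lemma hoch_d_Delta i f : mlin f -> supp i f -> hoch_d (Delta f) = - Delta (hoch_d f).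
Proof.
move=> fl fs; have fb := supp_homog fs.
have dl := mlin_Delta fl; have ds := supp_Delta fl fs.
have hl := mlin_hoch_d fl fs; have hs := supp_hoch_d fl fs.
have hb := supp_homog hs.
apply/funext => s.
have [si|si] := eqVneq (size s)%:Z i; last first.
  rewrite fctE (supp_hoch_d dl ds) ?subrK // (supp_Delta hl hs) ?oppr0 //.
  by rewrite addrK.
apply: pairing_inj => a0; rewrite fctE mulrN.
rewrite -(Theta_tr TL) -[Theta _]/((Theta \o hoch_d (Delta f)) s).
rewrite -(hoch_d_comp Tl TL TR dl) hoch_d_dual; last exact: Theta_comp_mlin.
have -> : (fun a u => ((Theta \o Delta f) u : dual A) a) = connes tr (odd `|i|%N) f.
  by apply/funext => a; apply/funext => u; rewrite Theta_Delta (connesB_Theta _ _ fl fb).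
rewrite (cdif_connes tr_lin trM) //; last by move: si; lia.
have -> x : tr (- x) = - tr x by rewrite -!scaleN1r (linear_mapZ tr_lin).
by rewrite (tr_Delta _ _ hl hb) odd_absD addbT (hoch_d_regular fl fb).
Qed.

(** The cochain H with tr(a0 H(s)) the sum over rotations with g inserted
    after a0. It exists because Theta is surjective. *)
Definition homotopy bf bg f g : seq A -> AA := fun s =>
  Psi (mkdual (fun a0 => cyc (brace (eps k bg) g) (eps k bf) (fun t => tr (f t)) a0 s)).

Lemma Theta_homotopy bf bg f g s a0 : mlin f ->
  ((Theta \o homotopy bf bg f g) s : dual A) a0 =
  cyc (brace (eps k bg) g) (eps k bf) (fun t => tr (f t)) a0 s.
Proof.
move=> fl; rewrite /= /homotopy PK mkdualE //.
by apply: cyc_linear; [apply: brace_linear | apply: mlin_tr].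
Qed.

Lemma mlin_homotopy bf bg f g : mlin f -> mlin g -> mlin (homotopy bf bg f g).
Proof.
move=> fl gl; have -> : homotopy bf bg f g = Psi \o (Theta \o homotopy bf bg f g).
  by apply/funext => s; rewrite /= TK.
apply: (mlin_comp Pl) => s t c a b; apply: dualP => a0.
rewrite dual_combE !Theta_homotopy //.
rewrite (mlin_cyc _ _ (@brace_linear _ _ _ _ _)) //; last exact: mlin_tr.
by move=> phi; apply: mlin_brace.
Qed.

Lemma supp_homotopy i j bf bg f g : mlin f -> supp i f -> supp j g ->
  supp (i + j - 2) (homotopy bf bg f g).
Proof.
move=> fl fs gs s si; apply: (can_inj TK).
have T0 : Theta 0 = 0 := linear_map0 Tl.
rewrite T0; apply: dualP => a0; rewrite -[Theta _]/((Theta \o _) s) Theta_homotopy //.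
apply: deconc_supp => u v E.
have trl := mlin_tr tr_lin fl.
have trs : supp (i - (size v).+1%:Z) (fun t => tr (f (v ++ a0 :: t))).
  move=> t ti; rewrite fs; last by rewrite size_cat /=; lia.
  exact: linear_map0 tr_lin.
rewrite (supp_brace _ (mlin_cons a0 (mlin_catl v trl)) trs gs) ?scaler0 //.
by move: si; rewrite -E size_cat; lia.
Qed.

Lemma tr_homotopy bf bg f g s a0 :
  mlin f -> mlin g -> homog bf f -> homog bg g ->
  hoch_d f = 0 -> hoch_d g = 0 -> odd (size s) = bf (+) ~~ bg ->
  tr (a0 * hoch_d (homotopy bf bg f g) s) =
  eps k bg *: tr (a0 * brace (eps k bg) g f s)
  - eps k bg *: tr (a0 * cup g (Delta f) s)
  + (eps k bg * eps k bf) *: wound tr bf bg f g a0 s.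
Proof.
move=> fl gl fb gb df dg sb.
have hl := mlin_homotopy bf bg fl gl.
rewrite -(Theta_tr TL) -[Theta _]/((Theta \o hoch_d (homotopy bf bg f g)) s).
rewrite -(hoch_d_comp Tl TL TR hl) hoch_d_dual; last exact: Theta_comp_mlin.
have -> : (fun a u => ((Theta \o homotopy bf bg f g) u : dual A) a) =
   cyc (brace (eps k bg) g) (eps k bf) (fun t => tr (f t)).
  by apply/funext => a; apply/funext => u; rewrite Theta_homotopy.
rewrite (cdif_homotopy tr_lin trM) //; first last.
- by move=> t; rewrite -(hoch_d_regular gl gb) dg.
- by move=> t; rewrite -(hoch_d_regular fl fb) df.
congr (_ - _ *: _ + _).
rewrite (deconc_comp (l := fun x => tr (a0 * x))); last first.
  by move=> c u v; rewrite mulrDr -scalerAr tr_lin.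
by apply: eq_deconc => u v; rewrite mulrA (tr_Delta _ _ fl fb).
Qed.

(** The Batalin-Vilkovisky identity for cocycles up to an explicit
    coboundary. [tr_homotopy] for (f, g) and for (g, f) contain the two
    terms of [connes_cup]. *)
Lemma bracket_homotopic i j f g : mlin f -> mlin g -> supp i f -> supp j g ->
  hoch_d f = 0 -> hoch_d g = 0 ->
  exists y : seq A -> AA, [/\ mlin y, supp (i + j - 2) y &
    brk (odd `|i|%N) (odd `|j|%N) f g =
    (sgn ((i - 1) * (j - 1)) : k) *: (cup g (Delta f) : seq A -> AA) - cup f (Delta g)
    + (sgn i : k) *: Delta (cup f g) + hoch_d y].
Proof.
move=> fl gl fs gs df dg; have fb := supp_homog fs; have gb := supp_homog gs.
set bi := odd `|i|%N in fb *; set bj := odd `|j|%N in gb *.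
rewrite sgnM !odd_abs_pred sgnE -/bi -/bj.
have hfl := mlin_homotopy bi bj fl gl; have hgl := mlin_homotopy bj bi gl fl.
have hfs := supp_homotopy bi bj fl fs gs; have hgs := supp_homotopy bj bi gl gs fs.
have ji : j + i - 2 = i + j - 2 by rewrite (addrC j).
rewrite ji in hgs.
(* The coefficients are those for which f{g} and g{f} form the bracket. *)
pose y : seq A -> AA := fun s =>
  ((-1) ^+ (~~ bi && ~~ bj) * eps k bj) *: homotopy bi bj f g s
  + (- eps k bi *: homotopy bj bi g f s + 0).
have dy : hoch_d y = (fun s =>
   ((-1) ^+ (~~ bi && ~~ bj) * eps k bj) *: hoch_d (homotopy bi bj f g) s
  + - eps k bi *: hoch_d (homotopy bj bi g f) s).
  rewrite -[y]/(_ *: homotopy bi bj f g + (_ *: homotopy bj bi g f + 0)).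
  rewrite addr0 hoch_d_linear -[- eps k bi *: _]addr0 hoch_d_linear.
  rewrite (_ : hoch_d 0 = 0) ?addr0 //.
  by have := hoch_d_linear (-1) (0 : seq A -> AA) 0; rewrite scaler0 addr0 scaleN1r addNr.
have yl : mlin y by apply: mlin_comb => //; apply: mlin_comb => // ? ? ? ? ?; lin.
have ys : supp (i + j - 2) y by move=> s si; rewrite /y hfs // hgs //; lin.
exists y; split=> //; apply/funext => s; rewrite !fctE.
have csl := mlin_cup fl gl; have css := supp_cup fs gs.
have [si|si] := eqVneq (size s)%:Z (i + j - 1); last first.
  rewrite (supp_hoch_d yl ys) ?(supp_Delta csl css) //; last by move: si; lia.
  rewrite (supp_cup gs (supp_Delta fl fs)); last by move: si; lia.
  rewrite (supp_cup fs (supp_Delta gl gs)); last by move: si; lia.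
  rewrite /brk (supp_brace _ fl fs gs) // (supp_brace _ gl gs fs); first by lin.
  by move: si; lia.
have sij : odd (size s) = bi (+) ~~ bj by rewrite /bi /bj; move: si; lia.
have sji : odd (size s) = bj (+) ~~ bi.
  by rewrite sij; case: (bi); case: (bj).
apply: pairing_inj => a0.
pose ta x : k^o := tr (a0 * x); rewrite -!/(ta _).
have tal : linear ta by move=> c u v; rewrite /ta mulrDr -scalerAr tr_lin.
have taD : forall u v, ta (u + v) = ta u + ta v := linear_mapD tal.
have taZ : forall c u, ta (c *: u) = c *: ta u := linear_mapZ tal.
have taN u : ta (- u) = - ta u by rewrite -!scaleN1r taZ.
have dfg := tr_homotopy a0 fl gl fb gb df dg sij.
have dgf := tr_homotopy a0 gl fl gb fb dg df sji.
rewrite -!/(ta _) in dfg dgf; rewrite dy /brk !(taD, taN, taZ) dfg dgf.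
rewrite [in ta (Delta _ _)]/ta (tr_Delta _ _ csl (supp_homog css)) odd_absD.
rewrite (connes_cup tr_lin trM fb gb).
by case: (bi); case: (bj); rewrite /eps /= ?expr0 ?expr1; lin.
Qed.

End SymmetricAlgebra.

(** * Cohomology classes *)

Section CohomologyClasses.
Local Open Scope quotient_scope.
Variables (k : comPzRingType) (C : complex k) (n : int).
Local Notation V := (cpx_ambient C).
Local Notation Z := (@cocycles k C n).
Local Notation pi := (\pi_(Quotient.quot (mquot_pred (@coboundary k C n)))).

Lemma cls_cocycle (x : V) (xz : x \in @cocycle k C n) : (cls x : cohomology C n) = pi (Cocycle xz).
Proof. by rewrite /cls /insubd insubT. Qed.

Lemma rep_cocycle (h : cohomology C n) : rep h \in @cocycle k C n.
Proof. by rewrite /rep; case: (repr _). Qed.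

Lemma clsK (h : cohomology C n) : cls (rep h) = h.
Proof.
rewrite (cls_cocycle (rep_cocycle h)) -[RHS]reprK; congr (pi _).
exact: val_inj.
Qed.

Lemma pi_eq (x y : Z) : (pi x = pi y) <-> x - y \in @coboundary k C n.
Proof.
split=> [E|E]; last by apply/eqP; rewrite -Quotient.idealrBE.
by rewrite -[_ \in _]/(x - y \in mquot_pred (@coboundary k C n)) Quotient.idealrBE; apply/eqP.
Qed.

Lemma cls_eq (x y : V) : x \in @cocycle k C n -> y \in @cocycle k C n ->
  (cls x : cohomology C n) = cls y <->
  exists2 z, cpx_deg (n - 1) z & x - y = cpx_d z.
Proof.
move=> xz yz; rewrite (cls_cocycle xz) (cls_cocycle yz) pi_eq.
by split=> [/asboolP|] // E; apply/asboolP.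
Qed.

Lemma cls_linear c (x y : V) : x \in @cocycle k C n -> y \in @cocycle k C n ->
  (cls (c *: x + y) : cohomology C n) = c *: cls x + cls y.
Proof.
move=> xz yz; have xyz : c *: x + y \in @cocycle k C n.
  by apply: rpredD => //; apply: rpredZ.
rewrite (cls_cocycle xz) (cls_cocycle yz) (cls_cocycle xyz).
have -> : Cocycle xyz = c *: Cocycle xz + Cocycle yz by apply: val_inj.
rewrite (raddfD pi); congr (_ + _); apply/pi_eq; rewrite -scalerBr.
apply: rpredZ; apply/pi_eq; by rewrite reprK.
Qed.

End CohomologyClasses.

Section HochschildClasses.
Variables (k : comPzRingType) (A : algType k) (M : bimodule A).
Implicit Types f g : seq A -> M.

Lemma HHrepP n (h : HH M n) : HHcocycle n (rep h : seq A -> M).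
Proof. exact: (elimT (@cocycleP k (hochschild M) n _) (rep_cocycle h)). Qed.

Lemma HHclsK n (h : HH M n) : HHcls M n (rep h) = h.
Proof. exact: clsK. Qed.

Lemma HHcocycleP n f : HHcocycle n f -> (f : cpx_ambient (hochschild M)) \in @cocycle k (hochschild M) n.
Proof. exact: (introT (@cocycleP k (hochschild M) n f)). Qed.

Lemma HHcls_eq n f g : HHcocycle n f -> HHcocycle n g ->
  HHcls M n f = HHcls M n g <->
  exists2 y : seq A -> M, is_cochain (n - 1) y & f - g = hoch_d y.
Proof. by move=> /HHcocycleP fz /HHcocycleP gz; apply: (cls_eq fz gz). Qed.

Lemma HHcls_linear n c f g : HHcocycle n f -> HHcocycle n g ->
  HHcls M n (c *: f + g) = c *: HHcls M n f + HHcls M n g.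
Proof. by move=> /HHcocycleP fz /HHcocycleP gz; apply: (cls_linear c fz gz). Qed.

Lemma HHcocycle_lin n c f g : HHcocycle n f -> HHcocycle n g -> HHcocycle n (c *: f + g).
Proof.
move=> [fc df] [gc dg]; split; first exact: is_cochainP.
by rewrite hoch_d_linear df dg scaler0 addr0.
Qed.

Lemma HHcocycle0 n : HHcocycle n (0 : seq A -> M).
Proof.
split; first exact: is_cochain0.
by have := hoch_d_linear (-1) (0 : seq A -> M) 0; rewrite scaler0 addr0 scaleN1r addNr.
Qed.

Lemma HHcls_regrade i j (e : i = j) f : regrade (HH M) e (HHcls M i f) = HHcls M j f.
Proof. by case: j / e. Qed.

Lemma HHcls_rep n f : HHcocycle n f ->
  exists2 y : seq A -> M, is_cochain (n - 1) y &
    (rep (HHcls M n f) : seq A -> M) = f + hoch_d y.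
Proof.
move=> fz; have [y yc E] : exists2 y : seq A -> M, is_cochain (n - 1) y &
    (rep (HHcls M n f) : seq A -> M) - f = hoch_d y.
  by apply/(HHcls_eq (HHrepP _) fz); rewrite HHclsK.
by exists y => //; rewrite -E addrC subrK.
Qed.

End HochschildClasses.

Section Descent.
Variables (k : comPzRingType) (A : algType k).
Local Notation AA := (regular_bimod A).
Variables (i j n : int) (op : (seq A -> AA) -> (seq A -> AA) -> seq A -> AA).
Hypotheses
  (opz : forall f g, HHcocycle i f -> HHcocycle j g -> HHcocycle n (op f g))
  (opDl : forall f f' g, is_cochain i f -> is_cochain i f' -> is_cochain j g ->
     op (f + f') g = op f g + op f' g)
  (opDr : forall f g g', is_cochain i f -> is_cochain j g -> is_cochain j g' ->
     op f (g + g') = op f g + op f g')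
  (opbl : forall y g, is_cochain (i - 1) y -> HHcocycle j g ->
     exists2 w, is_cochain (n - 1) w & op (hoch_d y) g = hoch_d w)
  (opbr : forall f y, HHcocycle i f -> is_cochain (j - 1) y ->
     exists2 w, is_cochain (n - 1) w & op f (hoch_d y) = hoch_d w).

(** A biadditive operation on cochains that maps a product of a coboundary
    and a cocycle to a coboundary has a class that depends only on the
    classes of its arguments. *)
Lemma op_descends f g : HHcocycle i f -> HHcocycle j g ->
  HHcls AA n (op (rep (HHcls AA i f)) (rep (HHcls AA j g))) = HHcls AA n (op f g).
Proof.
move=> fz gz; have [y yc fE] := HHcls_rep fz; have [z zc gE] := HHcls_rep gz.
have rfz := HHrepP (HHcls AA i f); have rgz := HHrepP (HHcls AA j g).
have dyc : is_cochain i (hoch_d y : seq A -> AA).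
  have -> : hoch_d y = -1 *: f + rep (HHcls AA i f).
    by rewrite fE scaleN1r addrA addNr add0r.
  by apply: is_cochainP; [case: fz | case: rfz].
have dzc : is_cochain j (hoch_d z : seq A -> AA).
  have -> : hoch_d z = -1 *: g + rep (HHcls AA j g).
    by rewrite gE scaleN1r addrA addNr add0r.
  by apply: is_cochainP; [case: gz | case: rgz].
have [u uc uE] := opbl yc rgz; have [v vc vE] := opbr fz zc.
apply/HHcls_eq; [exact: opz | exact: opz |].
exists (1 *: u + v); first exact: is_cochainP.
rewrite hoch_d_linear scale1r -uE -vE {1}fE.
rewrite (opDl _ dyc); [|by case: fz|by case: rgz].
rewrite {1}gE (opDr _ _ dzc); [|by case: fz|by case: gz].
by rewrite addrAC [op f g + _]addrC addrK addrC.
Qed.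

End Descent.

(** * The Gerstenhaber algebra *)

Section GerstenhaberClasses.
Variables (k : comPzRingType) (A : algType k).
Local Notation AA := (regular_bimod A).
Local Notation cochain := (@is_cochain k A AA).
Local Notation Zcocycle := (@HHcocycle k A AA).
Implicit Types f g h : seq A -> AA.

Lemma sgnK (i : int) : sgn i * sgn i = 1 :> k.
Proof. by rewrite /sgn -exprMn mulrNN mulr1 expr1n. Qed.

Lemma cochain_homog i f : cochain i f -> homog (odd `|i|%N) f.
Proof. by move=> [_ fs]; apply: supp_homog. Qed.

Lemma HHcocycle_dif i f : Zcocycle i f -> forall s, dif (odd `|i|%N) f s = 0.
Proof.
move=> [fc df] s; have fb := cochain_homog fc; case: fc => fl _.
by rewrite -(hoch_d_regular fl fb) df.
Qed.

Lemma is_cochain_cup i j f g : cochain i f -> is_cochain j g -> cochain (i + j) (cup f g).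
Proof. by move=> [fl fs] [gl gs]; split; [apply: mlin_cup | apply: supp_cup]. Qed.

Lemma is_cochain_d i f : cochain i f -> cochain (i + 1) (hoch_d f).
Proof. by move=> [fl fs]; split; [apply: mlin_hoch_d fs | apply: supp_hoch_d]. Qed.

Lemma is_cochain_d1 i f : cochain (i - 1) f -> cochain i (hoch_d f).
Proof. by move/is_cochain_d; rewrite subrK. Qed.

Lemma hoch_d_cochain i f : cochain i f -> hoch_d f = dif (odd `|i|%N) f.
Proof. by move=> fc; rewrite (hoch_d_regular _ (cochain_homog fc)) //; case: fc. Qed.

Lemma hoch_d_cup i j f g : cochain i f -> is_cochain j g ->
  hoch_d (cup f g : seq A -> AA) =
  (cup (hoch_d f) g : seq A -> AA) + (sgn i : k) *: (cup f (hoch_d g) : seq A -> AA).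
Proof.
move=> fc gc; rewrite (hoch_d_cochain (is_cochain_cup fc gc)).
apply/funext => s; rewrite !fctE odd_absD dif_cup; try by [case: fc | case: gc].
- by rewrite !(hoch_d_cochain fc, hoch_d_cochain gc) sgnE /eps;
   case: (odd _); rewrite /= ?expr0 ?expr1; lin.
- exact: cochain_homog.
- exact: cochain_homog.
Qed.

Lemma HHcocycle_cup i j f g : Zcocycle i f -> Zcocycle j g -> Zcocycle (i + j) (cup f g).
Proof.
move=> [fc df] [gc dg]; split; first exact: is_cochain_cup.
rewrite (hoch_d_cup fc gc) df dg; apply/funext => s.
by rewrite !fctE cup0l cup0r scaler0 addr0.
Qed.

Lemma cup_addl f f' g : cup (f + f') g = (cup f g : seq A -> AA) + cup f' g.
Proof.
apply/funext => s; rewrite -[RHS]/(cup f g s + cup f' g s) /cup -deconcD.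
by apply: eq_deconc => u v; rewrite -mulrDl.
Qed.

Lemma cup_addr f g g' : cup f (g + g') = (cup f g : seq A -> AA) + cup f g'.
Proof.
apply/funext => s; rewrite -[RHS]/(cup f g s + cup f g' s) /cup -deconcD.
by apply: eq_deconc => u v; rewrite -mulrDr.
Qed.

Lemma cupZl c f g : cup (c *: f) g = c *: (cup f g : seq A -> AA).
Proof.
apply/funext => s; rewrite -[RHS]/(c *: cup f g s) /cup -deconcZ.
by apply: eq_deconc => u v; rewrite scalerAl.
Qed.

Lemma cupZr c f g : cup f (c *: g) = c *: (cup f g : seq A -> AA).
Proof.
apply/funext => s; rewrite -[RHS]/(c *: cup f g s) /cup -deconcZ.
by apply: eq_deconc => u v; rewrite scalerAr.
Qed.

Lemma HHcup_cls i j f g : Zcocycle i f -> Zcocycle j g ->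
  HHcup (HHcls AA i f) (HHcls AA j g) = HHcls AA (i + j) (cup f g).
Proof.
move=> fz gz; rewrite /HHcup cup_cochainE; last by have [[_ fs] _] := HHrepP (HHcls AA i f).
apply: (op_descends (op := @cup k A)) => //.
- exact: HHcocycle_cup.
- by move=> u u' v _ _ _; apply: cup_addl.
- by move=> u v v' _ _ _; apply: cup_addr.
- move=> y u yc [uc du]; exists (cup y u).
    by rewrite -addrAC; apply: is_cochain_cup.
  by rewrite (hoch_d_cup yc uc) du; apply/funext => s; rewrite !fctE cup0r; lin.
- move=> u y [uc du] yc; exists ((sgn i : k) *: (cup u y : seq A -> AA)).
    have := is_cochainP (sgn i) (is_cochain_cup uc yc) (is_cochain0 _ _).
    by rewrite addr0 addrA.
  rewrite -[_ *: _]addr0 hoch_d_linear (hoch_d_cup uc yc) du (HHcocycle0 _ 0).2.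
  by apply/funext => s; rewrite !fctE cup0l add0r scalerA sgnK scale1r addr0.
Qed.

Lemma is_cochain_brace i j e f g : cochain i f -> is_cochain j g ->
  cochain (i + j - 1) (brace e g f).
Proof. by move=> [fl fs] [gl gs]; split; [apply: mlin_brace | apply: supp_brace]. Qed.

Lemma brk_lin i j f g : (brk (odd `|i|%N) (odd `|j|%N) f g : seq A -> AA) =
  (-1) ^+ (~~ odd `|i|%N && ~~ odd `|j|%N) *: (brace (eps k (odd `|j|%N)) g f : seq A -> AA)
  + ((-1) *: (brace (eps k (odd `|i|%N)) f g : seq A -> AA) + 0).
Proof. by apply/funext => s; rewrite addr0 scaleN1r. Qed.

Lemma is_cochain_brk i j f g : cochain i f -> is_cochain j g ->
  cochain (i + j - 1) (brk (odd `|i|%N) (odd `|j|%N) f g).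
Proof.
move=> fc gc; rewrite brk_lin; apply: is_cochainP; first exact: is_cochain_brace.
by apply: is_cochainP; [rewrite (addrC i); apply: is_cochain_brace | apply: is_cochain0].
Qed.

(** The terms f u g and g u f of [dif_brace] cancel in the commutator. *)
Lemma dif_brk bf bg f g s : mlin f -> mlin g -> homog bf f -> homog bg g ->
  dif (bf (+) ~~ bg) (brk bf bg f g) s =
  brk (~~ bf) bg (dif bf f) g s + eps k bf *: brk bf (~~ bg) f (dif bg g) s.
Proof.
move=> fl gl fb gb.
have -> : dif (bf (+) ~~ bg) (brk bf bg f g) s =
   (-1) ^+ (~~ bf && ~~ bg) *: dif (bf (+) ~~ bg) (brace (eps k bg) g f) s
   - dif (bg (+) ~~ bf) (brace (eps k bf) f g) s.
  have -> : bg (+) ~~ bf = bf (+) ~~ bg by case: (bf); case: (bg).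
  have bE e x : dif e x s = eps k e *: cup x (@idc k A) s + cup (@idc k A) x s - bar x s
    by exact: difE.
  rewrite !bE.
  have -> : brk bf bg f g = (fun t => -1 *: brace (eps k bf) f g t +
    (-1) ^+ (~~ bf && ~~ bg) *: brace (eps k bg) g f t).
    by apply/funext => t; rewrite scaleN1r addrC.
  rewrite cupPl cupPr bar_linear (opZ (@bar_linear _ _ _)).
  have cZl c u : cup (fun t => c *: u t) (@idc k A) s = c *: cup u (@idc k A) s.
    by rewrite -[RHS]addr0 -(cup0l (@idc k A) s) -cupPl; apply: cup_ext => // t; rewrite addr0.
  have cZr c u : cup (@idc k A) (fun t => c *: u t) s = c *: cup (@idc k A) u s.
    by rewrite -[RHS]addr0 -(cup0r (@idc k A) s) -cupPr; apply: cup_ext => // t; rewrite addr0.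
  rewrite cZl cZr; lin.
rewrite !dif_brace // !brkE !epsN.
by case: (bf); case: (bg); rewrite /eps /= ?expr0 ?expr1 ?opprK; lin.
Qed.

Lemma hoch_d_brk i j f g : cochain i f -> is_cochain j g ->
  hoch_d (brk (odd `|i|%N) (odd `|j|%N) f g : seq A -> AA) =
  (brk (odd `|(i + 1)%R|%N) (odd `|j|%N) (hoch_d f) g : seq A -> AA)
  + (sgn (i - 1) : k) *: (brk (odd `|i|%N) (odd `|(j + 1)%R|%N) f (hoch_d g) : seq A -> AA).
Proof.
move=> fc gc; rewrite (hoch_d_cochain (is_cochain_brk fc gc)).
have fb := cochain_homog fc; have gb := cochain_homog gc.
have -> : odd `|(i + j - 1)%R|%N = odd `|i|%N (+) ~~ odd `|j|%N by lia.
apply/funext => s; rewrite dif_brk //; try by [case: fc | case: gc].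
rewrite -(hoch_d_cochain fc) -(hoch_d_cochain gc) !fctE.
have -> : ~~ odd `|i|%N = odd `|(i + 1)%R|%N by lia.
have -> : ~~ odd `|j|%N = odd `|(j + 1)%R|%N by lia.
by rewrite sgnE odd_abs_pred.
Qed.

Lemma brk0l bf bg g : mlin g -> brk bf bg (fun=> 0) g = fun=> 0.
Proof.
move=> gl; apply/funext => s; rewrite brkE brace_fun0 // (op0 (@brace_linear _ _ _ _ _)); lin.
Qed.

Lemma brk0r bf bg f : mlin f -> brk bf bg f (fun=> 0) = fun=> 0.
Proof.
move=> gl; apply/funext => s; rewrite brkE brace_fun0 // (op0 (@brace_linear _ _ _ _ _)); lin.
Qed.

Lemma HHcocycle_brk i j f g : Zcocycle i f -> Zcocycle j g ->
  Zcocycle (i + j - 1) (brk (odd `|i|%N) (odd `|j|%N) f g).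
Proof.
move=> [fc df] [gc dg]; split; first exact: is_cochain_brk.
rewrite (hoch_d_brk fc gc) df dg -[0]/(fun _ : seq A => 0 : A).
rewrite brk0l ?brk0r; try by [case: fc | case: gc].
by apply/funext => s; rewrite !fctE scaler0 addr0.
Qed.

Lemma brk_addl bf bg f f' g : mlin g ->
  brk bf bg (f + f') g = (brk bf bg f g : seq A -> AA) + brk bf bg f' g.
Proof.
move=> gl; apply/funext => s.
rewrite -[RHS]/(brk bf bg f g s + brk bf bg f' g s) !brkE.
rewrite -[f + f']/(fun t => f t + f' t) (opD (@brace_linear _ _ _ _ _)).
have -> : (fun t => f t + f' t) = (fun t => 1 *: f t + f' t) by apply/funext => t; rewrite scale1r.
rewrite brace_fun //; lin.
Qed.

Lemma brk_addr bf bg f g g' : mlin f ->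
  brk bf bg f (g + g') = (brk bf bg f g : seq A -> AA) + brk bf bg f g'.
Proof.
move=> fl; apply/funext => s.
rewrite -[RHS]/(brk bf bg f g s + brk bf bg f g' s) !brkE.
rewrite -[g + g']/(fun t => g t + g' t) (opD (@brace_linear _ _ _ _ _)).
have -> : (fun t => g t + g' t) = (fun t => 1 *: g t + g' t) by apply/funext => t; rewrite scale1r.
rewrite brace_fun //; lin.
Qed.

Lemma HHbracket_cls i j f g : Zcocycle i f -> Zcocycle j g ->
  HHbracket (HHcls AA i f) (HHcls AA j g) =
  HHcls AA (i + j - 1) (brk (odd `|i|%N) (odd `|j|%N) f g).
Proof.
move=> fz gz; rewrite /HHbracket.
have [[rl rs] _] := HHrepP (HHcls AA i f); have [[rl' rs'] _] := HHrepP (HHcls AA j g).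
rewrite bracket_cochainE //.
apply: (op_descends (op := @brk k A (odd `|i|%N) (odd `|j|%N))) => //.
- exact: HHcocycle_brk.
- by move=> u u' v _ _ [vl _]; apply: brk_addl.
- by move=> u v v' [ul _] _ _; apply: brk_addr.
- move=> y u yc [uc du]; exists (brk (odd `|(i - 1)%R|%N) (odd `|j|%N) y u).
    by rewrite (_ : i + j - 1 - 1 = i - 1 + j - 1); [apply: is_cochain_brk | lia].
  rewrite (hoch_d_brk yc uc) du -[0]/(fun _ : seq A => 0 : A) brk0r ?subrK; last by case: yc.
  by apply/funext => s; rewrite !fctE scaler0 addr0.
- move=> u y [uc du] yc.
  exists ((sgn (i - 1) : k) *: (brk (odd `|i|%N) (odd `|(j - 1)%R|%N) u y : seq A -> AA)).
    have := is_cochainP (sgn (i - 1)) (is_cochain_brk uc yc) (is_cochain0 _ _).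
    by rewrite addr0 (_ : i + (j - 1) - 1 = i + j - 1 - 1) //; lia.
  rewrite -[_ *: _]addr0 hoch_d_linear (hoch_d_brk uc yc) du (HHcocycle0 _ 0).2 subrK.
  rewrite -[X in brk _ _ X y]/(fun _ : seq A => 0 : A) brk0l; last by case: yc.
  by apply/funext => s; rewrite !fctE add0r scalerA sgnK scale1r addr0.
Qed.

End GerstenhaberClasses.

Section ClassArithmetic.
Variables (k : comPzRingType) (A : algType k) (M : bimodule A).
Implicit Types f g : seq A -> M.

Lemma HHcls0 n : HHcls M n 0 = 0.
Proof.
have := HHcls_linear (-1) (HHcocycle0 M n) (HHcocycle0 M n).
by rewrite scaler0 addr0 => ->; lin.
Qed.

Lemma HHclsZ n c f : HHcocycle n f -> HHcls M n (c *: f) = c *: HHcls M n f.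
Proof.
by move=> fz; have := HHcls_linear c fz (HHcocycle0 M n); rewrite HHcls0 !addr0.
Qed.

Lemma HHcocycleZ n c f : HHcocycle n f -> HHcocycle n (c *: f).
Proof. by move=> fz; have := HHcocycle_lin c fz (HHcocycle0 M n); rewrite addr0. Qed.

Lemma HHclsN n f : HHcocycle n f -> HHcls M n (- f) = - HHcls M n f.
Proof. by move=> fz; rewrite -[- f]scaleN1r HHclsZ // scaleN1r. Qed.

Lemma HHindex n (h : HH M n) : exists2 f, HHcocycle n f & h = HHcls M n f.
Proof. by exists (rep h); [apply: HHrepP | rewrite HHclsK]. Qed.

End ClassArithmetic.

Section GerstenhaberAlgebra.
Variables (k : comPzRingType) (A : algType k).
Local Notation AA := (regular_bimod A).
Local Notation cochain := (@is_cochain k A AA).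
Local Notation Zcocycle := (@HHcocycle k A AA).
Implicit Types f g h : seq A -> AA.

(** For cocycles, [dif_brace] exhibits the graded commutator as the
    coboundary of an insertion. *)
Lemma cup_commutes i j f g : Zcocycle i f -> Zcocycle j g ->
  HHcls AA (i + j) (cup f g) = sgn (i * j) *: HHcls AA (i + j) (cup g f).
Proof.
move=> fz gz; have fgz := HHcocycle_cup fz gz.
have gfz : Zcocycle (i + j) (cup g f) by rewrite addrC; apply: HHcocycle_cup.
rewrite -HHclsZ //; apply/HHcls_eq => //; first exact: HHcocycleZ.
have dg0 := HHcocycle_dif gz; have df0 := HHcocycle_dif fz.
case: (fz) => fc _; case: (gz) => gc _.
have Rc := is_cochain_brace (eps k (odd `|j|%N)) fc gc.
pose c : k := - (eps k (odd `|i|%N) * eps k (odd `|j|%N) ^+ (~~ odd `|i|%N)).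
exists (c *: (brace (eps k (odd `|j|%N)) g f : seq A -> AA)).
  by have := is_cochainP c Rc (is_cochain0 _ _); rewrite addr0.
rewrite -[c *: _]addr0 hoch_d_linear (HHcocycle0 _ 0).2 addr0 (hoch_d_cochain Rc).
apply/funext => s; rewrite !fctE.
have -> : odd `|(i + j - 1)%R|%N = odd `|i|%N (+) ~~ odd `|j|%N by lia.
rewrite dif_brace //; first last; try by [exact: cochain_homog | case: fc].
have -> : dif (odd `|i|%N) f = fun=> 0 by apply/funext.
have -> : dif (odd `|j|%N) g = fun=> 0 by apply/funext.
rewrite brace_fun0; last by case: fc.
rewrite (op0 (@brace_linear _ _ _ _ _)) sgnM /c /eps.
by case: (odd _); case: (odd _); rewrite /= ?expr0 ?expr1; lin.
Qed.

(** Bracketing with f on the left is a derivation only up to homotopy.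
    Insertion of f in g u h is a derivation by [brace_cup]; insertion of g
    u h in f is one up to the coboundary of f{g,h}, by [dif_brace2]. *)
Lemma bracket_cup i j l f g h : Zcocycle i f -> Zcocycle j g -> Zcocycle l h ->
  HHcls AA (i + (j + l) - 1) (brk (odd `|i|%N) (odd `|(j + l)%R|%N) f (cup g h)) =
  HHcls AA (i + (j + l) - 1) (cup (brk (odd `|i|%N) (odd `|j|%N) f g) h)
  + sgn (j * (i - 1)) *:
    HHcls AA (i + (j + l) - 1) (cup g (brk (odd `|i|%N) (odd `|l|%N) f h)).
Proof.
move=> fz gz hz.
have z1 := HHcocycle_brk fz (HHcocycle_cup gz hz).
have z2 := HHcocycle_cup (HHcocycle_brk fz gz) hz.
rewrite (_ : i + j - 1 + l = i + (j + l) - 1) in z2; last by lia.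
have z3 := HHcocycle_cup gz (HHcocycle_brk fz hz).
rewrite (_ : j + (i + l - 1) = i + (j + l) - 1) in z3; last by lia.
rewrite [RHS]addrC -HHcls_linear //; apply/HHcls_eq => //; first exact: HHcocycle_lin.
have dh0 := HHcocycle_dif hz; have dg0 := HHcocycle_dif gz.
have df0 := HHcocycle_dif fz.
case: (fz) => fc _; case: (gz) => gc _; case: (hz) => hc _.
have fb := cochain_homog fc; have gb := cochain_homog gc; have hb := cochain_homog hc.
case: (fc) => fl fs; case: (gc) => gl gs; case: (hc) => hl hs.
set bi := odd `|i|%N in fb df0 *; set bj := odd `|j|%N in gb dg0 *.
set bl := odd `|l|%N in hb dh0 *.
pose w : seq A -> AA := brace2 (eps k bj * eps k bl) (eps k bl) g h f.
have wc : cochain (i + (j + l) - 1 - 1) w.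
  split; first exact: mlin_brace2.
  rewrite (_ : i + (j + l) - 1 - 1 = i + j + l - 2); last by lia.
  exact: supp_brace2.
(* The sign with which the insertion of g u h in f occurs in the bracket,
   corrected by that of dif_brace2. *)
pose c : k := (-1) ^+ (~~ bi && ~~ (bj (+) bl)) * (eps k bj * eps k bl).
exists (c *: w).
  by have := is_cochainP c wc (is_cochain0 _ _); rewrite addr0.
rewrite -[c *: _]addr0 hoch_d_linear (HHcocycle0 _ 0).2 addr0 (hoch_d_cochain wc).
apply/funext => s; rewrite !fctE odd_absD -/bj -/bl.
have -> : odd `|(i + (j + l) - 1 - 1)%R|%N = bi (+) bj (+) bl.
  by rewrite !odd_abs_pred !odd_absD negbK addbA.
rewrite /w dif_brace2 // brkE eps_cup (brace_cup _ _ _ (epsK _ _) gb) /brk sgnM odd_abs_pred -/bi -/bj.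
have cl c' u u' v : cup (fun t => c' *: u t - u' t) v s = c' *: cup u v s - cup u' v s.
  have -> : (fun t => c' *: u t - u' t) = (fun t => -1 *: u' t + (c' *: u t + 0)).
    by apply/funext => t; rewrite addr0 scaleN1r addrC.
  by rewrite !cupPl cup0l; lin.
have cr c' u u' v : cup v (fun t => c' *: u t - u' t) s = c' *: cup v u s - cup v u' s.
  have -> : (fun t => c' *: u t - u' t) = (fun t => -1 *: u' t + (c' *: u t + 0)).
    by apply/funext => t; rewrite addr0 scaleN1r addrC.
  by rewrite !cupPr cup0r; lin.
rewrite cl cr /c.
by case: (bi); case: (bj); case: (bl); rewrite /eps /= ?expr0 ?expr1; lin.
Qed.

Lemma cup_one_l f : cup (@one_cochain k A) f = f.
Proof.
apply/funext => s; rewrite /cup (deconc_take (m := 0)) ?take0 ?drop0 ?mul1r //.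
by case=> //= *; rewrite mul0r.
Qed.

Lemma cup_one_r f : cup f (@one_cochain k A) = f.
Proof.
apply/funext => s; rewrite /cup -[RHS](deconc_nilr f); apply: eq_deconc => u v.
by case: v => *; rewrite ?mulr1 ?mulr0.
Qed.

Lemma HHcocycle_one : Zcocycle 0 (@one_cochain k A).
Proof.
have oc : cochain 0 (@one_cochain k A).
  by split=> [[|x s] t c a b|[|x s]] //=; lin.
split=> //; rewrite (hoch_d_cochain oc); apply/funext => -[|a s].
  by rewrite difE cup_idr0 cup_idl bar_nil; [rewrite scaler0 addr0 subr0 | case: oc].
rewrite difE cup_one_l cup_one_r /=.
have -> : bar (@one_cochain k A) (a :: s) = 0.
  have [ol _] := oc; rewrite (@bar_contract k A AA) // big1 // => i _; rewrite /contract.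
  by case: (take i _) => *; rewrite scaler0.
by rewrite /eps /= expr1 scaleN1r addNr subr0.
Qed.

Lemma HH_gerstenhaber :
  gerstenhaber_algebra (G := HH AA) (HHone A) (@HHcup k A) (@HHbracket k A).
Proof.
split; [split|..].
- split=> [i j c a a' b | i j c a b b'].
    have [f fz ->] := HHindex a; have [f' fz' ->] := HHindex a'; have [g gz ->] := HHindex b.
    rewrite -HHcls_linear // !HHcup_cls //; last exact: HHcocycle_lin.
    rewrite -HHcls_linear; try exact: HHcocycle_cup.
    by congr (HHcls _ _ _); apply/funext => s; apply: cupPl.
  have [f fz ->] := HHindex a; have [g gz ->] := HHindex b; have [g' gz' ->] := HHindex b'.
  rewrite -HHcls_linear // !HHcup_cls //; last exact: HHcocycle_lin.
  rewrite -HHcls_linear; try exact: HHcocycle_cup.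
  by congr (HHcls _ _ _); apply/funext => s; apply: cupPr.
- move=> i j l a b c.
  have [f fz ->] := HHindex a; have [g gz ->] := HHindex b; have [h hz ->] := HHindex c.
  rewrite !HHcup_cls //; try exact: HHcocycle_cup.
  by rewrite HHcls_regrade; congr (HHcls _ _ _); apply/funext => s; rewrite cup_assoc.
- move=> i a; have [f fz ->] := HHindex a.
  by rewrite HHcup_cls ?HHcls_regrade ?cup_one_l //; apply: HHcocycle_one.
- move=> i a; have [f fz ->] := HHindex a.
  by rewrite HHcup_cls ?HHcls_regrade ?cup_one_r //; apply: HHcocycle_one.
- move=> i j a b; have [f fz ->] := HHindex a; have [g gz ->] := HHindex b.
  by rewrite !HHcup_cls // HHcls_regrade; apply: cup_commutes.
- split=> [i j c a a' b | i j c a b b'].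
    have [f fz ->] := HHindex a; have [f' fz' ->] := HHindex a'; have [g gz ->] := HHindex b.
    rewrite -HHcls_linear // !HHbracket_cls //; last exact: HHcocycle_lin.
    rewrite -HHcls_linear; try exact: HHcocycle_brk.
    congr (HHcls _ _ _); apply/funext => s; rewrite !fctE !brkE.
    rewrite brace_fun; last by case: gz => -[].
    by rewrite braceP; lin.
  have [f fz ->] := HHindex a; have [g gz ->] := HHindex b; have [g' gz' ->] := HHindex b'.
  rewrite -HHcls_linear // !HHbracket_cls //; last exact: HHcocycle_lin.
  rewrite -HHcls_linear; try exact: HHcocycle_brk.
  congr (HHcls _ _ _); apply/funext => s; rewrite !fctE !brkE.
  rewrite brace_fun; last by case: fz => -[].
  by rewrite braceP; lin.
- move=> i j a b; have [f fz ->] := HHindex a; have [g gz ->] := HHindex b.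
  rewrite !HHbracket_cls // HHcls_regrade.
  have gfz := HHcocycle_brk gz fz; rewrite (addrC j) in gfz.
  rewrite -HHclsZ // -HHclsN; last exact: HHcocycleZ.
  congr (HHcls _ _ _); apply/funext => s; rewrite !fctE !brkE sgnM !odd_abs_pred.
  by case: (odd _); case: (odd _); rewrite /= ?expr0 ?expr1; lin.
- move=> i j l a b c.
  have [f fz ->] := HHindex a; have [g gz ->] := HHindex b; have [h hz ->] := HHindex c.
  rewrite !HHbracket_cls //; try exact: HHcocycle_brk.
  rewrite !HHcls_regrade.
  have z1 := HHcocycle_brk (HHcocycle_brk fz gz) hz.
  have z2 := HHcocycle_brk gz (HHcocycle_brk fz hz).
  rewrite (deg_brA i j l) in z1; rewrite (deg_brCA i j l) in z2.
  rewrite [RHS]addrC -HHcls_linear //; congr (HHcls _ _ _); apply/funext => s; rewrite !fctE.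
  have o x y : odd `|(x + y - 1)%R|%N = odd `|x|%N (+) ~~ odd `|y|%N by lia.
  rewrite !o brk_jacobi; try by [case: fz => -[] | case: gz => -[] | case: hz => -[]].
  - by rewrite sgnM !odd_abs_pred addrC.
  - by case: fz => /cochain_homog.
  - by case: gz => /cochain_homog.
  - by case: hz => /cochain_homog.
- move=> i j l a b c.
  have [f fz ->] := HHindex a; have [g gz ->] := HHindex b; have [h hz ->] := HHindex c.
  have fgz := HHcocycle_brk fz gz; have fhz := HHcocycle_brk fz hz.
  have ghz := HHcocycle_cup gz hz.
  rewrite (HHcup_cls gz hz) (HHbracket_cls fz ghz) (HHbracket_cls fz gz).
  rewrite (HHbracket_cls fz hz) (HHcup_cls fgz hz) (HHcup_cls gz fhz) !HHcls_regrade.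
  exact: bracket_cup.
Qed.

End GerstenhaberAlgebra.

(** * The Batalin-Vilkovisky algebra *)

Section InducedClasses.
Variables (k : comPzRingType) (A : algType k) (M N : bimodule A) (phi : M -> N).
Hypotheses (pl : linear phi) (pL : forall a x, phi (lact M a x) = lact N a (phi x))
  (pR : forall x a, phi (ract M x a) = ract N (phi x) a).

Lemma is_cochain_comp i (f : seq A -> M) : is_cochain i f -> is_cochain i (phi \o f).
Proof. by move=> [fl fs]; split; [apply: (mlin_comp pl) | apply: (supp_comp pl)]. Qed.

Lemma HHcocycle_comp i (f : seq A -> M) : HHcocycle i f -> HHcocycle i (phi \o f).
Proof.
move=> [fc df]; split; first exact: is_cochain_comp.
rewrite (hoch_d_comp pl pL pR) ?df; last by case: fc.
have p0 : phi 0 = 0 := linear_map0 pl.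
by apply/funext => s /=; rewrite p0.
Qed.

Lemma comp_linear c (f g : seq A -> M) : phi \o (c *: f + g) = c *: (phi \o f) + (phi \o g).
Proof. by apply/funext => s; rewrite /= pl. Qed.

Lemma HHmap_cls i (f : seq A -> M) : HHcocycle i f ->
  HHmap phi (HHcls M i f) = HHcls N i (phi \o f).
Proof.
move=> fz; rewrite /HHmap; have [y yc E] := HHcls_rep fz.
apply/HHcls_eq; [exact: HHcocycle_comp (HHrepP _) | exact: HHcocycle_comp |].
exists (phi \o y); first exact: is_cochain_comp.
rewrite (hoch_d_comp pl pL pR); last by case: yc.
have Es s : rep (HHcls M i f) s = 1 *: f s + hoch_d y s by rewrite E scale1r.
apply/funext => s; rewrite -[LHS]/(phi (rep (HHcls M i f) s) - phi (f s)).
by rewrite Es pl scale1r [X in X - _]addrC addrK.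
Qed.

End InducedClasses.

Section SymmetricClasses.
Variables (k : comPzRingType) (A : algType k).
Local Notation AA := (regular_bimod A).
Local Notation D := (dual_bimod A).
Variables (Theta : AA -> D) (Psi : D -> AA).
Hypotheses (Tl : linear Theta) (TL : forall a x, Theta (lact AA a x) = lact D a (Theta x))
  (TR : forall x a, Theta (ract AA x a) = ract D (Theta x) a)
  (TK : cancel Theta Psi) (PK : cancel Psi Theta).
Let Pl : linear Psi := Psi_linear Tl TK PK.
Let PL := Psi_lact TL TK PK.
Let PR := Psi_ract TR TK PK.
Local Notation Delta := (Delta Theta Psi).

Let T0 : Theta 0 = 0 := linear_map0 Tl.

Let PKf (F : seq A -> D) : Theta \o (Psi \o F) = F.
Proof. by apply/funext => s; rewrite /= PK. Qed.
Let TKf (f : seq A -> AA) : Psi \o (Theta \o f) = f.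
Proof. by apply/funext => s; rewrite /= TK. Qed.

Let Tz i (f : seq A -> AA) : HHcocycle i f -> HHcocycle i (Theta \o f).
Proof. exact: HHcocycle_comp. Qed.
Let Pz i (F : seq A -> D) : HHcocycle i F -> HHcocycle i (Psi \o F).
Proof. exact: HHcocycle_comp. Qed.

Lemma HHmap_bij i : bijective (@HHmap _ _ _ _ Theta i).
Proof.
exists (@HHmap _ _ _ _ Psi i) => x; have [f fz ->] := HHindex x.
  by rewrite !(HHmap_cls Tl TL TR, HHmap_cls Pl PL PR) ?TKf //; apply: Tz.
by rewrite !(HHmap_cls Tl TL TR, HHmap_cls Pl PL PR) ?PKf //; apply: Pz.
Qed.

Lemma HHmap_invK i (x : HH AA i) : HHmap_inv Theta (HHmap Theta x) = x.
Proof.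
apply: (@pinvKV _ _ _ setT (@HHmap _ _ _ _ Theta i)); last by rewrite inE.
by move=> u v _ _; apply: (bij_inj (HHmap_bij i)).
Qed.

Lemma HHmap_inv_cls i (F : seq A -> D) : HHcocycle i F ->
  HHmap_inv Theta (HHcls D i F) = HHcls AA i (Psi \o F).
Proof.
by move=> Fz; rewrite -{1}(PKf F) -(HHmap_cls Tl TL TR) ?HHmap_invK //; apply: Pz.
Qed.

Lemma normalized_comp (M N : bimodule A) (phi : M -> N) (f : seq A -> M) :
  linear phi -> normalized f -> normalized (phi \o f).
Proof.
move=> pl fn s s1; rewrite /= fn //.
exact: linear_map0 pl.
Qed.

(** [normalization] transported along Theta. *)
Lemma dual_normalization i (F : seq A -> D) : is_cochain i F -> normalized (hoch_d F) ->
  exists2 y : seq A -> D, is_cochain (i - 1) y & normalized (F - hoch_d y).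
Proof.
move=> Fc Fn; have [fl fs] := is_cochain_comp Pl Fc.
have [|y [yl ys yn]] := normalization fl fs.
  rewrite (hoch_d_comp Pl PL PR); last by case: Fc.
  exact: normalized_comp Pl Fn.
exists (Theta \o y); first exact: (is_cochain_comp Tl).
rewrite (hoch_d_comp Tl TL TR yl) -{1}(PKf F).
have -> : (Theta \o (Psi \o F)) - (Theta \o hoch_d y) =
     Theta \o ((Psi \o F) - hoch_d y).
  have := comp_linear Tl (-1) (hoch_d y) (Psi \o F).
  by rewrite !scaleN1r ![- _ + _]addrC => ->.
exact: normalized_comp.
Qed.

Lemma is_cochain_connesB i (F : seq A -> D) : is_cochain i F -> is_cochain (i - 1) (connesB F).
Proof. by move=> [Fl Fs]; split; [apply: mlin_connesB | apply: supp_connesB]. Qed.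

Lemma hoch_d_connesB i (F : seq A -> D) : is_cochain i F ->
  hoch_d (connesB F) = - connesB (hoch_d F).
Proof.
move=> Fc; have [fl fs] := is_cochain_comp Pl Fc.
rewrite -{1}(PKf F) -(Theta_Delta PK (Psi \o F)).
rewrite (hoch_d_comp Tl TL TR (mlin_Delta Tl TK PK fl)).
rewrite (hoch_d_Delta Tl TL TR TK PK fl fs) (hoch_d_comp Pl PL PR); last by case: Fc.
apply/funext => s; rewrite /= -scaleN1r -[_ *: _]addr0 Tl.
by rewrite T0 addr0 scaleN1r /Delta /= PK PKf.
Qed.

Lemma connesB_0 : connesB (0 : seq A -> D) = 0.
Proof.
have := connesB_linear (-1) (@multilinear0 k A) (@multilinear0 k A).
by rewrite scaler0 addr0 scaleN1r addNr.
Qed.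

Lemma HHcocycle_connesB i (F : seq A -> D) : HHcocycle i F -> HHcocycle (i - 1) (connesB F).
Proof.
move=> [Fc dF]; split; first exact: is_cochain_connesB.
by rewrite (hoch_d_connesB Fc) dF connesB_0 oppr0.
Qed.

(** A cocycle has the normalized differential 0, so that
    [dual_normalization] applies. *)
Lemma nrep_exists i (x : HH D i) : exists f : seq A -> D,
  [/\ normalized f, HHcocycle i f & HHcls D i f = x].
Proof.
have [F Fz ->] := HHindex x; case: (Fz) => Fc dF.
have [|y yc yn] := dual_normalization Fc; first by rewrite dF.
have dyc : is_cochain i (hoch_d y).
  have := is_cochain_comp Tl (is_cochain_d1 (is_cochain_comp Pl yc)).
  by rewrite -(hoch_d_comp Tl TL TR) ?PKf //; case: (is_cochain_comp Pl yc).
have ddy : hoch_d (hoch_d y) = 0.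
  have [pl ps] := is_cochain_comp Pl yc.
  rewrite -(PKf y) (hoch_d_comp Tl TL TR pl) (hoch_d_comp Tl TL TR (mlin_hoch_d pl ps)).
  by rewrite (hoch_d_hoch_d pl ps); apply/funext => s /=; rewrite T0.
have dyz : HHcocycle i (hoch_d y) by split.
exists (F - hoch_d y); split=> //.
  by rewrite addrC -scaleN1r; apply: HHcocycle_lin.
apply/HHcls_eq => //; first by rewrite addrC -scaleN1r; apply: HHcocycle_lin.
exists (-1 *: y + 0); first by apply: is_cochainP => //; apply: is_cochain0.
by rewrite hoch_d_linear (HHcocycle0 _ 0).2 addr0 scaleN1r addrC addrA addNr add0r.
Qed.

Lemma nrepP i (x : HH D i) : [/\ normalized (nrep x), HHcocycle i (nrep x) &
  HHcls D i (nrep x) = x].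
Proof. exact: (xgetPex 0 (nrep_exists x)). Qed.

Lemma HHconnes_cls i (F : seq A -> D) : HHcocycle i F ->
  HHconnes (HHcls D i F) = HHcls D (i - 1) (connesB F).
Proof.
move=> Fz; rewrite /HHconnes; have [_ Gz] := nrepP (HHcls D i F).
move: (nrep _) Gz => G Gz /(HHcls_eq Gz Fz)[y yc E].
apply/HHcls_eq; [exact: HHcocycle_connesB | exact: HHcocycle_connesB |].
exists (-1 *: connesB y + 0).
  by apply: is_cochainP; [apply: is_cochain_connesB | apply: is_cochain0].
rewrite hoch_d_linear (HHcocycle0 _ 0).2 addr0 scaleN1r (hoch_d_connesB yc) opprK -E.
rewrite [G - F]addrC -[- F]scaleN1r connesB_linear; [| by case: Fz => -[] | by case: Gz => -[]].
by rewrite scaleN1r addrC.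
Qed.

Lemma HHcocycle_Delta i (f : seq A -> AA) : HHcocycle i f -> HHcocycle (i - 1) (Delta f).
Proof. by move=> fz; apply/Pz/HHcocycle_connesB/Tz. Qed.

Lemma HHdelta_cls i (f : seq A -> AA) : HHcocycle i f ->
  HHdelta Theta (HHcls AA i f) = HHcls AA (i - 1) (Delta f).
Proof.
move=> fz; rewrite /HHdelta (HHmap_cls Tl TL TR) // HHconnes_cls; last exact: Tz.
by rewrite HHmap_inv_cls //; apply/HHcocycle_connesB/Tz.
Qed.

(** [bracket_homotopic] in cohomology, with g u Delta f rewritten as Delta
    f u g. *)
Lemma bracket_Delta i j (f g : seq A -> AA) : HHcocycle i f -> HHcocycle j g ->
  HHcls AA (i + j - 1) (brk (odd `|i|%N) (odd `|j|%N) f g) =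
  sgn i *: (HHcls AA (i + j - 1) (Delta (cup f g))
    - HHcls AA (i + j - 1) (cup (Delta f) g)
    - sgn i *: HHcls AA (i + j - 1) (cup f (Delta g))).
Proof.
move=> fz gz; have bz := HHcocycle_brk fz gz.
have z1 := HHcocycle_Delta (HHcocycle_cup fz gz).
have z2 := HHcocycle_cup (HHcocycle_Delta fz) gz; rewrite deg_B_cup in z2.
have z3 := HHcocycle_cup fz (HHcocycle_Delta gz); rewrite deg_cup_B in z3.
have z4 := HHcocycle_cup gz (HHcocycle_Delta fz).
rewrite (_ : j + (i - 1) = i + j - 1) in z4; last by lia.
have E : HHcls AA (i + j - 1) (cup g (Delta f)) =
   sgn (j * (i - 1)) *: HHcls AA (i + j - 1) (cup (Delta f) g).
  have := cup_commutes gz (HHcocycle_Delta fz).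
  by rewrite (_ : j + (i - 1) = i + j - 1) //; lia.
have -> : HHcls AA (i + j - 1) (brk (odd `|i|%N) (odd `|j|%N) f g) =
   sgn ((i - 1) * (j - 1)) *: HHcls AA (i + j - 1) (cup g (Delta f))
   - HHcls AA (i + j - 1) (cup f (Delta g))
   + sgn i *: HHcls AA (i + j - 1) (Delta (cup f g)).
  have y3 : HHcocycle (i + j - 1) (-1 *: (cup f (Delta g) : seq A -> AA)
      + (sgn i : k) *: Delta (cup f g)).
    by apply: HHcocycle_lin => //; apply: HHcocycleZ.
  transitivity (sgn ((i - 1) * (j - 1)) *: HHcls AA (i + j - 1) (cup g (Delta f))
     + (-1 *: HHcls AA (i + j - 1) (cup f (Delta g))
        + sgn i *: HHcls AA (i + j - 1) (Delta (cup f g)))); last by lin.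
  rewrite -(HHclsZ (sgn i) z1) -(HHcls_linear (-1) z3 (HHcocycleZ (sgn i) z1)).
  rewrite -(HHcls_linear _ z4 y3).
  case: (fz) => -[fl fs] df; case: (gz) => -[gl gs] dg.
  (* The coboundary of the homotopy identifies the two sides. *)
  have [y [yl ys Ey]] := bracket_homotopic Tl TL TR TK PK fl gl fs gs df dg.
  apply/HHcls_eq => //; first exact: HHcocycle_lin.
  exists y; first by split=> //; rewrite (_ : i + j - 1 - 1 = i + j - 2) //; lia.
  by rewrite Ey; lin.
rewrite E !sgnM !odd_abs_pred sgnE.
by case: (odd _); case: (odd _); rewrite /= ?expr0 ?expr1; lin.
Qed.

(** The square of Delta is computed on the image of a normalized
    representative, where [connesB_connesB] applies. *)
Lemma HH_BV : BV_algebra (G := HH AA) (HHone A)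
  (@HHcup k A) (@HHbracket k A) (@HHdelta k A Theta).
Proof.
split; first exact: HH_gerstenhaber.
- move=> i c a a'; have [f fz ->] := HHindex a; have [f' fz' ->] := HHindex a'.
  rewrite -HHcls_linear // !HHdelta_cls //; last exact: HHcocycle_lin.
  rewrite -HHcls_linear; try exact: HHcocycle_Delta.
  have fl : multilinear (Theta \o f) by case: (Tz fz) => -[].
  have fl' : multilinear (Theta \o f') by case: (Tz fz') => -[].
  by rewrite /Delta (comp_linear Tl) (connesB_linear c fl fl') (comp_linear Pl).
- move=> i a; have [F [Fn Fz E]] : exists F : seq A -> D,
    [/\ normalized F, HHcocycle i F & HHcls D i F = HHmap Theta a] := nrep_exists _.
  have -> : a = HHcls AA i (Psi \o F).
    by rewrite -(HHmap_inv_cls Fz) E HHmap_invK.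
  rewrite (HHdelta_cls (Pz Fz)) (HHdelta_cls (HHcocycle_Delta (Pz Fz))).
  rewrite /Delta !PKf connesB_connesB //; last by case: Fz => -[].
  rewrite (_ : Psi \o 0 = 0) ?HHcls0 //; apply/funext => s /=.
  by rewrite -[RHS]TK T0.
- move=> i j a b; have [f fz ->] := HHindex a; have [g gz ->] := HHindex b.
  rewrite HHbracket_cls // (HHcup_cls fz gz) !HHdelta_cls //; last exact: HHcocycle_cup.
  rewrite (HHcup_cls (HHcocycle_Delta fz) gz) (HHcup_cls fz (HHcocycle_Delta gz)).
  by rewrite !HHcls_regrade bracket_Delta.
Qed.

End SymmetricClasses.

(** * Cyclic cohomology *)

Section CyclicClasses.
Variables (k : comPzRingType) (A : algType k).
Local Notation D := (dual_bimod A).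
Implicit Types c : nat -> seq A -> D.

Lemma HCrepP n (h : HC A n) : HCcocycle n (rep h : nat -> seq A -> D).
Proof. exact: (elimT (@cocycleP k (cyclic_complex A) n _) (rep_cocycle h)). Qed.

Lemma HCindex n (h : HC A n) : exists2 c, HCcocycle n c & h = HCcls n c.
Proof. by exists (rep h); [apply: HCrepP | rewrite /HCcls clsK]. Qed.

Lemma HCcocycleP n c : HCcocycle n c ->
  (c : cpx_ambient (cyclic_complex A)) \in @cocycle k (cyclic_complex A) n.
Proof. exact: (introT (@cocycleP k (cyclic_complex A) n c)). Qed.

Lemma HCcls_eq n c c' : HCcocycle n c -> HCcocycle n c' ->
  HCcls n c = HCcls n c' <-> exists2 z, is_tot (n - 1) z & c - c' = tot_d z.
Proof. by move=> /HCcocycleP cz /HCcocycleP cz'; apply: (cls_eq cz cz'). Qed.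

Lemma HCcls_linear n e c c' : HCcocycle n c -> HCcocycle n c' ->
  HCcls n (e *: c + c') = e *: HCcls n c + HCcls n c'.
Proof. by move=> /HCcocycleP cz /HCcocycleP cz'; apply: (cls_linear e cz cz'). Qed.

End CyclicClasses.

Section SymmetricCyclic.
Variables (k : comPzRingType) (A : algType k).
Local Notation AA := (regular_bimod A).
Local Notation D := (dual_bimod A).
Variables (Theta : AA -> D) (Psi : D -> AA).
Hypotheses (Tl : linear Theta) (TL : forall a x, Theta (lact AA a x) = lact D a (Theta x))
  (TR : forall x a, Theta (ract AA x a) = ract D (Theta x) a)
  (TK : cancel Theta Psi) (PK : cancel Psi Theta).
Local Notation Delta := (Delta Theta Psi).
Let Pl : linear Psi := Psi_linear Tl TK PK.
Let PL := Psi_lact TL TK PK.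
Let PR := Psi_ract TR TK PK.
Let PKf (F : seq A -> D) : Theta \o (Psi \o F) = F.
Proof. by apply/funext => s; rewrite /= PK. Qed.
Let Tz i (f : seq A -> AA) : HHcocycle i f -> HHcocycle i (Theta \o f).
Proof. exact: HHcocycle_comp. Qed.
Let Pz i (F : seq A -> D) : HHcocycle i F -> HHcocycle i (Psi \o F).
Proof. exact: HHcocycle_comp. Qed.

Lemma is_tot_incl n (F : seq A -> D) : is_cochain n F -> normalized F -> is_tot n (tot_incl F).
Proof.
move=> Fc Fn; split; last by exists 1%N => -[].
case=> [|i] /=; first by rewrite addr0.
by split; [apply: is_cochain0 |].
Qed.

Lemma tot_d_incl (F : seq A -> D) : tot_d (tot_incl F) = tot_incl (hoch_d F).
Proof.
apply/funext => -[|i]; rewrite /tot_d /= connesB_0 addr0 //.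
exact: (HHcocycle0 D 0).2.
Qed.

Lemma HCcocycle_incl n (F : seq A -> D) : HHcocycle n F -> normalized F ->
  HCcocycle n (tot_incl F).
Proof.
move=> [Fc dF] Fn; split; first exact: is_tot_incl.
by rewrite tot_d_incl dF; apply/funext => -[].
Qed.

(** Two normalized representatives of a class differ by the differential
    of a cochain y. Since dy is normalized, y may be replaced by a
    normalized cochain with the same differential, which gives a
    coboundary of the cyclic complex. *)
Lemma HCI_cls n (F : seq A -> D) : HHcocycle n F -> normalized F ->
  HCI (HHcls D n F) = HCcls n (tot_incl F).
Proof.
move=> Fz Fn; rewrite /HCI.
have [Gn Gz E] := nrepP Tl TL TR TK PK (HHcls D n F); move: (nrep _) Gn Gz E => G Gn Gz.
move=> /(HHcls_eq Gz Fz)[y yc E].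
have GFn : normalized (hoch_d y) by rewrite -E => s s1; rewrite !fctE Gn ?Fn ?subr0.
have [z zc zn] := dual_normalization Tl TL TR TK PK yc GFn.
have [pl ps] := is_cochain_comp Pl zc.
have dzc : is_cochain (n - 1) (hoch_d z).
  have := is_cochain_comp Tl (is_cochain_d1 (is_cochain_comp Pl zc)).
  by rewrite -(hoch_d_comp Tl TL TR pl) PKf.
have ddz : hoch_d (hoch_d z) = 0.
  rewrite -(PKf z) (hoch_d_comp Tl TL TR pl) (hoch_d_comp Tl TL TR (mlin_hoch_d pl ps)).
  rewrite (hoch_d_hoch_d pl ps); apply/funext => s /=.
  have T0 : Theta 0 = 0 := linear_map0 Tl.
  exact: T0.
have yzE : y - hoch_d z = -1 *: hoch_d z + y by rewrite scaleN1r addrC.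
apply/HCcls_eq; [exact: HCcocycle_incl | exact: HCcocycle_incl |].
exists (tot_incl (y - hoch_d z)).
  by apply: is_tot_incl => //; rewrite yzE; apply: is_cochainP.
rewrite tot_d_incl yzE hoch_d_linear ddz scaler0 add0r -E.
by apply/funext => -[|i] //=; rewrite -[LHS]/(0 - 0) subr0.
Qed.

Lemma HCI_linear n c (x y : HH D n) : HCI (c *: x + y) = c *: HCI x + HCI y.
Proof.
have [F [Fn Fz <-]] := nrep_exists Tl TL TR TK PK x.
have [G [Gn Gz <-]] := nrep_exists Tl TL TR TK PK y.
have FGn : normalized (c *: F + G).
  by move=> s s1; rewrite !fctE Fn ?Gn // scaler0 addr0.
rewrite -HHcls_linear // !HCI_cls //; last exact: HHcocycle_lin.
rewrite -HCcls_linear; try exact: HCcocycle_incl.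
by congr HCcls; apply/funext => -[|i] //=; rewrite -[RHS]/(c *: 0 + 0) scaler0 addr0.
Qed.

(** The first equation of a cyclic cocycle is d c_0 = - B c_1, so B c_0 is
    a cocycle as d B c_0 = - B d c_0 = B B c_1 = 0. *)
Lemma HCcocycle0th n c : HCcocycle n c -> [/\ is_cochain n (c 0%N : seq A -> D),
  normalized (c 0%N) & HHcocycle (n - 1) (connesB (c 0%N))].
Proof.
move=> [[cn _] dc]; have [c0 n0] := cn 0%N; rewrite addr0 in c0; split=> //.
split; first exact: is_cochain_connesB.
rewrite (hoch_d_connesB Tl TL TR TK PK c0).
have /(congr1 (fun u => u 0%N)) := dc; rewrite /tot_d => E.
have -> : hoch_d (c 0%N) = -1 *: connesB (c 1%N) + 0.
  by rewrite addr0 scaleN1r; apply/eqP; rewrite -addr_eq0; apply/eqP.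
have [[l1 s1] n1] := cn 1%N.
rewrite connesB_linear; [|exact: mlin_connesB|exact: multilinear0].
by rewrite connesB_connesB // connesB_0 scaler0 addr0 oppr0.
Qed.

Lemma HCpartial_cls n c : HCcocycle n c ->
  HCpartial (HCcls n c) = HHcls D (n - 1) (connesB (c 0%N)).
Proof.
move=> cz; rewrite /HCpartial.
have rz := HCrepP (HCcls n c).
have /(HCcls_eq rz cz)[z [zn _] E] : HCcls n (rep (HCcls n c)) = HCcls n c by rewrite /HCcls clsK.
have [_ _ z1] := HCcocycle0th rz; have [[cl _] _ z2] := HCcocycle0th cz.
have [z0c z0n] := zn 0%N; have [[z1l _] z1n] := zn 1%N.
rewrite addr0 in z0c.
move: (@rep k (cyclic_complex A) n (HCcls n c)) E z1 rz => r E rz1 rz.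
have [[rl _] _ _] := HCcocycle0th rz.
apply/HHcls_eq => //; exists (-1 *: connesB (z 0%N) + 0).
  by apply: is_cochainP; [apply: is_cochain_connesB | apply: is_cochain0].
rewrite hoch_d_linear (HHcocycle0 _ 0).2 addr0 scaleN1r.
rewrite (hoch_d_connesB Tl TL TR TK PK z0c) opprK.
have /(congr1 (fun u => u 0%N)) := E; rewrite /tot_d -[LHS]/(r 0%N - c 0%N) => E0.
have -> : hoch_d (z 0%N) = -1 *: connesB (z 1%N) + (-1 *: c 0%N + r 0%N).
  by rewrite [-1 *: c 0%N]scaleN1r [- c 0%N + _]addrC E0 scaleN1r addrC addrK.
have l1 := mlin_connesB z1l.
have l2 : multilinear (-1 *: c 0%N + r 0%N) by apply: mlin_comb.
rewrite (connesB_linear (-1) l1 l2) connesB_connesB // scaler0 add0r.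
by rewrite (connesB_linear (-1) cl rl) scaleN1r addrC.
Qed.

(** In the cyclic complex, (B F, 0, 0, ...) is the differential of (0, F,
    0, ...) for a cocycle F. *)
Lemma HCI_connes n (x : HH D n) : HCI (HHconnes x) = 0.
Proof.
have [F [Fn Fz <-]] := nrep_exists Tl TL TR TK PK x.
have [[Fl Fs] dF] := Fz.
have Bz := HHcocycle_connesB Tl TL TR TK PK Fz.
rewrite (HHconnes_cls Tl TL TR TK PK Fz) HCI_cls //; last exact: normalized_connesB.
have Z0 : HCcocycle (n - 1) (0 : nat -> seq A -> D).
  split; first exact: is_tot0.
  apply/funext => i; rewrite /tot_d -[X in hoch_d X]/(0 : seq A -> D).
  by rewrite -[X in connesB X]/(0 : seq A -> D) connesB_0 (HHcocycle0 D 0).2 addr0.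
transitivity (HCcls (n - 1) (0 : nat -> seq A -> D)); last first.
  have := HCcls_linear (-1) Z0 Z0; rewrite scaler0 addr0 => ->; lin.
apply/HCcls_eq => //; first by apply: HCcocycle_incl => //; apply: normalized_connesB.
exists (fun i => if i is 1%N then F else 0).
  split; last by exists 2%N => -[|[|i]].
  case=> [|[|i]]; [| |]; try by split; [apply: is_cochain0 |].
  by rewrite (_ : n - 1 - 1 + (2 * 1)%:Z = n) //; lia.
rewrite subr0; apply/funext => -[|[|i]]; rewrite /tot_d /=.
- by rewrite (HHcocycle0 D 0).2 add0r.
- by rewrite dF connesB_0 addr0.
- by rewrite (HHcocycle0 D 0).2 connesB_0 addr0.
Qed.

End SymmetricCyclic.

(** * The Lie bracket on cyclic cohomology *)

Lemma regradeZ (k : comPzRingType) (G : int -> lmodType k) i j (e : i = j) c (x : G i) :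
  regrade G e (c *: x) = c *: regrade G e x.
Proof. by case: j / e. Qed.

Section CyclicLie.
Variables (k : comPzRingType) (A : algType k).
Local Notation AA := (regular_bimod A).
Local Notation D := (dual_bimod A).
Variables (Theta : AA -> D) (Psi : D -> AA).
Hypotheses (Tl : linear Theta) (TL : forall a x, Theta (lact AA a x) = lact D a (Theta x))
  (TR : forall x a, Theta (ract AA x a) = ract D (Theta x) a)
  (TK : cancel Theta Psi) (PK : cancel Psi Theta).
Local Notation Delta := (Delta Theta Psi).
Let Pl : linear Psi := Psi_linear Tl TK PK.
Let PL := Psi_lact TL TK PK.
Let PR := Psi_ract TR TK PK.
Let PKf (F : seq A -> D) : Theta \o (Psi \o F) = F.
Proof. by apply/funext => s; rewrite /= PK. Qed.
Let TKf (f : seq A -> AA) : Psi \o (Theta \o f) = f.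
Proof. by apply/funext => s; rewrite /= TK. Qed.
Let Tz i (f : seq A -> AA) : HHcocycle i f -> HHcocycle i (Theta \o f).
Proof. exact: HHcocycle_comp. Qed.
Let Pz i (F : seq A -> D) : HHcocycle i F -> HHcocycle i (Psi \o F).
Proof. exact: HHcocycle_comp. Qed.
Implicit Types f g h u v : seq A -> AA.

(** The map I, as a map from cochains with values in A. *)
Definition to_cyclic n u : HC A n := HCI (HHcls D n (Theta \o u)).

Lemma to_cyclic_eq n u v : HHcocycle n u -> HHcocycle n v ->
  HHcls AA n u = HHcls AA n v -> to_cyclic n u = to_cyclic n v.
Proof.
by move=> uz vz E; rewrite /to_cyclic -(HHmap_cls Tl TL TR uz) -(HHmap_cls Tl TL TR vz) E.
Qed.

Lemma to_cyclic_linear n c u v : HHcocycle n u -> HHcocycle n v ->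
  to_cyclic n (c *: u + v) = c *: to_cyclic n u + to_cyclic n v.
Proof.
move=> uz vz; rewrite /to_cyclic (comp_linear Tl) HHcls_linear; try exact: Tz.
exact: (HCI_linear Tl TL TR TK PK).
Qed.

Lemma to_cyclic0 n : to_cyclic n 0 = 0.
Proof.
have z0 := HHcocycle0 AA n; have := to_cyclic_linear (-1) z0 z0.
by rewrite scaler0 addr0 => ->; lin.
Qed.

Lemma to_cyclicZ n c u : HHcocycle n u -> to_cyclic n (c *: u) = c *: to_cyclic n u.
Proof.
by move=> uz; have := to_cyclic_linear c uz (HHcocycle0 AA n); rewrite to_cyclic0 !addr0.
Qed.

Lemma to_cyclic_regrade i j (e : i = j) u : regrade (HC A) e (to_cyclic i u) = to_cyclic j u.
Proof. by case: j / e. Qed.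

(** Theta maps Delta u to the Connes operator on the image of u, and I
    vanishes on the image of the Connes coboundary ([HCI_connes]). *)
Lemma to_cyclic_Delta n u : HHcocycle n u -> to_cyclic (n - 1) (Delta u) = 0.
Proof.
move=> uz; rewrite /to_cyclic (Theta_Delta PK) -(HHconnes_cls Tl TL TR TK PK); last exact: Tz.
exact: (HCI_connes Tl TL TR TK PK).
Qed.

(** Brackets of cyclic classes depend only on cochains that represent
    their boundaries under Theta. *)
Definition has_boundary n (x : HC A n) f : Prop :=
  HHcocycle (n - 1) f /\ HCpartial x = HHcls D (n - 1) (Theta \o f).

(** The boundary of a class is represented by B c_0 with c_0 normalized,
    and BB = 0; so Delta of the representative vanishes as a cochain. *)
Lemma boundary_exists n (x : HC A n) : exists2 f, has_boundary x f & Delta f = 0.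
Proof.
have [c cz ->] := HCindex x.
have [[cl cs] cn bz] := HCcocycle0th Tl TL TR TK PK cz.
exists (Psi \o connesB (c 0%N)).
  by split; [apply: Pz | rewrite PKf (HCpartial_cls Tl TL TR TK PK)].
rewrite /Delta PKf connesB_connesB //; apply/funext => s /=.
have T0 : Theta 0 = 0 := linear_map0 Tl.
by rewrite -[RHS]TK T0.
Qed.

(** The map I sends the class of a normalized F to that of (F, 0, 0, ...),
    whose boundary is the class of B F. *)
Lemma boundary_to_cyclic n u : HHcocycle n u -> has_boundary (to_cyclic n u) (Delta u).
Proof.
move=> uz; split; first exact: (HHcocycle_Delta Tl TL TR TK PK).
rewrite (Theta_Delta PK) -(HHconnes_cls Tl TL TR TK PK); last exact: Tz.
rewrite /to_cyclic.
have [F [Fn Fz <-]] := nrep_exists Tl TL TR TK PK (HHcls D n (Theta \o u)).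
rewrite (HCI_cls Tl TL TR TK PK) // (HCpartial_cls Tl TL TR TK PK); last exact: HCcocycle_incl.
by rewrite (HHconnes_cls Tl TL TR TK PK).
Qed.

Lemma HCpartial_linear n c (x y : HC A n) :
  HCpartial (c *: x + y) = c *: HCpartial x + HCpartial y.
Proof.
have [u uz ->] := HCindex x; have [v vz ->] := HCindex y.
have [[ul _] _ bu] := HCcocycle0th Tl TL TR TK PK uz.
have [[vl _] _ bv] := HCcocycle0th Tl TL TR TK PK vz.
have uvz : HCcocycle n (c *: u + v).
  have [ut du] := uz; have [vt dv] := vz; split; first exact: is_totP.
  by rewrite (tot_d_linear c ut vt) du dv scaler0 addr0.
rewrite -(HCcls_linear c uz vz) (HCpartial_cls Tl TL TR TK PK uvz).
rewrite (HCpartial_cls Tl TL TR TK PK uz) (HCpartial_cls Tl TL TR TK PK vz).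
rewrite -(HHcls_linear c bu bv).
by congr HHcls; rewrite -[X in connesB X]/(c *: u 0%N + v 0%N) (connesB_linear c ul vl).
Qed.

Lemma boundary_linear n c (x y : HC A n) f g : has_boundary x f -> has_boundary y g ->
  has_boundary (c *: x + y) (c *: f + g).
Proof.
move=> [fz fx] [gz gy]; split; first exact: HHcocycle_lin.
by rewrite HCpartial_linear fx gy (comp_linear Tl) (HHcls_linear c (Tz fz) (Tz gz)).
Qed.

Lemma boundaryZ n c (x : HC A n) f : has_boundary x f -> has_boundary (c *: x) (c *: f).
Proof.
move=> [fz fx]; split; first exact: HHcocycleZ.
have := HCpartial_linear c x 0.
have p0 : HCpartial (0 : HC A n) = 0.
  have := HCpartial_linear (-1) (0 : HC A n) 0.
  by rewrite scaler0 addr0 => ->; lin.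
rewrite p0 !addr0 => ->; rewrite fx -HHclsZ; last exact: Tz.
have := comp_linear Tl c f (0 : seq A -> AA).
have -> : Theta \o (0 : seq A -> AA) = 0.
  apply/funext => s /=.
  have T0 : Theta 0 = 0 := linear_map0 Tl.
  exact: T0.
by rewrite !addr0 => ->.
Qed.

Lemma HCbracketE i j (x : HC A i) (y : HC A j) f g :
  has_boundary x f -> has_boundary y g ->
  HCbracket Theta x y = sgn i *: to_cyclic (i + j - 2) (cup f g).
Proof.
move=> [fz fx] [gz gy]; rewrite /HCbracket /HHcup_dual fx gy.
rewrite !(HHmap_inv_cls Tl TL TR TK PK) ?TKf; try exact: Tz.
rewrite (HHcup_cls fz gz) (HHmap_cls Tl TL TR); last exact: HHcocycle_cup.
by rewrite -/(to_cyclic _ _) to_cyclic_regrade.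
Qed.

(** A Batalin-Vilkovisky operator has order two. Expanding the brackets in
    the Poisson identity for {f, g u h} by [bracket_Delta] leaves only the
    terms where Delta is applied to a product. *)
Lemma Delta_cup3 i j l f g h :
  HHcocycle i f -> HHcocycle j g -> HHcocycle l h ->
  Delta f = 0 -> Delta g = 0 -> Delta h = 0 ->
  HHcls AA (i + (j + l) - 1) (Delta (cup f (cup g h))) =
  HHcls AA (i + (j + l) - 1) (cup (Delta (cup f g)) h)
  + sgn i *: HHcls AA (i + (j + l) - 1) (cup f (Delta (cup g h)))
  + sgn ((i - 1) * j) *: HHcls AA (i + (j + l) - 1) (cup g (Delta (cup f h))).
Proof.
move=> fz gz hz df dg dh.
have c0l u : cup (0 : seq A -> AA) u = 0 by apply/funext => s; apply: cup0l.
have c0r u : cup u (0 : seq A -> AA) = 0 by apply/funext => s; apply: cup0r.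
have ghz := HHcocycle_cup gz hz.
have := bracket_cup fz gz hz.
rewrite (bracket_Delta Tl TL TR TK PK fz ghz) df c0l HHcls0 subr0.
have brD p q (a b : seq A -> AA) : HHcocycle p a -> HHcocycle q b -> Delta a = 0 -> Delta b = 0 ->
    HHcls AA (p + q - 1) (brk (odd `|p|%N) (odd `|q|%N) a b) =
    HHcls AA (p + q - 1) (sgn p *: Delta (cup a b)).
  move=> az bz da db; rewrite (bracket_Delta Tl TL TR TK PK az bz) da db c0l c0r HHcls0.
  rewrite scaler0 !subr0 HHclsZ //.
  exact: (HHcocycle_Delta Tl TL TR TK PK (HHcocycle_cup az bz)).
have Dz p q (a b : seq A -> AA) : HHcocycle p a -> HHcocycle q b -> HHcocycle (p + q - 1) (Delta (cup a b)).
  by move=> az bz; apply: (HHcocycle_Delta Tl TL TR TK PK); apply: HHcocycle_cup.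
have E1 : HHcls AA (i + (j + l) - 1) (cup (brk (odd `|i|%N) (odd `|j|%N) f g) h) =
    sgn i *: HHcls AA (i + (j + l) - 1) (cup (Delta (cup f g)) h).
  rewrite -(deg_br_cup i j l) -(HHcup_cls (HHcocycle_brk fz gz) hz) (brD _ _ _ _ fz gz df dg).
  rewrite (HHcup_cls (HHcocycleZ _ (Dz _ _ _ _ fz gz)) hz).
  rewrite -HHclsZ; last exact: HHcocycle_cup (Dz _ _ _ _ fz gz) hz.
  by rewrite cupZl.
have E2 : HHcls AA (i + (j + l) - 1) (cup g (brk (odd `|i|%N) (odd `|l|%N) f h)) =
    sgn i *: HHcls AA (i + (j + l) - 1) (cup g (Delta (cup f h))).
  rewrite -(deg_cup_br i j l) -(HHcup_cls gz (HHcocycle_brk fz hz)) (brD _ _ _ _ fz hz df dh).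
  rewrite (HHcup_cls gz (HHcocycleZ _ (Dz _ _ _ _ fz hz))).
  rewrite -HHclsZ; last exact: HHcocycle_cup gz (Dz _ _ _ _ fz hz).
  by rewrite cupZr.
rewrite E1 E2 [j * _]mulrC => /(congr1 (fun z => sgn i *: z)).
rewrite scalerA sgnK scale1r => /eqP; rewrite subr_eq => /eqP ->.
have e2 := sgnK k i; move: (HHcls _ _ _) (HHcls _ _ _) (HHcls _ _ _) => x y z.
lin_using e2 e2.
Qed.

(** By [HCbracketE], the double brackets are the images under I of the
    three products on the right of [Delta_cup3], and I kills the left-hand
    side by [to_cyclic_Delta]. *)
Lemma HC_lie : graded_lie_algebra_m2 (G := HC A) (@HCbracket k A Theta).
Proof.
have degE (i j : int) : i - 1 + (j - 1) = i + j - 2 by exact: deg_lie.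
have czE (i j : int) f g : HHcocycle (i - 1) f -> HHcocycle (j - 1) g ->
    HHcocycle (i + j - 2) (cup f g : seq A -> AA).
  by move=> fz gz; rewrite -degE; apply: HHcocycle_cup.
split.
- split=> [i j c a a' b | i j c a b b'].
    have [f fb _] := boundary_exists a; have [f' fb' _] := boundary_exists a'.
    have [g gb _] := boundary_exists b.
    rewrite (HCbracketE (boundary_linear c fb fb') gb) (HCbracketE fb gb) (HCbracketE fb' gb).
    case: fb fb' gb => [fz _] [fz' _] [gz _].
    have -> : cup (c *: f + f') g = c *: (cup f g : seq A -> AA) + cup f' g.
      by apply/funext => s; apply: cupPl.
    rewrite (to_cyclic_linear c (czE _ _ _ _ fz gz) (czE _ _ _ _ fz' gz)).
    by move: (to_cyclic _ _) (to_cyclic _ _) => x y; lin.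
  have [f fb _] := boundary_exists a; have [g gb _] := boundary_exists b.
  have [g' gb' _] := boundary_exists b'.
  rewrite (HCbracketE fb (boundary_linear c gb gb')) (HCbracketE fb gb) (HCbracketE fb gb').
  case: fb gb gb' => [fz _] [gz _] [gz' _].
  have -> : cup f (c *: g + g') = c *: (cup f g : seq A -> AA) + cup f g'.
    by apply/funext => s; apply: cupPr.
  rewrite (to_cyclic_linear c (czE _ _ _ _ fz gz) (czE _ _ _ _ fz gz')).
  by move: (to_cyclic _ _) (to_cyclic _ _) => x y; lin.
- move=> i j a b; have [f fb _] := boundary_exists a; have [g gb _] := boundary_exists b.
  rewrite (HCbracketE fb gb) (HCbracketE gb fb).
  case: fb gb => [fz _] [gz _].
  rewrite regradeZ to_cyclic_regrade.
  have -> : to_cyclic (i + j - 2) (cup f g) =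
      sgn ((i - 1) * (j - 1)) *: to_cyclic (i + j - 2) (cup g f).
    have gfz := czE _ _ _ _ gz fz; rewrite (addrC j) in gfz.
    rewrite -(to_cyclicZ (sgn ((i - 1) * (j - 1))) gfz).
    apply: (to_cyclic_eq (czE _ _ _ _ fz gz) (HHcocycleZ _ gfz)).
    rewrite (HHclsZ _ gfz); have := cup_commutes fz gz.
    by case: _ / (degE i j).
  rewrite !sgnM !odd_abs_pred !sgnE; move: (to_cyclic _ _) => x.
  by case: (odd _); case: (odd _); rewrite /= ?expr0 ?expr1; lin.
- move=> i j l a b c.
  have [f fb df] := boundary_exists a; have [g gb dg] := boundary_exists b.
  have [h hb dh] := boundary_exists c.
  have [fz _] := fb; have [gz _] := gb; have [hz _] := hb.
  have ghb := boundaryZ (sgn j) (boundary_to_cyclic (czE _ _ _ _ gz hz)).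
  have fgb := boundaryZ (sgn i) (boundary_to_cyclic (czE _ _ _ _ fz gz)).
  have fhb := boundaryZ (sgn i) (boundary_to_cyclic (czE _ _ _ _ fz hz)).
  rewrite (HCbracketE gb hb) (HCbracketE fb gb) (HCbracketE fb hb).
  rewrite (HCbracketE fb ghb) (HCbracketE fgb hb) (HCbracketE gb fhb).
  rewrite !cupZl !cupZr !regradeZ !to_cyclic_regrade.
  pose N : int := i + (j + l - 2) - 2.
  have Ndeg : i - 1 + (j - 1 + (l - 1)) - 1 = N by rewrite /N; lia.
  have Dz (p q : int) u v : HHcocycle (p - 1) u -> HHcocycle (q - 1) v ->
      HHcocycle (p + q - 2 - 1) (Delta (cup u v)).
    by move=> uz vz; apply: (HHcocycle_Delta Tl TL TR TK PK); apply: czE.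
  have z1 : HHcocycle N (cup f (Delta (cup g h)) : seq A -> AA).
    have := HHcocycle_cup fz (Dz _ _ _ _ gz hz).
    by rewrite (_ : i - 1 + (j + l - 2 - 1) = N) // /N; lia.
  have z2 : HHcocycle N (cup (Delta (cup f g)) h : seq A -> AA).
    have := HHcocycle_cup (Dz _ _ _ _ fz gz) hz.
    by rewrite (_ : i + j - 2 - 1 + (l - 1) = N) // /N; lia.
  have z3 : HHcocycle N (cup g (Delta (cup f h)) : seq A -> AA).
    have := HHcocycle_cup gz (Dz _ _ _ _ fz hz).
    by rewrite (_ : j - 1 + (i + l - 2 - 1) = N) // /N; lia.
  have fghz := HHcocycle_cup fz (HHcocycle_cup gz hz).
  have D3 := Delta_cup3 fz gz hz df dg dh; rewrite Ndeg in D3.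
  have z0 : HHcocycle N (Delta (cup f (cup g h))).
    by rewrite -Ndeg; apply: (HHcocycle_Delta Tl TL TR TK PK).
  (* The image of Delta_cup3 under I. *)
  have J : 0 = to_cyclic N (cup (Delta (cup f g)) h)
      + (sgn (i - 1) *: to_cyclic N (cup f (Delta (cup g h)))
         + sgn ((i - 1 - 1) * (j - 1)) *: to_cyclic N (cup g (Delta (cup f h)))).
    have <- : to_cyclic N (Delta (cup f (cup g h))) = 0.
      by have := to_cyclic_Delta fghz; rewrite Ndeg.
    have y3 := HHcocycleZ (sgn ((i - 1 - 1) * (j - 1))) z3.
    have y13 := HHcocycle_lin (sgn (i - 1)) z1 y3.
    rewrite -(to_cyclicZ (sgn ((i - 1 - 1) * (j - 1))) z3) -(to_cyclic_linear _ z1 y3).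
    rewrite -[X in X + _]scale1r -(to_cyclic_linear _ z2 y13).
    apply: (to_cyclic_eq z0 (HHcocycle_lin 1 z2 y13)).
    rewrite D3 (HHcls_linear _ z2 y13) scale1r (HHcls_linear _ z1 y3).
    by rewrite (HHclsZ _ z3) addrA.
  rewrite -/N (to_cyclicZ (sgn j) z1) (to_cyclicZ (sgn i) z2) (to_cyclicZ (sgn i) z3).
  move: (to_cyclic N _) (to_cyclic N _) (to_cyclic N _) J => P Q R.
  move=> /esym/eqP; rewrite addr_eq0 => /eqP ->.
  have e2 : odd `|(i + j - 2)%R|%N = odd `|i|%N (+) odd `|j|%N by lia.
  rewrite !sgnM !sgnE !odd_abs_pred e2.
  by case: (odd _); case: (odd _); rewrite /= ?expr0 ?expr1; lin.
Qed.

Lemma HH_operations_induced : operations_induced Theta.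
Proof.
split.
- exact: HHcocycle_one.
- move=> i j f g fz gz; have [[_ fs] _] := fz; rewrite (cup_cochainE _ fs).
  by split; [apply: HHcocycle_cup | apply: HHcup_cls].
- move=> i j f g fz gz; have [[fl fs] _] := fz; have [[gl gs] _] := gz.
  rewrite (bracket_cochainE fl gl fs gs).
  by split; [apply: HHcocycle_brk | apply: HHbracket_cls].
- by move=> i f fz; split; [apply: Tz | apply: HHmap_cls].
- exact: (HHmap_bij Tl TL TR TK PK).
- exact: (nrep_exists Tl TL TR TK PK).
- move=> i F _ Fz; split; first exact: (HHcocycle_connesB Tl TL TR TK PK).
  exact: (HHconnes_cls Tl TL TR TK PK).
- move=> i F Fn Fz; split; first exact: HCcocycle_incl.
  exact: (HCI_cls Tl TL TR TK PK).
- move=> i c cz; split; last exact: (HCpartial_cls Tl TL TR TK PK).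
  by have [] := HCcocycle0th Tl TL TR TK PK cz.
Qed.

End CyclicLie.

Theorem theorem1p4 (k : comPzRingType) (A : algType k)
    (Theta : regular_bimod A -> dual_bimod A) (Theta_iso : bimodule_iso Theta) :
  [/\ operations_induced Theta,
      BV_algebra (G := HH (regular_bimod A)) (HHone A)
        (@HHcup k A) (@HHbracket k A) (@HHdelta k A Theta)
    & graded_lie_algebra_m2 (G := HC A) (@HCbracket k A Theta)].
Proof.
have [Tl TL TR [Psi TK PK]] := Theta_iso; split.
- exact: (HH_operations_induced Tl TL TR TK PK).
- exact: (HH_BV Tl TL TR TK PK).
- exact: (HC_lie Tl TL TR TK PK).
Qed.
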